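(* Let $m\ge 1$, $\mathbf x=(x_1,\dots,x_m)\in\mathcal X^m$ and $\mathbf t=(t_1,\dots,t_m)\in\mathbb R^m$. Assume: (A1) $\mathcal Y$ is compact; (A2) for every $t\in\mathcal Y$, the functions $x\mapsto F_n(x,t)$, $n\ge 0$, are equicontinuous, $\mathbb P$-a.s.; (A3) for every $x$ and $t$, $\sum_{k\ge n}\mathbb E(\Delta_k(x,t)\mid Z_{1:k-1})\to 0$ as $n\to\infty$, $\mathbb P$-a.s. Let $\tilde F$ be the limit of the sequence $(F_n)$, i.e. the random function such that, $\mathbb P$-a.s., $F_n(x,\cdot)\to\tilde F(x,\cdot)$ weakly for every $x\in\mathcal X$ (it exists under (A1)–(A3)), and suppose that $\mathbf t$ is a continuity point of $\mathbb E[\tilde{\mathbf F}(\mathbf x,\cdot)]$, i.e. for each $i$ the distribution function $\mathbb E[\tilde F(x_i,\cdot)]$ is continuous at $t_i$. Suppose moreover that there exists $\gamma\in(0,1]$ for which the following hold: (ia) for $i=1,\dots,m$, the sequences $n^{\gamma/2}\sum_{k>n}\mathbb E(\Delta_k(x_i,t_i)\mid Z_{1:k-1})$ and $n^{\gamma/2}\sup_{k\ge n}|\mathbb E(\Delta_k(x_i,t_i)\mid Z_{1:k-1})|$ converge to zero $\mathbb P$-a.s. as $n\to\infty$ and are dominated in $L^1$; (ib) for $i=1,\dots,m$, $n^{\gamma}\sum_{k\ge n}\mathbb E(\Delta_k(x_i,t_i)\mid Z_{1:k-1})^2\to 0$ $\mathbb P$-a.s.; (ii) for $i=1,\dots,m$,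 $\mathbb E\bigl[\sup_{k\ge 1}k^{\gamma/2}|\Delta_k(x_i,t_i)|\bigr]<+\infty$; (iii) the matrix $\mathbf R_n(\mathbf x,\mathbf t):=n^\gamma\sum_{k\ge n+1}\boldsymbol\Delta_k(\mathbf x,\mathbf t)\boldsymbol\Delta_k(\mathbf x,\mathbf t)^\top$ converges $\mathbb P$-a.s. as $n\to\infty$ to a positive definite random matrix $\mathbf V(\mathbf x,\mathbf t)$. Then, $\mathbb P$-a.s. as $n\to\infty$, $$\mathcal L\bigl(n^{\gamma/2}(\mathbf F_n(\mathbf x,\mathbf t)-\tilde{\mathbf F}(\mathbf x,\mathbf t))\mid Z_{1:n}\bigr)\to\mathcal N_m(\mathbf 0,\mathbf V(\mathbf x,\mathbf t))$$ weakly.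
   Context: Setting: $Z_i=(X_i,Y_i)$, $i\ge1$, is a stochastic sequence with law $\mathbb P$, where $X_i\in\mathcal X\subseteq\mathbb R^d$ and $Y_i\in\mathcal Y\subset\mathbb R$ (measurable sets); $Z_{1:n}=(Z_1,\dots,Z_n)$, and conditioning on $Z_{1:0}$ is trivial. For $n\ge0$, $x\in\mathcal X$, $t\in\mathbb R$, the predictive distribution function is $$F_n(x,t)=\mathbb P(Y_{n+1}\le t\mid X_{n+1}=x,Z_{1:n}),\qquad F_0(x,t)=\mathbb P(Y_1\le t\mid X_1=x),$$ a fixed version (predictive kernel) defined for every $x\in\mathcal X$; for fixed $(x,t)$ it is a random variable that is a function of $Z_{1:n}$, and $F_n(x,\cdot)$ is a distribution function. For $n\ge1$, $\Delta_n(x,t)=F_n(x,t)-F_{n-1}(x,t)$. For vectors $\mathbf x,\mathbf t$: $\mathbf F_n(\mathbf x,\mathbf t)=(F_n(x_1,t_1),\dots,F_n(x_m,t_m))^\top$, $\tilde{\mathbf F}(\mathbf x,\mathbf t)=(\tilde F(x_1,t_1),\dots,\tilde F(x_m,t_m))^\top$, and $\boldsymbol\Delta_n(\mathbf x,\mathbf t)=\mathbf F_n(\mathbf x,\mathbf t)-\mathbf F_{n-1}(\mathbf x,\mathbf t)$. A sequence of random variables is dominated in $L^1$ if there is an integrable random variable bounding the absolute values of all its terms. Statements that infinite sums tend to a limit include the a.s. convergence of the series. $\mathcal L(U\mid Z)$ denotes the (regular) conditional distribution of the random vector $U$ given $Z$. The conclusion means: for $\mathbb P$-almost every $\omega$,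 the conditional distributions evaluated at $\omega$ converge weakly to the centred Gaussian distribution on $\mathbb R^m$ with covariance matrix $\mathbf V(\mathbf x,\mathbf t)(\omega)$. *)

(* Defs.v *)
From HB Require Import structures.
From mathcomp Require Import all_boot all_order all_algebra.
From mathcomp Require Import all_classical all_reals all_analysis.

Set Implicit Arguments.
Unset Strict Implicit.
Unset Printing Implicit Defensive.
Import Order.TTheory GRing.Theory Num.Theory.
Import numFieldNormedType.Exports.

Local Open Scope classical_set_scope.
Local Open Scope ring_scope.

(* R^k with its Borel sigma-algebra. The carrier is convertible to 'cV[R]_k,
   but the topology is only inferred on the latter. *)
Notation borelV R k := (g_sigma_algebraType (@open 'cV[R]_k)).

(* sum_(k >= n) a k. As a bare [lim] it is only meaningful when the series
   converges, so statements about it come with [cvgn (series a)]. *)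
Definition tail {R : realType} {V : normedModType R} (a : nat -> V) (n : nat)
    : V :=
  limn (fun N => \sum_(n <= k < N) a k).

Definition is_cdf {R : realType} (G : R -> R) : Prop :=
  [/\ {homo G : s t / s <= t}, right_continuous G,
      G s @[s --> -oo] --> (0 : R) & G s @[s --> +oo] --> (1 : R)].

Definition weak_cvg_cdf {R : realType} (G : nat -> R -> R) (H : R -> R)
    : Prop :=
  forall t : R, {for t, continuous H} -> G n t @[n --> \oo] --> H t.

Definition weak_cvg {R : realType} {m : nat}
    (mu : nat -> probability (borelV R m) R) (nu : probability (borelV R m) R)
    : Prop :=
  forall f : 'cV[R]_m -> R, continuous f ->
    (exists M : R, forall u, `|f u| <= M) ->
    (\int[mu n]_u (f u)%:E)%E @[n --> \oo] --> (\int[nu]_u (f u)%:E)%E.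

(* N(0, v) on the line; the library's [normal_prob m 0] is not a Dirac mass,
   hence the case distinction. *)
Definition centred_normal {R : realType} (v : R) (B : set R) : \bar R :=
  if v == 0 then \d_(0 : R) B else normal_prob (0 : R) (Num.sqrt v) B.

(* N_m(0, V): a^T U ~ N(0, a^T V a) for every vector a. *)
Definition is_centred_gaussian {R : realType} {m : nat} (V : 'M[R]_m)
    (N : probability (borelV R m) R) : Prop :=
  forall (a : 'cV[R]_m) (B : set R), measurable B ->
    N [set u | B ((a^T *m (u : 'cV[R]_m)) 0 0)] =
    centred_normal ((a^T *m V *m a) 0 0) B.

Definition posdef {R : realType} {m : nat} (V : 'M[R]_m) : Prop :=
  V^T = V /\ forall u : 'cV[R]_m, u != 0 -> 0 < (u^T *m V *m u) 0 0.

Section conditioning.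
Context {d0 : measure_display} {T : measurableType d0} {R : realType}.
Variable P : probability T R.

(* g is a version of E(f | G), for a sub-sigma-algebra G. *)
Definition is_condexp (G : set (set T)) (f g : T -> R) : Prop :=
  [/\ forall B : set R, measurable B -> G (g @^-1` B),
      P.-integrable [set: T] (EFin \o g) &
      forall A, G A ->
        (\int[P]_(w in A) (g w)%:E = \int[P]_(w in A) (f w)%:E)%E].

(* L is a version of the regular conditional distribution of U given G. *)
Definition is_cond_law {m : nat} (G : set (set T)) (U : T -> 'cV[R]_m)
    (L : T -> probability (borelV R m) R) : Prop :=
  forall B : set (borelV R m), measurable B ->
    is_condexp G (\1_(U @^-1` B)) (fun w => fine (L w B)).

Definition dominated_L1 (u : nat -> T -> \bar R) : Prop :=
  exists2 g : T -> R, P.-integrable [set: T] (EFin \o g) &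
    {ae P, forall w, forall n, (`|u n w| <= (g w)%:E)%E}.

End conditioning.

(* The observations are Z_i = (X_i, Y_i) for i >= 1; index 0 is unused. *)
Section predictive.
Context {d0 : measure_display} {T : measurableType d0} {R : realType} {d : nat}.
Variables (X : nat -> T -> borelV R d) (Y : nat -> T -> R).

(* Z_{1:n} *)
Definition past (n : nat) (w : T) : n.-tuple (borelV R d * R)%type :=
  [tuple (X i.+1 w, Y i.+1 w) | i < n].

Definition sigma_past (n : nat) : set (set T) :=
  g_sigma_algebra_preimage (past n).

(* K n (x, z) is the conditional law of Y_{n+1} given X_{n+1} = x and
   Z_{1:n} = z. *)
Variable K :
  forall n : nat, R.-pker (borelV R d * n.-tuple (borelV R d * R))%type ~> R.

Definition pred_cdf (n : nat) (x : 'cV[R]_d) (t : R) (w : T) : R :=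
  fine (K n ((x : borelV R d), past n w) [set` `]-oo, t]]).

Definition is_predictive (P : probability T R) : Prop :=
  forall (n : nat) (t : R),
    is_condexp P (g_sigma_algebra_preimage (fun w => (X n.+1 w, past n w)))
      (\1_[set w | Y n.+1 w <= t]) (fun w => pred_cdf n (X n.+1 w) t w).

(* Delta_n, for n >= 1 (and Delta_0 = 0). *)
Definition pred_incr (n : nat) (x : 'cV[R]_d) (t : R) (w : T) : R :=
  pred_cdf n x t w - pred_cdf n.-1 x t w.

End predictive.

(* (f(x_1, t_1), ..., f(x_m, t_m))^T for a random function f. *)
Definition vec_at {T : Type} {R : realType} {d m : nat}
    (f : 'cV[R]_d -> R -> T -> R) (x : 'I_m -> 'cV[R]_d) (t : 'I_m -> R)
    (w : T) : 'cV[R]_m :=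
  \col_(i < m) f (x i) (t i) w.

(* Main.v *)
(** Let al_n = n^(gam/2). For a rational vector u, the variables
    e_k = u.(E(Delta_k | Z_{1:k-1}) - Delta_k) are martingale differences. By (ia),
    al_n u.(F_n - Ft) is al_n \sum_(k > n) e_k up to a vanishing term, and by (ib)
    and (iii), al_n^2 \sum_(k > n) e_k^2 tends to u^T V u. Stop the increments
    z_k = al_n e_(n+k) once their quadratic variation Q exceeds a level c. The
    product T of the 1 + i z_k (McLeish) then has conditional mean 1 given Z_{1:n},
    it is dominated thanks to (ia) and (ii), and exp(i \sum z_k) is close to
    T exp(-Q/2). Since Q is close to u^T V u, which is itself approximated in L^1 by
    a Z_{1:N}-measurable variable with N fixed, the conditional characteristic
    function tends to exp(-u^T V u/2). The estimates are integrated over the events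
    of Z_{1:n} for all n >= N at once; a maximal inequality makes them almost sure.
    The same scheme applied to sqrt(1 + (\sum z_k)^2) gives conditional tightness.
    Rational u suffice in Levy's continuity theorem, which follows from
    approximation by Bernstein polynomials in the sines of the coordinates, so that
    a single null set serves all test functions. *)

Require Import Defs.
From HB Require Import structures.
From mathcomp Require Import all_boot all_order all_algebra.
From mathcomp Require Import all_classical all_reals all_analysis.
From mathcomp Require Import measurable_realfun.
From mathcomp Require Import ring lra.
Set Implicit Arguments.
Unset Strict Implicit.
Unset Printing Implicit Defensive.
Import Order.TTheory GRing.Theory Num.Theory.
Import numFieldNormedType.Exports.
Local Open Scope classical_set_scope.
Local Open Scope ring_scope.

(** * Integration *)

(** The obstacle is that V is random and known only in the limit. The conditional mean of T is
    usable only against Z_{1:n}-measurable factors, so exp(-Q/2) is traded for a fixed Phi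
    measurable for Z_{1:N}. The error of this trade is multiplied by |T|, hence exp(-V/2) must be
    approximated in L^1 with a weight that dominates |T|. Stopping supplies the weight: only the
    last factor of T passes the level c, so |T| is at most a constant times 1 + |D|, where D is the
    integrable bound of al_k |e_k|. The cap at c costs an error carried by V > c - 1, which
    disappears when c runs through the integers. All estimates are upper bounds, the form that suits
    Fatou's lemma and the maximal inequality; lower bounds come from shifting the phase by pi. The
    maximal inequality asks for one error function valid for every n >= N, whence the suprema of
    tails. Testing with cos(x - th), the real part of exp(ix) exp(-i th), keeps every estimate real
    and one-sided. *)

Section dominated.
Context {d : measure_display} {T : measurableType d} {R : realType}.
Variable mu : {measure set T -> \bar R}.

Lemma Rintegral_dominated (A : set T) (f_ : nat -> T -> R) (f g : T -> R) : measurable A ->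
  (forall n, measurable_fun [set: T] (f_ n)) -> measurable_fun [set: T] f ->
  {ae mu, forall w, f_ ^~ w @ \oo --> f w} -> mu.-integrable [set: T] (EFin \o g) ->
  {ae mu, forall w n, `|f_ n w| <= g w} ->
  mu.-integrable [set: T] (EFin \o f) /\
  \int[mu]_(w in A) f_ n w @[n --> \oo] --> \int[mu]_(w in A) f w.
Proof.
move=> mA mf_ mf cf ig fg.
have H (B : set T) : measurable B -> mu.-integrable B (EFin \o f) /\
    (\int[mu]_(w in B) (f_ n w)%:E @[n --> \oo] --> \int[mu]_(w in B) (f w)%:E)%E.
  move=> mB; have [|||||? _ ?] := @dominated_convergence _ _ _ mu B mB
      (fun n => EFin \o f_ n) (EFin \o f) (EFin \o g).
  - by move=> n; exact/measurable_EFinP/measurable_funTS.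
  - exact/measurable_EFinP/measurable_funTS.
  - by apply: filterS cf => w cf _; apply: cvg_EFin; [exact: nearW|exact: cf].
  - exact: (integrableS measurableT mB (@subsetT _ _) ig).
  - by apply: filterS fg => w fg n _ /=; rewrite lee_fin.
  - by split.
have [intf _] := H _ measurableT; split=> //.
have [_ c] := H _ mA; apply: fine_cvg; rewrite fineK//.
by apply: integrable_fin_num => //; exact: (integrableS measurableT mA (@subsetT _ _) intf).
Qed.

End dominated.

Section integration.
Context {d : measure_display} {T : measurableType d} {R : realType}.
Variable P : probability T R.
Implicit Types (A : set T) (f g h : T -> R).

Local Notation intg f := (P.-integrable [set: T] (EFin \o f)).

Lemma integrable_measurable f : intg f -> measurable_fun [set: T] f.
Proof. by move=> /measurable_int/measurable_EFinP. Qed.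

Lemma integrable_sub A f : measurable A -> intg f ->
  P.-integrable A (EFin \o f).
Proof. by move=> mA; exact: integrableS. Qed.

Lemma bounded_integrable f M : measurable_fun [set: T] f ->
  (forall w, `|f w| <= M) -> intg f.
Proof.
move=> mf fM; apply: measurable_bounded_integrable => //.
  by rewrite ltey_eq fin_num_measure.
exists M; split; first exact: num_real.
by move=> x Mx w _ /=; apply: (le_trans (fM w)); exact: ltW.
Qed.

Lemma integrable_cst (c : R) : intg (fun=> c).
Proof. exact: (bounded_integrable (M := `|c|)). Qed.

Lemma integrable_add f g : intg f -> intg g -> intg (fun w => f w + g w).
Proof. exact: integrableD. Qed.

Lemma integrable_sub_fun f g : intg f -> intg g -> intg (fun w => f w - g w).
Proof. exact: integrableB. Qed.

Lemma integrable_scale (c : R) f : intg f -> intg (fun w => c * f w).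
Proof. by move=> /(integrableZl measurableT c); exact: eq_integrable. Qed.

Lemma ae_le_integrable f g : measurable_fun [set: T] f -> intg g ->
  {ae P, forall w, `|f w| <= g w} -> intg f.
Proof.
move=> mf ig fg; apply/integrableP; split; first exact/measurable_EFinP.
have /integrableP[_ goo] := ig.
apply: le_lt_trans goo; apply: ae_ge0_le_integral => //.
- by apply: measurableT_comp => //; exact/measurable_EFinP.
- apply: measurableT_comp => //; apply/measurable_EFinP.
  exact: integrable_measurable.
- by apply: filterS fg => w fg _ /=; rewrite lee_fin (le_trans fg)// ler_norm.
Qed.

Lemma integrable_normr f : intg f -> intg (fun w => `|f w|).
Proof. by move=> ?; apply: integrable_norm. Qed.

Lemma integrable_mulr f g M : intg f -> measurable_fun [set: T] g ->
  (forall w, `|g w| <= M) -> intg (fun w => f w * g w).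
Proof.
move=> intf mg gM; have mf := integrable_measurable intf.
apply: (@ae_le_integrable _ (fun w => M * `|f w|)).
- exact: measurable_funM.
- by apply: integrable_scale; exact: integrable_normr.
- by apply: aeW => w; rewrite normrM mulrC ler_wpM2r.
Qed.

Lemma ae_eq_Rintegral A f g : measurable A ->
  measurable_fun [set: T] f -> measurable_fun [set: T] g ->
  {ae P, forall w, f w = g w} ->
  \int[P]_(w in A) f w = \int[P]_(w in A) g w.
Proof.
move=> mA mf mg fg; congr fine; apply: ae_eq_integral => //.
- exact/measurable_EFinP/measurable_funTS.
- exact/measurable_EFinP/measurable_funTS.
- by apply: filterS fg => w -> _.
Qed.

Lemma ae_le_Rintegral A f g : measurable A -> intg f -> intg g ->
  {ae P, forall w, f w <= g w} ->
  \int[P]_(w in A) f w <= \int[P]_(w in A) g w.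
Proof.
move=> mA intf inteG fg.
have mf := integrable_measurable intf; have mg := integrable_measurable inteG.
(* [le_Rintegral] asks for an inequality at every point, so f is replaced by its minimum with g,
   equal to it almost surely. *)
have mh : measurable_fun [set: T] (f \min g) by exact: measurable_minr.
rewrite (@ae_eq_Rintegral A f (f \min g))//; last first.
  by apply: filterS fg => w fg /=; rewrite min_l.
apply: le_Rintegral => //; try exact: integrable_sub.
  apply: integrable_sub => //.
  apply: (@ae_le_integrable _ (fun w => `|f w| + `|g w|)) => //.
    by apply: integrable_add; exact: integrable_normr.
  by apply: aeW => w /=; rewrite /Order.min; case: ifP => _; rewrite ?lerDl ?lerDr.
by move=> w _ /=; rewrite ge_min lexx orbT.
Qed.

Lemma Rintegral_indicM A f : measurable A -> intg f ->
  \int[P]_(w in A) f w = \int[P]_w (f w * \1_A w).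
Proof.
move=> mA intf; rewrite Rintegral_mkcond; apply: eq_Rintegral => w _.
by rewrite /patch indicE; case: ifP; rewrite ?mulr1 ?mulr0.
Qed.

Lemma Rintegral_sub_le A f : measurable A -> intg f ->
  {ae P, forall w, 0 <= f w} -> \int[P]_(w in A) f w <= \int[P]_w f w.
Proof.
move=> mA intf f0; rewrite Rintegral_indicM//; apply: ae_le_Rintegral => //.
  apply: (integrable_mulr (M := 1)) => // w.
  by rewrite indicE; case: (_ \in _); rewrite ?normr1 ?normr0.
apply: filterS f0 => w f0; rewrite indicE.
by case: (_ \in _); rewrite ?mulr1 ?mulr0.
Qed.

Lemma Rintegral_prob_cst (c : R) : \int[P]_w c = c.
Proof.
rewrite Rintegral_cst//; transitivity (c * fine 1%E); last by rewrite mulr1.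
by congr (c * fine _); exact: probability_setT.
Qed.

(** Selects a measurable limit without locating the set of convergence: the upper limit is always
    measurable, and [fine] returns the limit wherever it is a real number. *)
Lemma ae_cvg_measurable (f_ : nat -> T -> R) :
  (forall n, measurable_fun [set: T] (f_ n)) ->
  exists2 f, measurable_fun [set: T] f &
    forall w (l : R), f_ ^~ w @ \oo --> l -> f w = l.
Proof.
move=> mf_; exists (fun w => fine (limn_esup (fun n => (f_ n w)%:E))).
  apply: measurableT_comp => //; apply: measurable_fun_limn_esup => n.
  exact/measurable_EFinP.
move=> w l fl; rewrite limn_esup_lim.
have /cvg_esups/cvg_lim -> // : (f_ n w)%:E @[n --> \oo] --> l%:E.
by apply: cvg_EFin fl; exact: nearW.
Qed.

(* Replaces the supremum of a tail, which need not be finite everywhere. *)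
Lemma tail_majorant (b : nat -> T -> R) g :
  (forall k, measurable_fun [set: T] (b k)) -> intg g ->
  {ae P, forall w k, `|b k w| <= g w} ->
  exists s : nat -> T -> R, [/\ forall n, intg (s n),
    {ae P, forall w n, 0 <= s n w <= g w},
    {ae P, forall w n k, (n <= k)%N -> `|b k w| <= s n w} &
    {ae P, forall w, b ^~ w @ \oo --> (0 : R) ->
       s ^~ w @ \oo --> (0 : R)}].
Proof.
move=> mb ig bg.
pose s n w := fine (esups (fun k => `|b k w|%:E) n).
have ms n : measurable_fun [set: T] (s n).
  apply: measurableT_comp => //; apply: measurable_fun_esups => k.
  by apply/measurable_EFinP; exact: measurableT_comp.
have sP w n : (forall k, `|b k w| <= g w) ->
    (s n w)%:E = esups (fun k => `|b k w|%:E) n /\ 0 <= s n w <= g w.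
  move=> bgw.
  have ub : (esups (fun k => `|b k w|%:E) n <= (g w)%:E)%E.
    by apply: ge_ereal_sup => _ [k _ <-]; rewrite lee_fin.
  have lb : ((`|b n w|)%:E <= esups (fun k => `|b k w|%:E) n)%E.
    by apply: ereal_sup_ubound; exists n => /=.
  have fin : esups (fun k => `|b k w|%:E) n \is a fin_num.
    rewrite fin_numElt (le_lt_trans ub) ?ltry// andbT.
    by apply: lt_le_trans lb; rewrite ltNyr.
  split; first by rewrite fineK.
  by rewrite -!lee_fin fineK// ub andbT; apply: le_trans lb; rewrite lee_fin.
exists s; split.
- move=> n; apply: (ae_le_integrable (ms n) ig).
  by apply: filterS bg => w /(sP _ n)[_ /andP[? ?]]; rewrite ger0_norm.
- by apply: filterS bg => w bgw n; have [] := sP w n bgw.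
- apply: filterS bg => w bgw n k nk; have [E _] := sP w n bgw.
  by rewrite -lee_fin E; apply: ereal_sup_ubound; exists k.
- apply: filterS bg => w bgw b0; apply/cvgrPdist_le => e e0.
  have /cvgrPdist_le/(_ _ e0)[N _ HN] := b0.
  exists N => // n /= Nn; rewrite sub0r normrN.
  have [E /andP[s0 _]] := sP w n bgw.
  rewrite ger0_norm// -lee_fin E; apply: ge_ereal_sup => _ [k /= nk <-].
  by rewrite lee_fin; have := HN k (leq_trans Nn nk); rewrite sub0r normrN.
Qed.

(** The sequence is dominated from above only. Dominated convergence is therefore applied to
    max(f_n, Y), which is bounded below by Y, dominates f_n and converges to Y. *)
Lemma reverse_fatou A (kap : R) (f_ : nat -> T -> R) g Y : measurable A ->
  (forall n, intg (f_ n)) -> intg g -> intg Y ->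
  (forall n, \int[P]_(w in A) f_ n w = kap) ->
  {ae P, forall w n, f_ n w <= g w} ->
  {ae P, forall w e, 0 < e -> \forall n \near \oo, f_ n w <= Y w + e} ->
  kap <= \int[P]_(w in A) Y w.
Proof.
move=> mA if_ ig iY fkap fg fY.
pose h n w := Num.max (f_ n w) (Y w).
have mh n : measurable_fun [set: T] (h n).
  by apply: measurable_maxr; exact: integrable_measurable.
have hdom : {ae P, forall w n, `|h n w| <= `|g w| + `|Y w|}.
  apply: filterS fg => w fgw n; rewrite /h; have := fgw n.
  have := ler_norm (g w); have := ler_norm (Y w); have := ler_norm (- Y w).
  rewrite normrN => *; rewrite ler_norml.
  have : Num.max (f_ n w) (Y w) <= `|g w| + `|Y w|.
    by rewrite ge_max; apply/andP; split; have := normr_ge0 (g w);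
      have := normr_ge0 (Y w); lra.
  have : Y w <= Num.max (f_ n w) (Y w) by rewrite le_max lexx orbT.
  by have := normr_ge0 (g w); have := normr_ge0 (Y w); lra.
have idom : intg (fun w => `|g w| + `|Y w|).
  by apply: integrable_add; exact: integrable_normr.
have [] := Rintegral_dominated mA mh (integrable_measurable iY) _ idom hdom.
  apply: filterS fY => w fYw; apply/cvgrPdist_le => e e0.
  apply: filterS (fYw e e0) => n fn; rewrite distrC ger0_norm ?subr_ge0.
    by rewrite lerBlDr /h ge_max addrC fn/= lerDl ltW.
  by rewrite /h le_max lexx orbT.
move=> _ hY; rewrite -(cvg_lim _ hY)//; apply: limr_ge; first by apply/cvg_ex; eexists; exact: hY.
apply: nearW => n; rewrite -(fkap n); apply: ae_le_Rintegral => //.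
  apply: ae_le_integrable (mh n) idom _.
  by apply: filterS hdom => w.
by apply: aeW => w; rewrite /h le_max lexx.
Qed.

End integration.

(** * Stopped products *)

Section elementary.
Context {R : realType}.
Implicit Types s x y : R.

(** Each Taylor bound below follows from the previous one, which states that the derivative of the
    next error is nonnegative. *)
Lemma ge0_from_derivative (f g : R -> R) : f 0 = 0 ->
  (forall x, is_derive x 1 f (g x)) -> (forall x, 0 <= x -> 0 <= g x) ->
  forall x, 0 <= x -> 0 <= f x.
Proof.
move=> f0 df g0 x; rewrite le_eqVlt => /predU1P[<-|x0]; first by rewrite f0.
have cf : {within `[0, x], continuous f}.
  by apply: derivable_within_continuous => y _; exact: ex_derive.
have [c] := @MVT _ f g 0 x x0 (fun y _ => df y) cf.
rewrite in_itv/= => /andP[c0 cx]; rewrite f0 subr0 => ->.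
by rewrite subr0 mulr_ge0 ?g0 ?ltW.
Qed.

Lemma sin_le x : 0 <= x -> sin x <= x.
Proof.
move=> x0; rewrite -subr_ge0.
apply: (@ge0_from_derivative (fun x => x - sin x) (fun x => 1 - cos x)) => //.
by rewrite sin0 subr0.
Qed.

Lemma cos_ge x : 0 <= x -> 1 - x ^+ 2 / 2 <= cos x.
Proof.
move=> x0; rewrite -subr_ge0.
apply: (@ge0_from_derivative (fun x => cos x - (1 - x ^+ 2 / 2))
  (fun x => x - sin x)) => //.
- by rewrite cos0; lra.
- move=> y; apply: is_derive_eq.
  by rewrite /GRing.scale/=; field.
- by move=> y y0; rewrite subr_ge0 sin_le.
Qed.

Lemma sin_ge x : 0 <= x -> x - x ^+ 3 / 6 <= sin x.
Proof.
move=> x0; rewrite -subr_ge0.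
apply: (@ge0_from_derivative (fun x => sin x - (x - x ^+ 3 / 6))
  (fun x => cos x - (1 - x ^+ 2 / 2))) => //.
- by rewrite sin0; lra.
- move=> y; apply: is_derive_eq.
  by rewrite /GRing.scale/=; field.
- by move=> y y0; rewrite subr_ge0 cos_ge.
Qed.

Lemma cos_le x : 0 <= x -> cos x <= 1 - x ^+ 2 / 2 + x ^+ 4 / 24.
Proof.
move=> x0; rewrite -subr_ge0.
apply: (@ge0_from_derivative (fun x => (1 - x ^+ 2 / 2 + x ^+ 4 / 24) - cos x)
  (fun x => sin x - (x - x ^+ 3 / 6))) => //.
- by rewrite cos0; lra.
- move=> y; apply: is_derive_eq.
  by rewrite /GRing.scale/=; field.
- by move=> y y0; rewrite subr_ge0 sin_ge.
Qed.

(** From e^y >= 1 + y, because (1 + y)(1 - y + y^2) = 1 + y^3 >= 1. *)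
Lemma expRN_le y : 0 <= y -> expR (- y) <= 1 - y + y ^+ 2.
Proof.
move=> y0; rewrite expRN -[leRHS]invrK lef_pV2 ?posrE ?expR_gt0//; last first.
  by rewrite invr_gt0; nra.
have h : 0 < 1 - y + y ^+ 2 by nra.
rewrite (le_trans _ (expR_ge1Dx y))// -div1r ler_pdivrMr//.
have -> : (1 + y) * (1 - y + y ^+ 2) = 1 + y ^+ 3 by ring.
by rewrite lerDl exprn_ge0.
Qed.

Lemma cis_gauss_ge0 s : 0 <= s ->
  `|cos s - expR (- (s ^+ 2 / 2))| <= 2 * s ^+ 3 /\
  `|sin s - s * expR (- (s ^+ 2 / 2))| <= s ^+ 3.
Proof.
move=> s0; set e := expR _.
have e1 : 1 - s ^+ 2 / 2 <= e by rewrite expR_ge1Dx.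
have e2 : e <= 1 - s ^+ 2 / 2 + s ^+ 4 / 4.
  have /expRN_le : 0 <= s ^+ 2 / 2 by rewrite divr_ge0 ?sqr_ge0.
  by rewrite -/e => /le_trans; apply; lra.
have e0 : 0 < e by exact: expR_gt0.
have e3 : e <= 1 by rewrite -expR0 ler_expR; have := sqr_ge0 s; lra.
have := cos_ge s0; have := cos_le s0; have := sin_ge s0; have := sin_le s0.
have := cos_le1 s; have := cos_geN1 s.
have s3 : 0 <= s ^+ 3 by rewrite exprn_ge0.
move=> c1 c2 s1 s2 c3 c4; split; rewrite ler_norml.
  (* For s <= 1 the quartic terms are absorbed by s^3; for s > 1 the difference is at most 2 in
     absolute value, hence at most 2 s^3. *)
  have [sle1|sgt1] := leP s 1.
    have s4 : s ^+ 4 <= s ^+ 3 by rewrite exprS ler_piMl.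
    by lra.
  have : 1 <= s ^+ 3 by rewrite exprn_ege1// ltW.
  by lra.
have : s * e <= s by rewrite ler_piMr.
have : s * (1 - s ^+ 2 / 2) <= s * e by rewrite ler_wpM2l.
by rewrite (_ : s * (1 - s ^+ 2 / 2) = s - s ^+ 3 / 2); [lra|field].
Qed.

(** The estimate for one factor of the product: the distance between e^(is) and (1 + is) e^(-s^2/2),
    coordinate by coordinate. *)
Lemma cis_gauss s :
  `|cos s - expR (- (s ^+ 2 / 2))| + `|sin s - s * expR (- (s ^+ 2 / 2))|
    <= 3 * `|s| ^+ 3.
Proof.
have [s0|s0] := leP 0 s.
  have [] := cis_gauss_ge0 s0; rewrite (ger0_norm s0); lra.
have [|] := @cis_gauss_ge0 (- s); first by rewrite oppr_ge0 ltW.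
rewrite cosN sinN sqrrN mulNr -opprD normrN (ltr0_norm s0); lra.
Qed.

End elementary.

Section stopped_walk.
Context {R : realType}.
Variables (z : nat -> R) (c : R).

(** An increment is kept according to the quadratic variation accumulated before it, so that
    stopping is predictable. The increment that crosses the level is kept and causes the only
    overshoot. *)
Fixpoint stop_qv (j : nat) : R :=
  if j is k.+1 then
    stop_qv k + (if stop_qv k <= c then z k else 0) ^+ 2
  else 0.

Definition stop_inc (j : nat) : R := if stop_qv j <= c then z j else 0.

Definition stop_sum (j : nat) : R := \sum_(k < j) stop_inc k.

(** The derivative of sqrt(1 + x^2) at the current sum, of absolute value at most 1. *)
Definition stop_slope (k : nat) : R :=
  stop_sum k / Num.sqrt (1 + stop_sum k ^+ 2).

(* real and imaginary parts of prod_(k < j) (1 + i stop_inc k) *)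
Fixpoint stop_prod (j : nat) : R * R :=
  if j is k.+1 then
    let p := stop_prod k in
    (p.1 - p.2 * stop_inc k, p.2 + p.1 * stop_inc k)
  else (1, 0).

Lemma stop_qvS j : stop_qv j.+1 = stop_qv j + stop_inc j ^+ 2.
Proof. by []. Qed.

Lemma stop_prodS j : stop_prod j.+1 =
  ((stop_prod j).1 - (stop_prod j).2 * stop_inc j,
   (stop_prod j).2 + (stop_prod j).1 * stop_inc j).
Proof. by []. Qed.

Lemma stop_sumS j : stop_sum j.+1 = stop_sum j + stop_inc j.
Proof. by rewrite /stop_sum big_ord_recr. Qed.

Lemma stop_qv_ge0 j : 0 <= stop_qv j.
Proof. by elim: j => // j IH; rewrite stop_qvS addr_ge0 ?sqr_ge0. Qed.

(** Each factor satisfies |1 + is|^2 = 1 + s^2 <= e^(s^2). *)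
Lemma stop_prod_norm j :
  (stop_prod j).1 ^+ 2 + (stop_prod j).2 ^+ 2 <= expR (stop_qv j).
Proof.
elim: j => [|j IH]; first by rewrite /= expR0; lra.
rewrite stop_qvS expRD /=; set s := stop_inc j.
rewrite [leLHS](_ : _ =
  ((stop_prod j).1 ^+ 2 + (stop_prod j).2 ^+ 2) * (1 + s ^+ 2)); last by ring.
apply: ler_pM => //; first by rewrite addr_ge0 ?sqr_ge0.
  by rewrite addr_ge0 ?sqr_ge0.
exact: expR_ge1Dx.
Qed.

Hypothesis c_ge0 : 0 <= c.

Section bounded_increments.
Variable M : R.
Hypothesis zM : forall k, `|z k| <= M.

Let M0 : 0 <= M. Proof. exact: le_trans (zM 0%N). Qed.

(** Until the level is crossed, the stopped and the original walks coincide. After the crossing the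
    increments vanish, so the quadratic variation stays at c plus an overshoot of one squared
    increment. *)
Lemma stop_cases j :
  [/\ stop_qv j <= c, stop_qv j = \sum_(k < j) z k ^+ 2 &
      stop_sum j = \sum_(k < j) z k] \/
  [/\ c < stop_qv j, stop_qv j <= c + M ^+ 2 & c < \sum_(k < j) z k ^+ 2].
Proof.
elim: j => [|j [[q1 q2 q3]|[q1 q2 q3]]].
- by left; rewrite /stop_sum !big_ord0.
- have sE : stop_inc j = z j by rewrite /stop_inc q1.
  have QE : stop_qv j.+1 = \sum_(k < j.+1) z k ^+ 2.
    by rewrite stop_qvS sE q2 big_ord_recr.
  have [h|h] := leP (stop_qv j.+1) c.
    by left; split=> //; rewrite stop_sumS sE q3 big_ord_recr.
  right; split=> //; last by rewrite -QE.
  rewrite stop_qvS sE lerD// -[leLHS]real_normK ?num_real//.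
  by rewrite lerXn2r ?nnegrE.
- have sE : stop_inc j = 0 by rewrite /stop_inc leNgt q1.
  right; rewrite stop_qvS sE expr0n/= addr0; split=> //.
  by rewrite big_ord_recr/= ltr_wpDr ?sqr_ge0.
Qed.

Lemma stop_qv_ub j : stop_qv j <= c + M ^+ 2.
Proof.
have [[q _ _]|[]//] := stop_cases j.
by rewrite (le_trans q)// lerDl sqr_ge0.
Qed.

Lemma stop_inc_le j : `|stop_inc j| <= M.
Proof. by rewrite /stop_inc; case: ifP => // _; rewrite normr0. Qed.

(** Before the crossing the squared modulus is at most e^c, and only one further factor, at most 1 +
    M^2, differs from 1. The bound is thus linear in M, not exponential in M^2, and remains
    integrable when M is an integrable random variable. *)
Lemma stop_prod_bound j :
  `|(stop_prod j).1| <= expR c * (1 + M) /\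
  `|(stop_prod j).2| <= expR c * (1 + M).
Proof.
suff h : (stop_prod j).1 ^+ 2 + (stop_prod j).2 ^+ 2 <= (expR c * (1 + M)) ^+ 2.
  have B0 : 0 <= expR c * (1 + M) by rewrite mulr_ge0 ?expR_ge0 ?addr_ge0.
  split; rewrite -(ler_pXn2r (n := 2)) ?nnegrE// real_normK ?num_real//;
    apply: le_trans h; rewrite ?lerDl ?lerDr sqr_ge0//.
have e1 : 1 <= expR c by rewrite -expR0 ler_expR.
have lec : expR c * (1 + M ^+ 2) <= (expR c * (1 + M)) ^+ 2.
  rewrite exprMn; apply: ler_pM; rewrite ?expR_ge0 ?addr_ge0 ?sqr_ge0//.
    by rewrite expr2 ler_peMl ?expR_ge0.
  by have := M0; nra.
apply: le_trans lec.
elim: j => [|j IH].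
  rewrite /= expr1n expr0n addr0; have := sqr_ge0 M; nra.
have [q|q] := leP (stop_qv j) c; last first.
  have sE : stop_inc j = 0 by rewrite /stop_inc leNgt q.
  by rewrite /= sE !mulr0 subr0 addr0.
rewrite /=; set s := stop_inc j.
rewrite [leLHS](_ : _ =
  ((stop_prod j).1 ^+ 2 + (stop_prod j).2 ^+ 2) * (1 + s ^+ 2)); last by ring.
apply: ler_pM => //; [by rewrite addr_ge0 ?sqr_ge0|by rewrite addr_ge0 ?sqr_ge0| |].
  by apply: le_trans (stop_prod_norm _) _; rewrite ler_expR.
rewrite lerD2l -[leLHS]real_normK ?num_real// lerXn2r ?nnegrE//.
exact: stop_inc_le.
Qed.

(* The support-function form of |e^(i S_j) - T_j e^(-Q_j/2)| <= 3 M Q_j. *)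
Lemma stop_cos j th :
  cos (stop_sum j - th) -
  ((stop_prod j).1 * cos th + (stop_prod j).2 * sin th) *
    expR (- (stop_qv j / 2)) <= 3 * M * stop_qv j.
Proof.
elim: j th => [|j IH] th.
  rewrite /stop_sum big_ord0 /= !mul0r oppr0 expR0 sub0r cosN.
  by rewrite mul1r addr0 mulr1 subrr mulr0.
(* The rotation by the new increment is absorbed by the angle; this is why the induction is over all
   [th]. *)
have := IH (th - stop_inc j).
rewrite stop_sumS stop_prodS stop_qvS/=; set s := stop_inc j.
set q := stop_qv j; set a := (stop_prod j).1; set b := (stop_prod j).2.
rewrite (_ : stop_sum j - (th - s) = stop_sum j + s - th); last by ring.
rewrite (cosB th s) (sinB th s); set E := expR (- (q / 2)).
rewrite (_ : - ((q + s ^+ 2) / 2) = - (q / 2) + - (s ^+ 2 / 2)); last by field.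
rewrite expRD -/E; set e := expR (- (s ^+ 2 / 2)) => H.
have cg := cis_gauss s; rewrite -/e in cg.
(* E compensates the growth of the product: its modulus times E is at most 1. The bound on a
   coordinate along a unit vector (x, y) is then the Cauchy-Schwarz inequality. *)
have u1 (x y : R) : x ^+ 2 + y ^+ 2 = 1 -> `|E * (a * x + b * y)| <= 1.
  move=> xy; rewrite -(ler_pXn2r (n := 2)) ?nnegrE// real_normK ?num_real//.
  rewrite expr1n exprMn.
  have -> : E ^+ 2 = expR (- q) by rewrite expr2 -expRD; congr expR; field.
  have := stop_prod_norm j; rewrite -/q -/a -/b => nab.
  have : (a * x + b * y) ^+ 2 <= expR q.
    apply: le_trans nab; rewrite -[leRHS]mulr1 -xy.
    by have := sqr_ge0 (a * y - b * x); lra.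
  move=> /(ler_wpM2l (expR_ge0 (- q)))/le_trans; apply.
  by rewrite -expRD addNr expR0.
have k1 : `|E * (a * cos th + b * sin th)| <= 1 by apply: u1; exact: cos2Dsin2.
have k2 : `|E * (a * sin th - b * cos th)| <= 1.
  by rewrite -mulrN; apply: u1; rewrite sqrrN addrC cos2Dsin2.
have s3 : `|s| ^+ 3 <= M * s ^+ 2.
  rewrite exprS -[s ^+ 2]real_normK ?num_real// ler_wpM2r ?sqr_ge0//.
  exact: stop_inc_le.
have d1 : E * (a * cos th + b * sin th) * (cos s - e) <= `|cos s - e|.
  by apply: le_trans (ler_norm _) _; rewrite normrM ler_piMl.
have d2 : E * (a * sin th - b * cos th) * (sin s - s * e) <= `|sin s - s * e|.
  by apply: le_trans (ler_norm _) _; rewrite normrM ler_piMl.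
have -> : cos (stop_sum j + s - th) -
    ((a - b * s) * cos th + (b + a * s) * sin th) * (E * e) =
    (cos (stop_sum j + s - th) -
      (a * (cos th * cos s + sin th * sin s) +
       b * (sin th * cos s - cos th * sin s)) * E) +
    E * (a * cos th + b * sin th) * (cos s - e) +
    E * (a * sin th - b * cos th) * (sin s - s * e) by ring.
have -> : 3 * M * (q + s ^+ 2) = 3 * M * q + 3 * (M * s ^+ 2) by ring.
by move: H; lra.
Qed.

(** While the level is not crossed, each step costs s^2/2 beyond the linear term, in total at most
    c/2. The crossing step is estimated by the Lipschitz bound instead, at cost 2|s| <= 2M, so that
    the result stays linear in M. *)
Lemma stop_sqrt j :
  Num.sqrt (1 + stop_sum j ^+ 2) <=
    1 + \sum_(k < j) stop_slope k * stop_inc k + c / 2 + 2 * M.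
Proof.
pose p := stop_slope; pose psi x : R := Num.sqrt (1 + x ^+ 2).
suff : [/\ stop_qv j <= c & psi (stop_sum j) <=
      1 + \sum_(k < j) p k * stop_inc k + stop_qv j / 2] \/
    [/\ c < stop_qv j & psi (stop_sum j) <=
      1 + \sum_(k < j) p k * stop_inc k + c / 2 + 2 * M].
  by move=> [[q]|[_]]; have := M0; rewrite /psi; lra.
have psiE x : psi x ^+ 2 = 1 + x ^+ 2.
  by rewrite /psi sqr_sqrtr// addr_ge0 ?sqr_ge0.
have psi_ge1 x : 1 <= psi x.
  by rewrite /psi -[leLHS]sqrtr1 ler_wsqrtr// lerDl sqr_ge0.
have psi_ge0 x : 0 <= psi x by exact: sqrtr_ge0.
have psi_gex x : `|x| <= psi x.
  by rewrite /psi -sqrtr_sqr ler_wsqrtr// lerDr.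
have pE k : p k = stop_sum k / psi (stop_sum k) by [].
have psi_0 : psi 0 = 1 by rewrite /psi expr0n/= addr0 sqrtr1.
clearbody psi p.
elim: j => [|j IH].
  left; rewrite /stop_sum !big_ord0 psi_0 /=; split => //; lra.
have -> : \sum_(k < j.+1) p k * stop_inc k =
    \sum_(k < j) p k * stop_inc k + p j * stop_inc j by rewrite big_ord_recr.
move: IH; set S := \sum_(_ < _) _; rewrite stop_sumS stop_qvS.
have : c < stop_qv j -> stop_inc j = 0 by rewrite /stop_inc ltNge => /negbTE ->.
have := stop_inc_le j; set s := stop_inc j; set x := stop_sum j => sM s0 IH.
have [q|q] := leP (stop_qv j) c; last first.
  rewrite (s0 q) expr0n/= mulr0 !addr0.
  by case: IH => [[h]|]; [have := lt_le_trans q h; rewrite ltxx|right].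
have {}IH : psi x <= 1 + S + stop_qv j / 2.
  by case: IH => [[]//|[h]]; have := lt_le_trans h q; rewrite ltxx.
have px : p j = x / psi x by rewrite pE.
have P0 : 0 < psi x by exact: lt_le_trans (psi_ge1 x).
have sq : psi (x + s) <= psi x + p j * s + s ^+ 2 / 2.
  have h0 : 0 <= psi x + (x * s + s ^+ 2 / 2) / psi x.
    rewrite -(pmulr_lge0 _ P0) mulrDl divfK ?gt_eqF// -expr2 psiE.
    have := sqr_ge0 (x + s); have := sqr_ge0 x; nra.
  (* Squares are compared: that of the right side exceeds 1 + (x + s)^2 by a square, and [h0] gives
     the sign needed to take roots. *)
  have h1 : psi (x + s) <= psi x + (x * s + s ^+ 2 / 2) / psi x.
    rewrite -(ler_pXn2r (n := 2)) ?nnegrE ?psi_ge0// psiE !sqrrD psiE.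
    have -> : psi x * ((x * s + s ^+ 2 / 2) / psi x) = x * s + s ^+ 2 / 2.
      by rewrite mulrC divfK ?gt_eqF.
    by have := sqr_ge0 ((x * s + s ^+ 2 / 2) / psi x); nra.
  apply: le_trans h1 _; rewrite -addrA lerD2l mulrDl px mulrAC lerD2l.
  by rewrite ler_pdivrMr// ler_peMr ?psi_ge1// divr_ge0 ?sqr_ge0.
have lin : psi (x + s) <= psi x + p j * s + 2 * M.
  have h1 : psi (x + s) <= psi x + `|s|.
    rewrite -(ler_pXn2r (n := 2)) ?nnegrE ?psi_ge0//; last first.
      by rewrite addr_ge0 ?psi_ge0.
    rewrite psiE !sqrrD psiE real_normK ?num_real//.
    have : x * s <= psi x * `|s|.
      by apply: le_trans (ler_norm _) _; rewrite normrM ler_wpM2r.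
    by lra.
  have h2 : - `|s| <= p j * s.
    rewrite lerNl -mulNr; apply: le_trans (ler_norm _) _.
    rewrite normrM ler_piMl// normrN px normrM normfV (gtr0_norm P0).
    by rewrite ler_pdivrMr// mul1r.
  by lra.
have [q1|q1] := leP (stop_qv j + s ^+ 2) c.
  by left; split=> //; lra.
right; split=> //; lra.
Qed.

End bounded_increments.
End stopped_walk.

(** * Conditional upper limits *)

Section layers.
Context {R : realType}.

(** The sum counts the positive integers below y, so it is the integer part of y. *)
Lemma layer_count (y : R) (L : nat) : 0 <= y -> y <= L%:R ->
  `|y - \sum_(k < L) (k.+1%:R <= y)%R%:R| <= 1.
Proof.
move=> y0 yL; suff : (L%:R <= y -> \sum_(k < L) (k.+1%:R <= y)%R%:R = L%:R :> R)
    /\ (y < L%:R -> \sum_(k < L) (k.+1%:R <= y)%R%:R <= y :> R /\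
        y <= \sum_(k < L) (k.+1%:R <= y)%R%:R + 1).
  move: yL; rewrite le_eqVlt => /predU1P[yL|yL] [h1 h2].
    by rewrite h1 ?yL// subrr normr0.
  by have [] := h2 yL; rewrite ler_norml; lra.
elim: L {yL} => [|L [IH1 IH2]].
  by rewrite big_ord0; split=> // ?; lra.
rewrite big_ord_recr/=; split=> [Ly|yL].
  have Ly' : L%:R <= y by apply: le_trans Ly; rewrite ler_nat.
  by rewrite IH1// Ly natr1.
have -> : (L.+1%:R <= y) = false by apply/negbTE; rewrite -ltNge.
rewrite addr0; have [Ly|yL'] := leP L%:R y; last exact: IH2.
by rewrite IH1//; split=> //; rewrite natr1 ltW.
Qed.

(* A function with values in [0, K] is within 1/N of a combination of K * N
   indicators of its upper level sets. *)
Lemma layer_approx (y : R) (K N : nat) : 0 <= y -> y <= K%:R -> (0 < N)%N ->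
  `|y - N%:R^-1 * \sum_(k < K * N) (k.+1%:R / N%:R <= y)%R%:R| <= N%:R^-1.
Proof.
move=> y0 yK N0; have N0' : 0 < N%:R :> R by rewrite ltr0n.
have yN0 : 0 <= y * N%:R by rewrite mulr_ge0.
have yNK : y * N%:R <= (K * N)%:R by rewrite natrM ler_wpM2r.
have := layer_count yN0 yNK; set S := \sum_(_ < _) _.
set S' := \sum_(_ < _) _ => h.
have -> : S' = S by apply: eq_bigr => k _; rewrite ler_pdivrMr.
have -> : y - N%:R^-1 * S = N%:R^-1 * (y * N%:R - S).
  by rewrite mulrBr mulrCA mulVf ?mulr1// gt_eqF.
by rewrite normrM gtr0_norm ?invr_gt0// ler_piMr// invr_ge0 ltW.
Qed.

Lemma inv_nat_lt (e : R) : 0 < e -> exists2 N, (0 < N)%N & N%:R^-1 < e.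
Proof.
move=> e0; exists (Num.truncn e^-1).+1 => //.
by rewrite invf_plt ?posrE// truncnS_gt.
Qed.

Lemma le_epsilon_scale (x y C : R) : 0 <= C ->
  (forall e, 0 < e -> x <= y + C * e) -> x <= y.
Proof.
move=> C0 h; apply/ler_addgt0Pr => e e0.
have C1 : 0 < C + 1 by lra.
apply: le_trans (h (e / (C + 1)) _) _; first by rewrite divr_gt0.
have e0' := ltW e0.
by rewrite lerD2l mulrCA ler_piMr// ler_pdivrMr// mul1r; lra.
Qed.

End layers.

Section bounded_induction.
Context {d : measure_display} {T : measurableType d} {R : realType}.

Definition bounded_measurable (f : T -> R) : Prop :=
  measurable_fun [set: T] f /\ exists M, forall x, `|f x| <= M.

Lemma bounded_measurable_lin a b f g :
  bounded_measurable f -> bounded_measurable g ->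
  bounded_measurable (fun x => a * f x + b * g x).
Proof.
move=> [mf [M fM]] [mg [M' gM']]; split.
  by apply: measurable_funD; exact: measurable_funM.
exists (`|a| * M + `|b| * M') => x.
by apply: le_trans (ler_normD _ _) _; rewrite !normrM lerD// ler_wpM2l.
Qed.

Lemma bounded_measurable_indic (E : set T) : measurable E ->
  bounded_measurable (\1_E : T -> R).
Proof.
move=> mE; split; first exact: measurable_indic.
by exists 1 => x; rewrite indicE; case: (_ \in _); rewrite ?normr1 ?normr0.
Qed.

(** Shifted to be nonnegative, a bounded function is a uniform limit of combinations of indicators
    of its level sets. Closure under uniform limits, rather than monotone ones, lets each use
    proceed by an error estimate. *)
Lemma bounded_measurable_ind (C : (T -> R) -> Prop) :
  (forall E, measurable E -> C \1_E) ->
  (forall a b f g, bounded_measurable f -> bounded_measurable g ->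
     C f -> C g -> C (fun x => a * f x + b * g x)) ->
  (forall f, bounded_measurable f ->
     (forall eps, 0 < eps -> exists g, [/\ bounded_measurable g, C g &
        forall x, `|f x - g x| <= eps]) -> C f) ->
  forall f, bounded_measurable f -> C f.
Proof.
move=> C1 Clin Clim f bf; apply: Clim => // eps eps0.
have [mf [M fM]] := bf.
have [K MK] : exists K : nat, M <= K%:R.
  by exists (Num.truncn M).+1; rewrite ltW// truncnS_gt.
have [N N0 Ne] := inv_nat_lt eps0.
pose g x := f x + K%:R.
have g0 x : 0 <= g x by have := fM x; rewrite ler_norml /g => /andP[]; lra.
have gK x : g x <= (K + K)%:R.
  by have := fM x; rewrite ler_norml /g natrD => /andP[]; lra.
pose E (k : nat) := [set x | k.+1%:R / N%:R <= g x].
have mE k : measurable (E k).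
  rewrite (_ : E k = g @^-1` [set` `[k.+1%:R / N%:R, +oo[]); last first.
    by apply/seteqP; split=> x /=; rewrite in_itv/= andbT.
  by rewrite -[_ @^-1` _]setTI; apply: measurable_funD => //; exact: measurable_itv.
have CS (L : nat) : bounded_measurable (fun x => \sum_(k < L) (\1_(E k) x : R)) /\
    C (fun x => \sum_(k < L) \1_(E k) x).
  elim: L => [|L [IH1 IH2]].
    have -> : (fun x : T => \sum_(k < 0) (\1_(E k) x : R)) = \1_set0.
      by apply/funext => x; rewrite big_ord0 indicE in_set0.
    by split; [exact: bounded_measurable_indic|exact: C1].
  have -> : (fun x : T => \sum_(k < L.+1) (\1_(E k) x : R)) =
      (fun x => 1 * \sum_(k < L) (\1_(E k) x : R) + 1 * \1_(E L) x).
    by apply/funext => x; rewrite big_ord_recr/= !mul1r.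
  have bE := bounded_measurable_indic (mE L).
  by split; [exact: bounded_measurable_lin|apply: Clin => //; exact: C1].
have [b1 c1] := CS ((K + K) * N)%N.
have bT := bounded_measurable_indic measurableT.
exists (fun x => N%:R^-1 * \sum_(k < (K + K) * N) \1_(E k) x +
  (- K%:R) * \1_setT x); split.
- exact: bounded_measurable_lin.
- by apply: Clin => //; exact: C1.
move=> x; have := layer_approx (g0 x) (gK x) N0.
rewrite indicT mulr1 (_ : \sum_(k < _) (k.+1%:R / N%:R <= g x)%R%:R =
    \sum_(k < (K + K) * N) \1_(E k) x).
  rewrite {1}/g => h; rewrite (_ : f x - _ = f x + K%:R -
    N%:R^-1 * \sum_(k < (K + K) * N) \1_(E k) x); last by ring.
  by apply: le_trans h _; exact: ltW.
apply: eq_bigr => k _; rewrite indicE; congr (nat_of_bool _)%:R.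
by apply/idP/idP; rewrite inE.
Qed.

End bounded_induction.

Lemma gt_preimage {T : Type} {R : realType} (f : T -> R) r :
  [set w | r < f w] = f @^-1` `]r, +oo[%classic.
Proof. by apply/seteqP; split=> w /=; rewrite in_itv/= andbT. Qed.

Lemma measurable_gt {d} {T : measurableType d} {R : realType} (f : T -> R) r :
  measurable_fun [set: T] f -> measurable [set w | r < f w].
Proof.
by move=> mf; rewrite gt_preimage -[_ @^-1` _]setTI; apply: mf => //; exact: measurable_itv.
Qed.

Section sub_sigma_algebra.
Context {d : measure_display} {T : measurableType d} {R : realType}.
Variable P : probability T R.
Implicit Types (S : set (set T)) (A : set T) (f g h : T -> R).

Local Notation intg f := (P.-integrable [set: T] (EFin \o f)).

Definition measurable_for S f := forall B, measurable B -> S (f @^-1` B).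

Lemma measurable_sub_sigmaP S A : sigma_algebra setT S ->
  @measurable _ (g_sigma_algebraType S) A <-> S A.
Proof.
by move=> sS; change (<<s S >> A <-> S A); rewrite sigma_algebra_id.
Qed.

Lemma measurable_forP S f : sigma_algebra setT S ->
  measurable_for S f <->
  measurable_fun [set: g_sigma_algebraType S] (f : g_sigma_algebraType S -> R).
Proof.
move=> sS; split=> [h _ B mB|h B mB].
  by rewrite setTI; apply/(measurable_sub_sigmaP _ sS)/h.
by have := h measurableT B mB; rewrite setTI => /(measurable_sub_sigmaP _ sS).
Qed.

Lemma measurable_for_sub S S' f : S `<=` S' ->
  measurable_for S f -> measurable_for S' f.
Proof. by move=> SS' h B mB; exact/SS'/h. Qed.

Lemma measurable_for_fun S f : S `<=` measurable ->
  measurable_for S f -> measurable_fun [set: T] f.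
Proof. by move=> Sm h _ B mB; rewrite setTI; exact/Sm/h. Qed.

Section fixed.
Variable S : set (set T).
Hypotheses (sS : sigma_algebra setT S) (Sm : S `<=` measurable).

Lemma sub_sigmaT : S setT.
Proof.
by have [S0 SC _] := sS; rewrite -setC0 -setTD; exact: SC.
Qed.

(** Extends a vanishing conditional mean from events to bounded multipliers: a uniform approximation
    of psi changes the integral by at most the error times the L^1 norm of f. *)
Lemma Rintegral_orthogonal f (psi : T -> R) (M : R) : intg f ->
  (forall A, S A -> \int[P]_(w in A) f w = 0) ->
  measurable_for S psi -> (forall w, `|psi w| <= M) ->
  \int[P]_w (f w * psi w) = 0.
Proof.
move=> intf f0 mpsi psiM; pose TS := g_sigma_algebraType S.
have iM (g : TS -> R) M' : measurable_fun [set: TS] g -> (forall w, `|g w| <= M') ->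
    intg (fun w => f w * g w).
  move=> mg gM; apply: (@integrable_mulr _ _ _ P f g M' intf _ gM).
  exact: (measurable_for_fun Sm ((measurable_forP _ sS).2 mg)).
apply: (@bounded_measurable_ind _ TS R (fun psi => \int[P]_w (f w * psi w) = 0)).
- move=> E /(measurable_sub_sigmaP _ sS) SE.
  by rewrite -(Rintegral_indicM (Sm SE) intf) f0.
- move=> a b g h [mg [K gK]] [mh [L hL]] g0 h0.
  have ig := iM _ _ mg gK; have ih := iM _ _ mh hL.
  under eq_Rintegral do rewrite mulrDr mulrCA (mulrCA _ b).
  rewrite RintegralD//; [|exact: integrable_scale..].
  by rewrite !RintegralZl// g0 h0 !mulr0 addr0.
- move=> g [mg [K gK]] hg; apply/eqP; rewrite -normr_le0.
  apply: (@le_epsilon_scale _ _ _ (\int[P]_w `|f w|)); first exact: Rintegral_ge0.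
  move=> e e0; have [h [[mh [L hL]] h0 gh]] := hg e e0.
  have ig := iM _ _ mg gK; have ih := iM _ _ mh hL.
  have -> : \int[P]_w (f w * g w) = \int[P]_w (f w * g w - f w * h w).
    by rewrite RintegralB// h0 subr0.
  apply: le_trans (le_normr_Rintegral _ (integrable_sub_fun ig ih)) _ => //.
  rewrite add0r mulrC -RintegralZl//; last exact: integrable_normr.
  apply: le_Rintegral => //.
  + by apply: integrable_normr; exact: integrable_sub_fun.
  + by apply: integrable_scale; exact: integrable_normr.
  + by move=> w _; rewrite -mulrBr normrM mulrC ler_wpM2r.
- by split; [exact/measurable_forP|exists M].
Qed.

End fixed.

Definition filtration (G : nat -> set (set T)) : Prop :=
  [/\ forall n, sigma_algebra setT (G n), forall n, G n `<=` measurable &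
      forall n, G n `<=` G n.+1].

Lemma filtration_le G : filtration G -> forall n m, (n <= m)%N -> G n `<=` G m.
Proof.
move=> [_ _ GS] n m /subnK <-; elim: (m - n)%N => [//|k IH] A /IH.
by rewrite addSn; exact: GS.
Qed.

(* E(f_n | G_n) is asymptotically at most phi, stated without conditional
   expectations. *)
Definition cond_limsup_le (G : nat -> set (set T)) (f_ : nat -> T -> R)
    (phi : T -> R) : Prop :=
  forall e, 0 < e -> exists N Phi h,
    [/\ measurable_for (G N) Phi, intg Phi,
        intg h, {ae P, forall w, 0 <= h w} & \int[P]_w h w <= e] /\
    [/\ intg (fun w => `|Phi w - phi w|), \int[P]_w `|Phi w - phi w| <= e &
        forall n A, (N <= n)%N -> G n A ->
          \int[P]_(w in A) f_ n w <= \int[P]_(w in A) Phi w + \int[P]_(w in A) h w].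

Section maximal.
Variables (G : nat -> set (set T)) (N : nat).
Variables (u_ : nat -> T -> R) (h : T -> R) (r : R).
Hypotheses (fG : filtration G) (r_gt0 : 0 < r).
Hypotheses (mu : forall n, (N <= n)%N -> measurable_for (G n) (u_ n)).
Hypotheses (iu : forall n, (N <= n)%N -> intg (u_ n)).
Hypotheses (ih : intg h) (h0 : {ae P, forall w, 0 <= h w}).
Hypothesis uh : forall n A, (N <= n)%N -> G n A ->
  \int[P]_(w in A) u_ n w <= \int[P]_(w in A) h w.

Let U k := \big[setU/set0]_(j < k) [set w | r < u_ (N + j)%N w].

Let GU k : G (N + k)%N (U k).
Proof.
have [sG _ _] := fG; elim: k => [|k IH].
  by rewrite /U big_ord0; case: (sG (N + 0)%N).
rewrite /U big_ord_recr/= -/(U k).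
have h1 : G (N + k.+1)%N (U k) by apply: (filtration_le fG) IH; rewrite leq_add2l.
have h2 : G (N + k.+1)%N [set w | r < u_ (N + k)%N w].
  apply: (filtration_le fG (n := (N + k)%N)); first by rewrite leq_add2l.
  by rewrite gt_preimage; apply: mu; [exact: leq_addr|exact: measurable_itv].
move: h1 h2 => /(measurable_sub_sigmaP _ (sG _)) h1 /(measurable_sub_sigmaP _ (sG _)) h2.
by apply/(measurable_sub_sigmaP _ (sG _)); exact: measurableU.
Qed.

(** The newly added part of [U k.+1] belongs to G (N + k); u exceeds r on it and has integral at
    most that of h. These parts are disjoint, so the bounds add up. *)
Let first_entrance k : r * fine (P (U k)) <= \int[P]_(w in U k) h w.
Proof.
have [sG Gm _] := fG; have mU j : measurable (U j) := Gm _ _ (GU j).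
elim: k => [|k IH]; first by rewrite /U big_ord0 measure0 mulr0 Rintegral_set0.
pose E := [set w | r < u_ (N + k)%N w].
have GE : G (N + k)%N E.
  by rewrite /E gt_preimage; apply: mu; [exact: leq_addr|exact: measurable_itv].
have GD : G (N + k)%N (E `\` U k).
  move: GE (GU k) => /(measurable_sub_sigmaP _ (sG _)) h1.
  move=> /(measurable_sub_sigmaP _ (sG _)) h2.
  by apply/(measurable_sub_sigmaP _ (sG _)); exact: measurableD.
have mD := Gm _ _ GD.
have UE : U k.+1 = U k `|` (E `\` U k).
  rewrite /U big_ord_recr/= -/(U k) -/E.
  apply/seteqP; split=> w [Uw|Ew]; [by left| |by left|by right; case: Ew].
  by case: (pselect (U k w)) => Uw; [left|right].
have dis : [disjoint U k & E `\` U k].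
  by apply/disj_setPS => w [? [_]].
rewrite UE Rintegral_setU//; last first.
  by apply: integrable_sub => //; exact: measurableU.
rewrite measureU//; last by apply/seteqP; split=> // w [? [_]].
rewrite fineD ?fin_num_measure// mulrDr lerD//.
apply: le_trans (uh (leq_addr _ _) GD).
rewrite -Rintegral_cst//; apply: le_Rintegral => //.
- by apply: integrable_sub => //; exact: integrable_cst.
- by apply: integrable_sub => //; apply: iu; exact: leq_addr.
- by move=> w [/= /ltW].
Qed.

(** As a single h serves all times, the first-entrance events together cost one integral of h,
    whereas a union bound would cost one for each n. *)
Lemma maximal_inequality :
  (P (\bigcup_n [set w | (r < u_ (N + n)%N w)%R]) <= (r^-1 * \int[P]_w h w)%:E)%E.
Proof.
have [sG Gm _] := fG; have mU j : measurable (U j) := Gm _ _ (GU j).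
have -> : \bigcup_n [set w | (r < u_ (N + n)%N w)%R] = \bigcup_n U n.
  apply/seteqP; split=> [w [n _ uw]|w [n _]].
    by exists n.+1 => //; rewrite /U big_ord_recr/=; right.
  rewrite /U -(bigcup_mkord n (fun j => [set w | r < u_ (N + j)%N w])).
  by case=> k _ uw; exists k.
have cU : P (U n) @[n --> \oo] --> P (\bigcup_n U n).
  apply: nondecreasing_cvg_mu => //; first exact: bigcupT_measurable.
  apply/nondecreasing_seqP => n; apply/subsetPset.
  by rewrite /U big_ord_recr/=; left.
rewrite -(cvg_lim _ cU)//; apply: lime_le; first by apply/cvg_ex; eexists; exact: cU.
apply: nearW => n.
rewrite -[leLHS]fineK ?fin_num_measure// lee_fin.
rewrite -(ler_pM2l r_gt0) mulrA mulfV ?gt_eqF// mul1r.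
apply: le_trans (first_entrance n) _; exact: Rintegral_sub_le.
Qed.

End maximal.

Lemma markov_fine (f : T -> R) (r : R) : 0 < r -> measurable_fun [set: T] f ->
  intg (fun w => `|f w|) ->
  (P [set w | (r < `|f w|)%R] <= (r^-1 * \int[P]_w `|f w|)%:E)%E.
Proof.
move=> r0 mf intf; set A := [set w | _].
have mA : measurable A by apply: measurable_gt; exact: measurableT_comp.
rewrite -[leLHS]fineK ?fin_num_measure// lee_fin.
rewrite -(ler_pM2l r0) mulrA mulfV ?gt_eqF// mul1r -Rintegral_cst//.
apply: (@le_trans _ _ (\int[P]_(w in A) `|f w|)).
  apply: le_Rintegral => //.
  - by apply: integrable_sub => //; exact: integrable_cst.
  - exact: integrable_sub.
  - by move=> w /= /ltW.
by apply: Rintegral_sub_le => //; exact: aeW.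
Qed.

(** Two events of small probability are discarded: the maximal inequality gives g_n <= Phi + r for
    all large n at once, and Markov's inequality gives |Phi - phi| <= r. Hence g_n exceeds phi + 2r
    infinitely often with probability zero. *)
Lemma cond_limsup_le_ae G (f_ g_ : nat -> T -> R) phi : filtration G ->
  measurable_fun [set: T] phi -> cond_limsup_le G f_ phi ->
  (forall n, (0 < n)%N -> measurable_for (G n) (g_ n) /\ intg (g_ n)) ->
  (forall n A, (0 < n)%N -> G n A ->
     \int[P]_(w in A) g_ n w = \int[P]_(w in A) f_ n w) ->
  {ae P, forall w e, 0 < e -> \forall n \near \oo, g_ n w <= phi w + e}.
Proof.
move=> fG mphi fphi mig gf.
have [sG Gm _] := fG.
have mg n : (0 < n)%N -> measurable_fun [set: T] (g_ n).
  by move=> /mig[+ _]; apply: measurable_for_fun.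
pose B (p : nat) := \bigcap_n [set w | exists k : nat,
  (n < k)%N /\ phi w + p.+1%:R^-1 *+ 2 < g_ k w].
suff Bp p : P.-negligible (B p).
  have : P.-negligible (\bigcup_p B p) by exact: negligible_bigcup.
  apply: negligibleS => w /= /existsNP[e /not_implyP[e0 he]].
  have e20 : 0 < e / 2 by rewrite divr_gt0.
  have [q q0 qe] := inv_nat_lt e20; exists q.-1 => // n _ /=.
  apply/not_existsP => hk; apply: he; exists n.+1 => // k /= nk.
  have /not_andP[//|/negP] := hk k; rewrite -leNgt prednK// => /le_trans; apply.
  by rewrite lerD2l mulr2n; lra.
set r : R := p.+1%:R^-1; have r0 : 0 < r by rewrite invr_gt0.
have mB : measurable (B p).
  apply: bigcapT_measurable => n.
  rewrite (_ : [set w | _] = \bigcup_k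
      [set w | (n < k)%N /\ phi w + r *+ 2 < g_ k w]); last first.
    by apply/seteqP; split=> w /=; [case=> k ?; exists k|case=> k _ ?; exists k].
  apply: bigcupT_measurable => k; have [nk|nk] := ltnP n k; last first.
    by rewrite (_ : [set w | _] = set0)//; apply/seteqP; split=> w // -[].
  rewrite (_ : [set w | _] = [set w | r *+ 2 < g_ k w - phi w]); last first.
    by apply/seteqP; split=> w /=; rewrite ltrBrDl; [case|].
  by apply: measurable_gt; apply: measurable_funB => //; apply: mg; exact: leq_ltn_trans nk.
apply/negligibleP => //; apply/eqP; rewrite eq_le measure_ge0 andbT.
apply/lee_addgt0Pr => e e0; rewrite add0e.
(* Both inequalities divide by r, so an error of r e/2 in each yields e in total. *)
have e'0 : 0 < r * e / 2 by rewrite divr_gt0 ?mulr_gt0.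
have [N [Phi [h [[mPhi iPhi ih h0 he] [iPp Pphi fPhi]]]]] := fphi _ e'0.
have mP := measurable_for_fun (Gm N) mPhi.
(* Starting at N + 1 keeps the times positive, as the hypotheses on [g_] require. *)
set M := N.+1.
have m1 : measurable (\bigcup_n [set w | r < g_ (M + n)%N w - Phi w]).
  apply: bigcupT_measurable => n; apply: measurable_gt.
  by apply: measurable_funB => //; exact: mg.
have m2 : measurable [set w | r < `|Phi w - phi w|].
  by apply: measurable_gt; apply: measurableT_comp => //; exact: measurable_funB.
apply: (@le_trans _ _ (P ((\bigcup_n [set w | r < g_ (M + n)%N w - Phi w]) `|`
    [set w | r < `|Phi w - phi w|]))).
  apply: le_measure; rewrite ?inE//; first exact: measurableU.
  move=> w Bw; have [k [/= nk]] := Bw M I; rewrite -/r => gk.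
  have [rP|rP] := ltP r `|Phi w - phi w|; first by right.
  left; exists (k - M)%N => //=; rewrite subnKC; last exact: ltnW.
  by move: rP gk; rewrite ler_norml mulr2n => /andP[]; lra.
apply: le_trans (measureU2 _ m1 m2) _.
have -> : e = r^-1 * (r * e / 2) + r^-1 * (r * e / 2).
  by field; rewrite gt_eqF.
rewrite EFinD; apply: leeD.
  have M0 n : (M <= n)%N -> (0 < n)%N by apply: leq_trans.
  have := @maximal_inequality G M (fun n w => g_ n w - Phi w) h r fG r0.
  move=> /(_ _ _ ih h0 _)/le_trans; apply.
  - move=> n Mn; apply/(measurable_forP _ (sG n)); apply: measurable_funB.
      by apply/(measurable_forP _ (sG n)); have [] := mig n (M0 _ Mn).
    apply/(measurable_forP _ (sG n)); apply: measurable_for_sub mPhi.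
    by apply: (filtration_le fG); exact: ltnW.
  - move=> n Mn; apply: integrable_sub_fun => //.
    by have [] := mig n (M0 _ Mn).
  - move=> n A Mn GA; have mA := Gm _ _ GA.
    have [_ ig] := mig n (M0 _ Mn).
    rewrite RintegralB//; [|exact: integrable_sub..].
    by rewrite lerBlDl (gf n A (M0 _ Mn) GA); apply: fPhi => //; exact: ltnW.
  - by rewrite lee_fin ler_pM2l ?invr_gt0.
apply: le_trans (markov_fine r0 _ iPp) _; first exact: measurable_funB.
by rewrite lee_fin ler_pM2l ?invr_gt0.
Qed.

End sub_sigma_algebra.

(** * Truncation at the level c and pathwise bounds for the stopped walk *)

Section truncation.
Context {R : realType}.
Implicit Types (c v x y : R).

Lemma cos_lipschitz x y : `|cos x - cos y| <= `|x - y|.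
Proof.
wlog xy : x y / x <= y.
  by have [xy|/ltW yx] := leP x y; [|rewrite distrC (distrC x)]; exact.
move: xy; rewrite le_eqVlt => /predU1P[->|xy]; first by rewrite subrr normr0.
have cc : {within `[x, y], continuous (@cos R)}.
  by apply: continuous_subspaceT; exact: continuous_cos.
have [u _] := MVT xy (fun u _ => is_derive_cos u) cc.
rewrite distrC => ->; rewrite normrM normrN (distrC x).
by rewrite ler_piMl// sin_max.
Qed.

Lemma expRN_lipschitz x y : 0 <= x -> 0 <= y ->
  `|expR (- x) - expR (- y)| <= `|x - y|.
Proof.
wlog xy : x y / x <= y.
  have [xy|/ltW yx] := leP x y; first exact.
  by move=> h x0 y0; rewrite distrC (distrC x); exact: h.
move=> x0 y0; rewrite (distrC x) ger0_norm ?subr_ge0 ?ler_expR ?lerN2//.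
rewrite ger0_norm ?subr_ge0//.
have -> : - y = - x + (- (y - x)) by ring.
rewrite expRD; have : expR (- x) <= 1 by rewrite -expR0 ler_expR oppr_le0.
have := expR_ge1Dx (- (y - x)); have := expR_gt0 (- x); nra.
Qed.

Definition clip c v := Num.max 0 (Num.min v c).

Lemma clip_ge0 c v : 0 <= clip c v. Proof. by rewrite le_max lexx. Qed.

Lemma clip_le c v : 0 <= c -> clip c v <= c.
Proof. by move=> c0; rewrite ge_max c0 ge_min lexx orbT. Qed.

Lemma clip_id c v : 0 <= v -> v <= c -> clip c v = v.
Proof. by move=> v0 vc; rewrite /clip min_l// max_r. Qed.

Lemma clip_max c v : 0 <= c -> c <= v -> clip c v = c.
Proof. by move=> c0 cv; rewrite /clip min_r// max_r. Qed.

Lemma clip_lipschitz c x y : `|clip c x - clip c y| <= `|x - y|.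
Proof.
have H : `|Num.min x c - Num.min y c| <= `|x - y|.
  rewrite !minEle; case: ifPn; rewrite ?ler_norml -?ltNge => h1;
    case: ifPn; rewrite -?ltNge => h2; have := ler_norm (x - y);
    have := ler_norm (y - x); rewrite (distrC y) ?subrr; lra.
apply: le_trans H; rewrite /clip; set a := Num.min x c; set b := Num.min y c.
rewrite !maxEle; case: ifPn; rewrite -?ltNge => h1;
    case: ifPn; rewrite -?ltNge => h2; rewrite ler_norml; have := ler_norm (a - b);
    have := ler_norm (b - a); rewrite (distrC b) ?subrr; lra.
Qed.

Lemma continuous_clip c : continuous (clip c).
Proof.
move=> v; apply/cvgrPdist_le => e e0; near=> u.
apply: le_trans (clip_lipschitz _ _ _) _.
by near: u; exact: cvgr_dist_le.
Unshelve. all: by end_near. Qed.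

(* exp(-v/2), frozen beyond c, and a continuous majorant of the indicator of
   ]c, +oo[ that vanishes below c - 1. *)
Definition gauss_cut c v := expR (- (clip c v / 2)).
Definition excess c v := clip 1 (v - c + 1).

Lemma gauss_cut_bounds c v : 0 <= gauss_cut c v <= 1.
Proof.
rewrite expR_ge0 /gauss_cut -[leRHS]expR0 ler_expR oppr_le0.
by have := clip_ge0 c v; lra.
Qed.

Lemma excess_bounds c v : 0 <= excess c v <= 1.
Proof. by rewrite clip_ge0 clip_le. Qed.

Lemma continuous_gauss_cut c : continuous (gauss_cut c).
Proof.
move=> v; apply: (@cvg_comp _ _ _ (fun v => - (clip c v / 2)) expR _ _ _ _
  (@continuous_expR R _)).
by apply: cvgN; apply: cvgMl; exact: continuous_clip.
Qed.

Lemma continuous_excess c : continuous (excess c).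
Proof.
move=> v; apply: (@cvg_comp _ _ _ (fun v => v - c + 1) (clip 1) _ _ _ _
  (@continuous_clip 1 _)).
by apply: cvgD; [apply: cvgB; [exact: cvg_id|exact: cvg_cst]|exact: cvg_cst].
Qed.

(** [excess c] is 1-Lipschitz and equals 1 from c on. It charges the event that the walk was stopped
    to V being large or Q being far from V. *)
Lemma excess_gt c q v : c < q -> 1 <= excess c v + `|q - v|.
Proof.
move=> cq; have := ler_norm (q - v); rewrite /excess /clip.
move=> h; apply: (@le_trans _ _ (Num.min (v - c + 1) 1 + `|q - v|)).
  have [h'|h'] := leP (v - c + 1) 1; first by lra.
  by rewrite lerDl.
by rewrite lerD2r le_max lexx orbT.
Qed.

Section stopped_bounds.
Variables (z : nat -> R) (c M : R).
Hypotheses (c_ge0 : 0 <= c) (zM : forall k, `|z k| <= M).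
Variables (V W : R).
Let S j := \sum_(k < j) z k.
Let Q j := \sum_(k < j) z k ^+ 2.
Let C := expR c * (1 + M).

Let M0 : 0 <= M. Proof. exact: le_trans (zM 0%N). Qed.
Let C0 : 0 <= C. Proof. by rewrite mulr_ge0 ?expR_ge0// addr_ge0. Qed.

Lemma stop_prod_trig_bound j th :
  `|(stop_prod z c j).1 * cos th + (stop_prod z c j).2 * sin th| <= 2 * C.
Proof.
have [h1 h2] := stop_prod_bound c_ge0 zM j.
apply: le_trans (ler_normD _ _) _; rewrite !normrM.
have : `|(stop_prod z c j).1| * `|cos th| <= C.
  by apply: le_trans h1; rewrite ler_piMr// cos_max.
have : `|(stop_prod z c j).2| * `|sin th| <= C.
  by apply: le_trans h2; rewrite ler_piMr// sin_max.
by lra.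
Qed.

(** Stopping caps the quadratic variation at c up to one overshoot, and [clip c] is 1-Lipschitz. *)
Lemma stop_qv_clip j : `|stop_qv z c j - clip c V| <= M ^+ 2 + `|Q j - V|.
Proof.
have := clip_lipschitz c (Q j) V; have := sqr_ge0 M.
have [[q1 q2 _]|[q1 q2 q3]] := stop_cases c_ge0 zM j.
  have -> : stop_qv z c j = clip c (Q j).
    by rewrite -[Q j]q2 clip_id// stop_qv_ge0.
  by lra.
rewrite (clip_max c_ge0 (ltW q3)) => m0.
have := ler_normD (stop_qv z c j - c) (c - clip c V).
rewrite (_ : stop_qv z c j - c + (c - clip c V) = stop_qv z c j - clip c V);
  last by ring.
by rewrite (ger0_norm (_ : 0 <= stop_qv z c j - c)); lra.
Qed.

(** Three replacements are added: W by the stopped sum, its cosine by the product formula, and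
    exp(-Q/2) by Phi. The first bracket on the right tends to zero along j and then n when M is the
    majorant of the increments; the second one remains. *)
Lemma stop_cos_le j th Phi :
  cos (W - th) -
    ((stop_prod z c j).1 * cos th + (stop_prod z c j).2 * sin th) * Phi <=
  (`|W - S j| + (2 + 2 * C) * `|Q j - V| + (3 * M * (c + M ^+ 2) + 2 * C * M ^+ 2)) +
  (2 * C * `|Phi - gauss_cut c V| + 2 * excess c V).
Proof.
set p := _ * _ + _ * _; have pC : `|p| <= 2 * C by exact: stop_prod_trig_bound.
(* On a stopped path the trivial bound 2 is paid by [excess_gt]. *)
have h1 : cos (W - th) - cos (stop_sum z c j - th) <=
    `|W - S j| + 2 * `|Q j - V| + 2 * excess c V.
  have /andP[x0 _] := excess_bounds c V.
  have [[q1 q2 q3]|[q1 q2 q3]] := stop_cases c_ge0 zM j.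
    apply: le_trans (ler_norm _) _; apply: le_trans (cos_lipschitz _ _) _.
    rewrite q3 (_ : W - th - _ = W - S j); last by rewrite /S; ring.
    by have := normr_ge0 (Q j - V); lra.
  have := excess_gt V q3; rewrite -/(Q j).
  have := cos_le1 (W - th); have := cos_geN1 (stop_sum z c j - th).
  by have := normr_ge0 (W - S j); lra.
have h2 : cos (stop_sum z c j - th) - p * expR (- (stop_qv z c j / 2)) <=
    3 * M * (c + M ^+ 2).
  apply: le_trans (stop_cos c zM j th) _; rewrite ler_wpM2l ?mulr_ge0//.
  exact: stop_qv_ub.
have h3 : p * (expR (- (stop_qv z c j / 2)) - Phi) <=
    2 * C * (M ^+ 2 + `|Q j - V| + `|Phi - gauss_cut c V|).
  apply: le_trans (ler_norm _) _; rewrite normrM ler_pM//.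
  apply: (@le_trans _ _ (`|expR (- (stop_qv z c j / 2)) - gauss_cut c V| +
      `|gauss_cut c V - Phi|)).
    by rewrite (le_trans _ (ler_normD _ _))// addrA subrK.
  rewrite (distrC (gauss_cut c V)) lerD2r.
  have q0 : 0 <= stop_qv z c j / 2 by rewrite divr_ge0 ?stop_qv_ge0.
  have k0 : 0 <= clip c V / 2 by rewrite divr_ge0 ?clip_ge0.
  apply: le_trans (expRN_lipschitz q0 k0) _; rewrite -mulrBl normrM.
  rewrite (ger0_norm (_ : 0 <= 2^-1)) ?invr_ge0//.
  by have := stop_qv_clip j; have := normr_ge0 (stop_qv z c j - clip c V); lra.
have -> : cos (W - th) - p * Phi =
    (cos (W - th) - cos (stop_sum z c j - th)) +
    (cos (stop_sum z c j - th) - p * expR (- (stop_qv z c j / 2))) +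
    p * (expR (- (stop_qv z c j / 2)) - Phi) by ring.
move: h1 h2 h3; set E := expR _; lra.
Qed.

(** Markov's inequality at level A before any mean is taken: if |W| > A then 1 <= (|W - S| + |S|)/A,
    and |S| is bounded through [stop_sqrt]. A stopped path is charged to the excess and to |Q -
    V|. *)
Lemma stop_tail_le j (A : R) : 1 <= A ->
  (A < `|W|)%R%:R - A^-1 * \sum_(k < j) stop_slope z c k * stop_inc z c k <=
  (`|W - S j| + `|Q j - V| + 2 * M) + (A^-1 * (1 + c / 2) + excess c V).
Proof.
move=> A1; have A0 : 0 < A by lra.
have l0 : 0 < A^-1 by rewrite invr_gt0.
have l1 : A^-1 <= 1 by rewrite invf_le1.
have /andP[x0 _] := excess_bounds c V.
have sq := stop_sqrt c_ge0 zM j; set X := \sum_(_ < _) _ in sq *.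
set psi := Num.sqrt _ in sq.
have psi0 : `|stop_sum z c j| <= psi by rewrite -sqrtr_sqr ler_wsqrtr// lerDr.
have h : - (A^-1 * X) <= A^-1 * (1 + c / 2) + 2 * M - A^-1 * psi.
  have : A^-1 * psi <= A^-1 * (1 + X + c / 2 + 2 * M) by rewrite ler_pM2l.
  have : A^-1 * (2 * M) <= 2 * M by rewrite ler_piMl// mulr_ge0.
  by rewrite !mulrDr; lra.
have [[q1 q2 q3]|[q1 q2 q3]] := stop_cases c_ge0 zM j; last first.
  have := excess_gt V q3; rewrite -/(Q j).
  have : (A < `|W|)%R%:R <= 1 :> R by rewrite lern1 leq_b1.
  have : 0 <= A^-1 * psi by rewrite mulr_ge0 ?(ltW l0)// sqrtr_ge0.
  by have := normr_ge0 (W - S j); lra.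
have := normr_ge0 (W - S j); have := normr_ge0 (Q j - V).
have psiS : A^-1 * `|S j| <= A^-1 * psi by rewrite ler_pM2l// /S -q3.
have [AW|AW] := ltP A `|W| => n1 n2; last first.
  have : 0 <= A^-1 * psi by rewrite mulr_ge0 ?(ltW l0)// sqrtr_ge0.
  by rewrite /=; lra.
have WS : `|W| <= `|W - S j| + `|S j|.
  by rewrite (le_trans _ (ler_normD _ _))// subrK.
have : A^-1 * A <= A^-1 * (`|W - S j| + `|S j|).
  by rewrite ler_pM2l//; lra.
have : A^-1 * `|W - S j| <= `|W - S j| by rewrite ler_piMl.
by rewrite mulVf ?gt_eqF// mulrDr /=; lra.
Qed.

End stopped_bounds.
End truncation.

(** * Conditional limits of martingale tails *)

Section stable_limit.
Context {d : measure_display} {T : measurableType d} {R : realType}.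
Variable P : probability T R.
Local Notation intg f := (P.-integrable [set: T] (EFin \o f)).

Variables (G : nat -> set (set T)) (e : nat -> T -> R) (al : nat -> R).
Variables (D V : T -> R) (W : nat -> T -> R).
Hypothesis fG : filtration G.
Hypothesis me : forall k, measurable_for (G k.+1) (e k.+1).
Hypothesis ie : forall k, intg (e k.+1).
Hypothesis e_martingale : forall k A, G k A -> \int[P]_(w in A) e k.+1 w = 0.
Hypothesis al_ge0 : forall k, 0 <= al k.
Hypothesis al_gt0 : forall k, 0 < al k.+1.
Hypothesis al_nd : forall n k, (n <= k)%N -> al n <= al k.
Hypothesis al_ratio : al n.+1 / al n @[n --> \oo] --> (1 : R).
Hypothesis iD : intg D.
Hypothesis eD : {ae P, forall w k, al k.+1 * `|e k.+1 w| <= D w}.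
Hypotheses (mV : measurable_fun [set: T] V)
  (mW : forall n, measurable_fun [set: T] (W n)).

Let z n w j := al n * e (n + j).+1 w.
Let S n j w := \sum_(k < j) z n w k.
Let Q n j w := \sum_(k < j) z n w k ^+ 2.

Hypothesis hQ : {ae P, forall w, exists q : nat -> R,
  (forall n, Q n j w @[j --> \oo] --> q n) /\ q @ \oo --> V w}.
Hypothesis hS : {ae P, forall w, exists r : nat -> R,
  (forall n, S n j w @[j --> \oo] --> W n w + r n) /\ r @ \oo --> (0 : R)}.

(** The weight dominating the stopped products: [stop_prod_bound] with M = |D| bounds them by
    [expR c] times X. *)
Let X w := 1 + `|D w|.

Let iX : intg X.
Proof. by apply: integrable_add; [exact: integrable_cst|exact: integrable_normr]. Qed.

Let X_ge1 w : 1 <= X w. Proof. by rewrite lerDl. Qed.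

Let sG n : sigma_algebra setT (G n). Proof. by have [] := fG. Qed.
Let Gm n : G n `<=` measurable. Proof. by have [] := fG. Qed.

(** Splitting off the first term gives q_n = z_{n,0}^2 + (al_n / al_(n+1))^2 q_(n+1). Both q_n and
    q_(n+1) tend to V and the ratio to 1, so the convergence of the quadratic variation alone makes
    the increments small. *)
Lemma increments_cvg0 :
  {ae P, forall w, al k.+1 * e k.+1 w @[k --> \oo] --> (0 : R)}.
Proof.
apply: filterS hQ => w [q [cq qV]].
have step n : (0 < n)%N -> q n = z n w 0 ^+ 2 + (al n / al n.+1) ^+ 2 * q n.+1.
  move=> n0; have cq1 : Q n j.+1 w @[j --> \oo] --> q n.
    by have := cq n; rewrite -(cvg_shiftS (fun j => Q n j w)).
  have cq2 : z n w 0 ^+ 2 + (al n / al n.+1) ^+ 2 * Q n.+1 j w @[j --> \oo] -->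
      z n w 0 ^+ 2 + (al n / al n.+1) ^+ 2 * q n.+1.
    by apply: cvgD; [exact: cvg_cst|apply: cvgMr; exact: cq].
  suff E : (fun j => Q n j.+1 w) =
      (fun j => z n w 0 ^+ 2 + (al n / al n.+1) ^+ 2 * Q n.+1 j w).
    by apply: (cvg_unique _ cq1) => //; rewrite E.
  apply/funext => j; rewrite /Q big_ord_recl big_distrr/=; congr (_ + _).
  apply: eq_bigr => i _; rewrite /z /bump/= add1n addnS addSn -exprMn.
  by rewrite mulrA divfK// gt_eqF.
have ratio : al n / al n.+1 @[n --> \oo] --> (1 : R).
  rewrite -[1]invr1; under eq_fun do rewrite -invf_div.
  by apply: cvgV => //; exact: oner_neq0.
have z20 : z n w 0 ^+ 2 @[n --> \oo] --> (0 : R).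
  have h : q n - (al n / al n.+1) ^+ 2 * q n.+1 @[n --> \oo] -->
      V w - 1 ^+ 2 * V w.
    apply: cvgB => //; apply: cvgM.
      by rewrite expr1n -[1]mulr1; under eq_fun do rewrite expr2; exact: cvgM.
    by rewrite (cvg_shiftS q).
  rewrite expr1n mul1r subrr in h; apply: cvg_trans h; apply: near_eq_cvg.
  by exists 1%N => // n /= n1; rewrite (step n n1) addrK.
have z0 : z n w 0 @[n --> \oo] --> (0 : R).
  apply: norm_cvg0; rewrite -sqrtr0; under eq_fun do rewrite -sqrtr_sqr.
  by apply: continuous_cvg => //; exact: sqrt_continuous.
(* The increment e_(n+1) carries the factor al_n here and needs al_(n+1). The index 0 is excluded
   because al_0 may vanish. *)
have h : al n.+1 / al n * z n w 0 @[n --> \oo] --> (1 * 0 : R) by exact: cvgM.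
rewrite mul1r in h; apply: cvg_trans h; apply: near_eq_cvg.
exists 1%N => // -[//|n] _; rewrite /z addn0 mulrA divfK// gt_eqF//.
Qed.

(** s n majorizes al_k |e_k| over k > n and bounds every increment of stage n since al is
    nondecreasing. It is the M of the pathwise bounds: its limit zero removes the overshoots, its
    bound D makes them integrable. *)
Lemma increment_majorant : exists s : nat -> T -> R,
  [/\ forall n, measurable_fun [set: T] (s n),
    {ae P, forall w n, 0 <= s n w <= D w},
    {ae P, forall w n j, `|z n w j| <= s n w} &
    {ae P, forall w, s ^~ w @ \oo --> (0 : R)}].
Proof.
have mb k : measurable_fun [set: T] (fun w => al k.+1 * e k.+1 w).
  apply: measurable_funM => //; exact: measurable_for_fun (@Gm _) (me k).
have bD : {ae P, forall w k, `|al k.+1 * e k.+1 w| <= D w}.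
  by apply: filterS eD => w h k; rewrite normrM (ger0_norm (al_ge0 _)).
have [s [is_ sD sb s0]] := tail_majorant mb iD bD.
exists s; split=> //.
- by move=> n; exact: integrable_measurable.
- apply: filterS sb => w h n j; apply: le_trans (h n (n + j)%N (leq_addr _ _)).
  rewrite /z !normrM ler_wpM2r// !ger0_norm//.
  by apply: al_nd; rewrite -addnS leq_addr.
- by apply: filterS2 s0 increments_cvg0 => w h1 h2; exact: h1.
Qed.

Local Notation mG k f := (measurable_fun [set: g_sigma_algebraType (G k)]
  (f : g_sigma_algebraType (G k) -> R)).

Let mGP k f : measurable_for (G k) f <-> mG k f.
Proof. exact: measurable_forP. Qed.

Let mG_le k l (f : T -> R) : (k <= l)%N -> measurable_for (G k) f -> measurable_for (G l) f.
Proof. by move=> kl; apply: measurable_for_sub; exact: filtration_le. Qed.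

Let mGz n j : measurable_for (G (n + j).+1) (fun w => z n w j).
Proof.
apply/mGP; apply: measurable_funM; first exact: measurable_cst.
exact/mGP/me.
Qed.

Let mGQ n j : measurable_for (G (n + j)) (Q n j).
Proof.
elim: j => [|j IH].
  apply/mGP; rewrite (_ : Q n 0 = cst 0); first exact: measurable_cst.
  by apply/funext => w; rewrite /Q big_ord0.
rewrite (_ : Q n j.+1 = fun w => Q n j w + z n w j ^+ 2); last first.
  by apply/funext => w; rewrite /Q big_ord_recr.
apply/mGP; apply: measurable_funD.
  by apply/mGP; apply: mG_le IH; rewrite addnS.
by apply: measurable_funX; apply/mGP; rewrite addnS; exact: mGz.
Qed.

Let mS n j : measurable_fun [set: T] (S n j).
Proof.
rewrite /S; elim: j => [|j IH].
  by under eq_fun do rewrite big_ord0; exact: measurable_cst.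
under eq_fun do rewrite big_ord_recr; apply: measurable_funD => //=.
by apply: measurable_for_fun (@Gm _) _; exact: mGz.
Qed.

Let mQ n j : measurable_fun [set: T] (Q n j).
Proof. by apply: measurable_for_fun (@Gm _) _; exact: mGQ. Qed.

(** H(V) is approached by H(Q n j), which is known at time n + j: j tends to infinity, then n. The
    weight X is there because the error will be multiplied by a stopped product. *)
Lemma approximation (H : R -> R) : continuous H -> (forall v, 0 <= H v <= 1) ->
  forall eps, 0 < eps -> exists N Phi, [/\ measurable_for (G N) Phi,
    forall w, 0 <= Phi w <= 1 & \int[P]_w (X w * `|Phi w - H (V w)|) <= eps].
Proof.
move=> cH H01 eps eps0.
have mH : measurable_fun [set: R] H by exact: continuous_measurable_fun.
have [q mq qE] : exists2 q : nat -> T -> R, forall n, measurable_fun [set: T] (q n) &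
    forall n w (l : R), Q n ^~ w @ \oo --> l -> q n w = l.
  have /choice[q hq] : forall n, exists qn : T -> R,
      measurable_fun [set: T] qn /\
      forall w (l : R), Q n ^~ w @ \oo --> l -> qn w = l.
    by move=> n; have [qn ? ?] := ae_cvg_measurable (mQ n); exists qn.
  by exists q => n; have [] := hq n.
have mXH (u : T -> R) : measurable_fun [set: T] u ->
    measurable_fun [set: T] (fun w => X w * `|H (u w) - H (V w)|).
  move=> mu; apply: measurable_funM; first exact: integrable_measurable iX.
  apply: measurableT_comp => //; apply: measurable_funB; exact: measurableT_comp.
have XHX (u : T -> R) w : `|X w * `|H (u w) - H (V w)| | <= X w.
  rewrite ger0_norm ?mulr_ge0// ?(le_trans ler01)// ler_piMr ?(le_trans ler01)//.
  by rewrite ler_norml; have /andP[] := H01 (u w); have /andP[] := H01 (V w); lra.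
have c1 : \int[P]_w (X w * `|H (q n w) - H (V w)|) @[n --> \oo] --> (0 : R).
  rewrite -(mul0r (fine (P setT))) -(Rintegral_cst P measurableT 0).
  apply: (proj2 (@Rintegral_dominated _ _ _ P setT
    (fun n w => X w * `|H (q n w) - H (V w)|) (fun=> 0) X measurableT
    (fun n => mXH _ (mq n)) _ _ iX _)) => //.
    apply: filterS hQ => w [q' [cq qV]].
    have -> : (fun n => X w * `|H (q n w) - H (V w)|) =
        (fun n => X w * `|H (q' n) - H (V w)|).
      by apply/funext => n; rewrite (qE n w _ (cq n)).
    rewrite -(mulr0 (X w)); apply: cvgMr; rewrite -(normr0 R) -(subrr (H (V w))).
    apply: cvg_norm; apply: cvgB; last exact: cvg_cst.
    by apply: continuous_cvg => //; exact: cH.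
  by apply: aeW => w n; exact: XHX.
have c2 n : \int[P]_w (X w * `|H (Q n j w) - H (V w)|) @[j --> \oo] -->
    \int[P]_w (X w * `|H (q n w) - H (V w)|).
  apply: (proj2 (@Rintegral_dominated _ _ _ P setT
    (fun j w => X w * `|H (Q n j w) - H (V w)|)
    (fun w => X w * `|H (q n w) - H (V w)|) X measurableT
    (fun j => mXH _ (mQ n j)) (mXH _ (mq n)) _ iX _)) => //.
    apply: filterS hQ => w [q' [cq qV]]; apply: cvgMr; apply: cvg_norm.
    apply: cvgB; last exact: cvg_cst.
    by rewrite (qE n w _ (cq n)); apply: continuous_cvg => //; exact: cH.
  by apply: aeW => w j; exact: XHX.
have eps20 : 0 < eps / 2 by rewrite divr_gt0.
have /cvgrPdist_le/(_ _ eps20)[n _ /(_ n (leqnn n))] := c1.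
rewrite sub0r normrN => /(le_trans (ler_norm _)) hn.
have /cvgrPdist_le/(_ _ eps20)[j _ /(_ j (leqnn j))] := c2 n.
rewrite distrC => /(le_trans (ler_norm _)) hj.
exists (n + j)%N, (fun w => H (Q n j w)); split.
- apply/mGP; apply: measurableT_comp => //; exact/mGP/mGQ.
- by move=> w; exact: H01.
- by lra.
Qed.

Lemma Rintegral_increment_mul k (psi : T -> R) (M : R) :
  measurable_for (G k) psi -> (forall w, `|psi w| <= M) ->
  \int[P]_w (e k.+1 w * psi w) = 0.
Proof. by apply: Rintegral_orthogonal => //; exact: e_martingale. Qed.

(* The passage j -> oo for fixed n, followed by n -> oo. *)
Lemma limit_step (F : nat -> T -> R) (f B : nat -> nat -> T -> R)
    (g Phi rest : T -> R) (N : nat) :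
  (forall n, intg (F n)) -> (forall n j, (N <= n)%N -> intg (f n j)) ->
  intg g -> intg Phi -> intg rest ->
  (forall n j, measurable_fun [set: T] (B n j)) ->
  (forall n j A, (N <= n)%N -> G n A ->
    \int[P]_(w in A) f n j w = \int[P]_(w in A) F n w - \int[P]_(w in A) Phi w) ->
  {ae P, forall w, 0 <= rest w} ->
  {ae P, forall w n j, (N <= n)%N -> f n j w <= g w} ->
  {ae P, forall w n j, (N <= n)%N -> f n j w <= B n j w + rest w} ->
  {ae P, forall w, exists E : nat -> R,
     (forall n, B n j w @[j --> \oo] --> E n) /\ E @ \oo --> (0 : R)} ->
  forall eps, 0 < eps -> exists N' h,
    [/\ (N <= N')%N, intg h, {ae P, forall w, 0 <= h w}, \int[P]_w h w <= eps &
      forall n A, (N' <= n)%N -> G n A -> \int[P]_(w in A) F n w <=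
        \int[P]_(w in A) Phi w + \int[P]_(w in A) h w +
        \int[P]_(w in A) rest w].
Proof.
move=> iF if_ ig iPhi irest mB fF rest0 fg fB cB eps eps0.
have [E mE EE] : exists2 E : nat -> T -> R, forall n, measurable_fun [set: T] (E n) &
    forall n w (l : R), B n ^~ w @ \oo --> l -> E n w = l.
  have /choice[E hE] : forall n, exists En : T -> R,
      measurable_fun [set: T] En /\
      forall w (l : R), B n ^~ w @ \oo --> l -> En w = l.
    by move=> n; have [En ? ?] := ae_cvg_measurable (mB n); exists En.
  by exists E => n; have [] := hE n.
(* The limiting bound E n need not be integrable. Capped by |g| it is, and it still bounds the limit
   because f n j <= g. *)
pose b n w := Num.min `|g w| (Num.max 0 (E n w)).
have b0 n w : 0 <= b n w by rewrite /b le_min normr_ge0/= le_max lexx.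
have bg n w : b n w <= `|g w| by rewrite /b ge_min lexx.
have mb n : measurable_fun [set: T] (b n).
  apply: measurable_minr.
    by apply: measurableT_comp => //; exact: integrable_measurable ig.
  by apply: measurable_maxr.
have bD : {ae P, forall w n, `|b n w| <= `|g w|}.
  by apply: aeW => w n; rewrite ger0_norm.
(* One function s N' dominates b n for all n >= N'; this uniformity in n is what the maximal
   inequality uses. *)
have [s [is_ sg sb s0]] := tail_majorant mb (integrable_normr ig) bD.
have b_cvg0 : {ae P, forall w, b ^~ w @ \oo --> (0 : R)}.
  apply: filterS cB => w [E' [cE E'0]].
  have EE' n : E n w = E' n by exact: EE.
  apply/cvgrPdist_le => e' e'0; have /cvgrPdist_le/(_ _ e'0)[m _ hm] := E'0.
  exists m => // n /hm; rewrite /= !sub0r !normrN (ger0_norm (b0 n w)) -EE' => h.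
  rewrite /b ge_min; apply/orP; right; rewrite ge_max (ltW e'0)/=.
  exact: le_trans (ler_norm _) h.
have cs : \int[P]_w s n w @[n --> \oo] --> (0 : R).
  rewrite -(mul0r (fine (P setT))) -(Rintegral_cst P measurableT 0).
  apply: (proj2 (@Rintegral_dominated _ _ _ P setT s (fun=> 0) (fun w => `|g w|)
    measurableT (fun n => integrable_measurable (is_ n)) _ _ (integrable_normr ig) _)).
  - exact: measurable_cst.
  - by apply: filterS2 s0 b_cvg0 => w h1 h2; exact: h1.
  - by apply: filterS sg => w h n; have /andP[? ?] := h n; rewrite ger0_norm.
have /cvgrPdist_le/(_ _ eps0)[m _ hm] := cs.
pose N' := maxn N m; exists N', (s N'); split.
- exact: leq_maxl.
- exact: is_.
- by apply: filterS sg => w /(_ N')/andP[].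
- have := hm N' (leq_maxr _ _); rewrite sub0r normrN.
  exact: le_trans (ler_norm _).
move=> n A N'n GA; have mA := Gm GA.
have Nn : (N <= n)%N by apply: leq_trans N'n; exact: leq_maxl.
have ib : intg (b n).
  apply: (ae_le_integrable (mb n) (integrable_normr ig)).
  by apply: filterS bD.
have iY : intg (fun w => b n w + rest w) by exact: integrable_add.
have key : \int[P]_(w in A) F n w - \int[P]_(w in A) Phi w <=
    \int[P]_(w in A) (b n w + rest w).
  have fY : {ae P, forall w eps', 0 < eps' ->
      \forall j \near \oo, f n j w <= (b n w + rest w) + eps'}.
    have fg' : {ae P, forall w j, f n j w <= g w}.
      by apply: filterS fg => w h j; exact: h.
    have fB' : {ae P, forall w j, f n j w <= B n j w + rest w}.
      by apply: filterS fB => w h j; exact: h.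
    apply: filterS2 (filterI fg' fB') (filterI rest0 cB).
    move=> w [h1 h2] [r0 [E' [cE _]]] eps' eps'0.
    have /cvgrPdist_le/(_ _ eps'0) := cE n; apply: filterS => j.
    rewrite -(EE n w _ (cE n)) => hj.
    have hj' : B n j w <= E n w + eps'.
      by have := le_trans (ler_norm _) hj; rewrite distrC in hj;
        have := le_trans (ler_norm _) hj; lra.
    have [h|h] := leP `|g w| (Num.max 0 (E n w)); rewrite /b.
      by rewrite min_l//; have := ler_norm (g w); have := h1 j; lra.
    rewrite (min_r (ltW h)); have : E n w <= Num.max 0 (E n w).
      by rewrite le_max lexx orbT.
    by have := h2 j; lra.
  (* By [fF] the integral of f n j over A does not depend on j, so reverse Fatou gives a bound for
     that constant. *)
  apply: (reverse_fatou mA (fun j => if_ n j Nn) ig iY) fY.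
    by move=> j; exact: fF.
  by apply: filterS fg => w h j; exact: h.
have mY : \int[P]_(w in A) (b n w + rest w) <=
    \int[P]_(w in A) s N' w + \int[P]_(w in A) rest w.
  rewrite RintegralD//; [|exact: integrable_sub..].
  rewrite lerD2r; apply: ae_le_Rintegral => //.
  apply: filterS sb => w h; have := h N' n N'n.
  exact: le_trans (ler_norm _).
by lra.
Qed.

Section stopped.
Variable c : R.
Hypothesis c_ge0 : 0 <= c.

Let C := expR c.
Let C1 : 1 <= C. Proof. by rewrite /C -expR0 ler_expR. Qed.

Lemma stop_measurable n j :
  [/\ measurable_for (G (n + j)) (fun w => stop_qv (z n w) c j),
      measurable_for (G (n + j)) (fun w => (stop_prod (z n w) c j).1),
      measurable_for (G (n + j)) (fun w => (stop_prod (z n w) c j).2) &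
      measurable_for (G (n + j)) (fun w => stop_sum (z n w) c j)] /\
  measurable_for (G (n + j).+1) (fun w => stop_inc (z n w) c j).
Proof.
have minc k : measurable_for (G (n + k)) (fun w => stop_qv (z n w) c k) ->
    measurable_for (G (n + k).+1) (fun w => stop_inc (z n w) c k).
  move=> mq; apply/mGP; apply: measurable_fun_ifT.
  - apply: measurable_fun_ler; last exact: measurable_cst.
    by apply/mGP; apply: mG_le mq.
  - by apply/mGP; exact: mGz.
  - exact: measurable_cst.
suff h : [/\ measurable_for (G (n + j)) (fun w => stop_qv (z n w) c j),
      measurable_for (G (n + j)) (fun w => (stop_prod (z n w) c j).1),
      measurable_for (G (n + j)) (fun w => (stop_prod (z n w) c j).2) &
      measurable_for (G (n + j)) (fun w => stop_sum (z n w) c j)].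
  by split=> //; apply: minc; have [] := h.
elim: j => [|j [IHq IHa IHb IHs]].
  have m0 (r : R) : measurable_for (G (n + 0)) (fun=> r).
    by apply/mGP; exact: measurable_cst.
  split; [exact: m0|exact: m0|exact: m0|].
  by rewrite /stop_sum; under eq_fun do rewrite big_ord0; exact: m0.
have is_ := minc _ IHq; rewrite -addnS in is_.
have up (f : T -> R) : measurable_for (G (n + j)) f ->
    measurable_for (G (n + j.+1)) f by apply: mG_le; rewrite addnS.
split; apply/mGP.
- apply: measurable_funD; first by apply/mGP; exact: up.
  by apply: measurable_funX; exact/mGP.
- apply: measurable_funB; first by apply/mGP; exact: up.
  by apply: measurable_funM; apply/mGP; [exact: up|].
- apply: measurable_funD; first by apply/mGP; exact: up.
  by apply: measurable_funM; apply/mGP; [exact: up|].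
- under eq_fun do rewrite stop_sumS; apply: measurable_funD; apply/mGP => //.
  exact: up.
Qed.

(** The multiplier is bounded only where the increment is kept: a stopped product is below a
    constant before the crossing, but only below a random variable afterwards. *)
Lemma Rintegral_stop_inc n j (psi : T -> R) (M : R) :
  measurable_for (G (n + j)) psi ->
  (forall w, stop_qv (z n w) c j <= c -> `|psi w| <= M) ->
  intg (fun w => psi w * stop_inc (z n w) c j) /\
  \int[P]_w (psi w * stop_inc (z n w) c j) = 0.
Proof.
move=> mpsi psiM; have [[mq _ _ _] _] := stop_measurable n j.
pose psi' w := al n * (if stop_qv (z n w) c j <= c then psi w else 0).
have -> : (fun w => psi w * stop_inc (z n w) c j) =
    (fun w => e (n + j).+1 w * psi' w).
  apply/funext => w; rewrite /psi' /stop_inc; case: ifP => _; last by ring.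
  by rewrite /z; ring.
have mpsi' : measurable_for (G (n + j)) psi'.
  apply/mGP; apply: measurable_funM; first exact: measurable_cst.
  apply: measurable_fun_ifT; [|exact/mGP|exact: measurable_cst].
  by apply: measurable_fun_ler; [exact/mGP|exact: measurable_cst].
have psi'M w : `|psi' w| <= al n * `|M|.
  rewrite /psi' normrM (ger0_norm (al_ge0 n)) ler_wpM2l//.
  case: ifP => [/psiM/le_trans|_]; last by rewrite normr0.
  by apply; exact: ler_norm.
split; last exact: Rintegral_increment_mul psi'M.
apply: (integrable_mulr (ie _) _ psi'M).
exact: measurable_for_fun (@Gm _) mpsi'.
Qed.

Lemma stop_prod_integrable n j :
  intg (fun w => (stop_prod (z n w) c j).1) /\
  intg (fun w => (stop_prod (z n w) c j).2).
Proof.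
have [[_ ma mb _] _] := stop_measurable n j.
have [s [_ sD sz _]] := increment_majorant.
have h : {ae P, forall w, `|(stop_prod (z n w) c j).1| <= C * X w /\
                        `|(stop_prod (z n w) c j).2| <= C * X w}.
  apply: filterS2 sD sz => w /(_ n)/andP[s0 sDw] zs.
  have zD k : `|z n w k| <= `|D w|.
    by apply: le_trans (zs n k) _; apply: le_trans sDw _; exact: ler_norm.
  exact: (stop_prod_bound c_ge0 zD).
have iCX : intg (fun w => C * X w) by exact: integrable_scale.
split; apply: (ae_le_integrable _ iCX).
- exact: measurable_for_fun (@Gm _) ma.
- by apply: filterS h => w [].
- exact: measurable_for_fun (@Gm _) mb.
- by apply: filterS h => w [].
Qed.

(** Multiplying by 1 + i s adds to each coordinate a predictable multiple of a stopped increment,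
    which integrates to zero against psi. *)
Lemma stop_prod_martingale n j (psi : T -> R) (M : R) :
  measurable_for (G n) psi -> (forall w, `|psi w| <= M) ->
  \int[P]_w ((stop_prod (z n w) c j).1 * psi w) = \int[P]_w psi w /\
  \int[P]_w ((stop_prod (z n w) c j).2 * psi w) = 0.
Proof.
move=> mpsi psiM.
have mpsiT : measurable_fun [set: T] psi := measurable_for_fun (@Gm _) mpsi.
elim: j => [|j [IHa IHb]].
  split; first by apply: eq_Rintegral => w _; rewrite mul1r.
  by under eq_Rintegral do rewrite mul0r; rewrite Rintegral_cst// mul0r.
have [ia ib] := stop_prod_integrable n j.
have [[mq ma mb _] _] := stop_measurable n j.
(* Where the increment is kept the squared modulus is at most [expR c], hence so is the modulus, as
   C <= C^2. *)
have bnd w : stop_qv (z n w) c j <= c ->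
    `|(stop_prod (z n w) c j).1| <= C /\ `|(stop_prod (z n w) c j).2| <= C.
  move=> qc; have := stop_prod_norm (z n w) c j.
  have : expR (stop_qv (z n w) c j) <= C by rewrite ler_expR.
  have : C <= C ^+ 2 by rewrite expr2 ler_peMl// (le_trans ler01).
  set a := _.1; set b := _.2 => h1 h2 h3.
  have C0 : 0 <= C by exact: le_trans ler01 C1.
  by split; rewrite -(ler_pXn2r (n := 2)) ?nnegrE// real_normK ?num_real//;
    have := sqr_ge0 a; have := sqr_ge0 b; lra.
have mpsi_j : measurable_for (G (n + j)) psi by apply: mG_le mpsi; exact: leq_addr.
have := @Rintegral_stop_inc n j (fun w => (stop_prod (z n w) c j).2 * psi w) (C * M).
have := @Rintegral_stop_inc n j (fun w => (stop_prod (z n w) c j).1 * psi w) (C * M).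
case.
- by apply/mGP; apply: measurable_funM; exact/mGP.
- by move=> w /bnd[h _]; rewrite normrM ler_pM.
move=> ias as0; case.
- by apply/mGP; apply: measurable_funM; exact/mGP.
- by move=> w /bnd[_ h]; rewrite normrM ler_pM.
move=> ibs bs0.
have iap : intg (fun w => (stop_prod (z n w) c j).1 * psi w).
  exact: integrable_mulr psiM.
have ibp : intg (fun w => (stop_prod (z n w) c j).2 * psi w).
  exact: integrable_mulr psiM.
split.
- under eq_Rintegral do rewrite stop_prodS /= mulrBl mulrAC.
  by rewrite RintegralB// IHa bs0 subr0.
- under eq_Rintegral do rewrite stop_prodS /= mulrDl mulrAC.
  by rewrite RintegralD// IHb as0 addr0.
Qed.

(** The common shape of the vanishing errors in the cosine and the tail estimates: distance of the
    sums, weighted distance of the quadratic variations, overshoot. *)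
Lemma limit_ingredients (s : nat -> T -> R) (k : nat -> T -> R) (l : R -> R) :
  {ae P, forall w, s ^~ w @ \oo --> (0 : R)} ->
  (forall w, s ^~ w @ \oo --> (0 : R) -> exists r : R, k ^~ w @ \oo --> r) ->
  l x @[x --> (0 : R)] --> (0 : R) ->
  {ae P, forall w, exists E : nat -> R, (forall n,
    `|W n w - S n j w| + k n w * `|Q n j w - V w| + l (s n w) @[j --> \oo] --> E n) /\
    E @ \oo --> (0 : R)}.
Proof.
move=> s0 kb l0; apply: filterS2 (filterI s0 hQ) hS => w [sw [q [cq qV]]] [r [cr r0]].
exists (fun n => `|- r n| + k n w * `|q n - V w| + l (s n w)); split=> [n|].
  apply: cvgD; last exact: cvg_cst.
  apply: cvgD; last first.
    by apply: cvgMr; apply: cvg_norm; apply: cvgB => //; exact: cvg_cst.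
  apply: cvg_norm; rewrite (_ : - r n = W n w - (W n w + r n)); last by ring.
  by apply: cvgB => //; exact: cvg_cst.
rewrite -[0]addr0; apply: cvgD; last first.
  exact: (@cvg_comp _ _ _ (fun n => s n w) l _ _ _ sw l0).
rewrite -[0]addr0; apply: cvgD.
  by rewrite -(normr0 R) -oppr0; apply: cvg_norm; apply: cvgN.
have [r' kr] := kb w sw.
rewrite -(mulr0 r') -(normr0 R) -(subrr (V w)); apply: cvgM => //.
by apply: cvg_norm; apply: cvgB => //; exact: cvg_cst.
Qed.

(** Two approximations enter: Phi1 stands for exp(-V/2) inside the product formula, and Phi2 for the
    excess, so that the final bound is measurable at a fixed time. *)
Lemma cond_limsup_le_cos th : cond_limsup_le P G
  (fun n w => cos (W n w - th))
  (fun w => cos th * gauss_cut c (V w) + 2 * excess c (V w)).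
Proof.
move=> eps eps0.
have C0 : 0 < C by exact: lt_le_trans ltr01 C1.
(* The error function h' spends (2C + 2) [eps1] besides eps/2, and the L^1 distance of Phi spends 3
   [eps1]. *)
pose eps1 := eps / (2 * (2 * C + 3)).
have eps10 : 0 < eps1 by rewrite divr_gt0// mulr_gt0// addr_gt0// mulr_gt0.
have eps1E : (2 * C + 3) * eps1 = eps / 2.
  by rewrite /eps1; field; rewrite gt_eqF// addr_gt0// mulr_gt0.
have [N1 [Phi1 [mPhi1 Phi101 int1]]] :=
  approximation (@continuous_gauss_cut R c) (gauss_cut_bounds c) eps10.
have [N2 [Phi2 [mPhi2 Phi201 int2]]] :=
  approximation (@continuous_excess R c) (excess_bounds c) eps10.
have [s [ms sD sz s0]] := increment_majorant.
have mT1 := measurable_for_fun (@Gm _) mPhi1.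
have mT2 := measurable_for_fun (@Gm _) mPhi2.
have mgc : measurable_fun [set: T] (fun w => gauss_cut c (V w)).
  apply: (@measurableT_comp _ _ _ _ _ _ (gauss_cut c)) => //.
  by apply: continuous_measurable_fun; exact: continuous_gauss_cut.
have mex : measurable_fun [set: T] (fun w => excess c (V w)).
  apply: (@measurableT_comp _ _ _ _ _ _ (excess c)) => //.
  by apply: continuous_measurable_fun; exact: continuous_excess.
have i01 (f : T -> R) : measurable_fun [set: T] f -> (forall w, 0 <= f w <= 1) -> intg f.
  move=> mf f01; apply: (bounded_integrable P (M := 1)) => // w.
  by have /andP[? ?] := f01 w; rewrite ger0_norm.
have iP1 := i01 _ mT1 Phi101; have iP2 := i01 _ mT2 Phi201.
have igc := i01 _ mgc (fun w => gauss_cut_bounds c (V w)).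
have iex := i01 _ mex (fun w => excess_bounds c (V w)).
pose d1 w := X w * `|Phi1 w - gauss_cut c (V w)|.
pose d2 w := X w * `|Phi2 w - excess c (V w)|.
have dist01 (u v : R) : 0 <= u <= 1 -> 0 <= v <= 1 -> `| `|u - v| | <= 1.
  by move=> /andP[? ?] /andP[? ?]; rewrite normr_id ler_norml; lra.
have id1 : intg d1.
  apply: (integrable_mulr (M := 1)) => //.
    by apply: measurableT_comp => //; exact: measurable_funB.
  by move=> w; apply: dist01 => //; exact: gauss_cut_bounds.
have id2 : intg d2.
  apply: (integrable_mulr (M := 1)) => //.
    by apply: measurableT_comp => //; exact: measurable_funB.
  by move=> w; apply: dist01 => //; exact: excess_bounds.
have X0 w : 0 <= X w by exact: le_trans ler01 (X_ge1 w).
have d10 w : 0 <= d1 w by rewrite mulr_ge0.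
have d20 w : 0 <= d2 w by rewrite mulr_ge0.
have le_d1 w : `|Phi1 w - gauss_cut c (V w)| <= d1 w by rewrite ler_peMl.
have le_d2 w : `|Phi2 w - excess c (V w)| <= d2 w by rewrite ler_peMl.
pose rest w := 2 * C * d1 w + 2 * excess c (V w).
pose F n w := cos (W n w - th).
pose f n j w := F n w - ((stop_prod (z n w) c j).1 * cos th +
  (stop_prod (z n w) c j).2 * sin th) * Phi1 w.
pose k n w := 2 + 2 * (C * (1 + s n w)).
pose l (x : R) := 3 * x * (c + x ^+ 2) + 2 * (C * (1 + x)) * x ^+ 2.
pose B n j w := `|W n w - S n j w| + k n w * `|Q n j w - V w| + l (s n w).
pose g w := 1 + 2 * C * X w.
have mF n : measurable_fun [set: T] (F n).
  apply: (@measurableT_comp _ _ _ _ _ _ (@cos R)).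
    by apply: continuous_measurable_fun; exact: continuous_cos.
  by apply: measurable_funB.
have iF n : intg (F n).
  by apply: (bounded_integrable P (M := 1)) => // w; exact: cos_max.
have iab n j : intg (fun w => (stop_prod (z n w) c j).1 * cos th +
    (stop_prod (z n w) c j).2 * sin th).
  have [ia ib] := stop_prod_integrable n j.
  under eq_fun do rewrite (mulrC _ (cos th)) (mulrC _ (sin th)).
  by apply: integrable_add; exact: integrable_scale.
have normPhi1 w : `|Phi1 w| <= 1.
  by have /andP[? ?] := Phi101 w; rewrite ger0_norm.
have iabP n j : intg (fun w => ((stop_prod (z n w) c j).1 * cos th +
    (stop_prod (z n w) c j).2 * sin th) * Phi1 w).
  exact: integrable_mulr (iab n j) mT1 normPhi1.
have if_ n j : intg (f n j) by apply: integrable_sub_fun.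
have ig : intg g.
  by apply: integrable_add; [exact: integrable_cst|exact: integrable_scale].
have irest : intg rest.
  by apply: integrable_add; exact: integrable_scale.
have icP : intg (fun w => cos th * Phi1 w) by exact: integrable_scale.
(* For n >= N1 the variable Phi1 times the indicator of A is bounded and measurable for G n, so the
   product is replaced by its conditional mean 1. *)
have fF n j A : (N1 <= n)%N -> G n A -> \int[P]_(w in A) f n j w =
    \int[P]_(w in A) F n w - \int[P]_(w in A) (cos th * Phi1 w).
  move=> Nn GA; have mA := Gm GA.
  rewrite /f RintegralB//; [|exact: integrable_sub..]; congr (_ - _).
  pose psi w := Phi1 w * \1_A w.
  have mpsi : measurable_for (G n) psi.
    apply/mGP; apply: measurable_funM; first by apply/mGP; apply: mG_le mPhi1.
    by apply: measurable_indic; exact/measurable_sub_sigmaP.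
  have psi1 w : `|psi w| <= 1.
    rewrite /psi normrM -[1]mulr1 ler_pM// indicE.
    by case: (_ \in _); rewrite ?normr1 ?normr0.
  have [ma mb] := stop_prod_martingale j mpsi psi1.
  have [ia ib] := stop_prod_integrable n j.
  have mpsiT := measurable_for_fun (@Gm _) mpsi.
  have iap : intg (fun w => (stop_prod (z n w) c j).1 * psi w).
    exact: integrable_mulr psi1.
  have ibp : intg (fun w => (stop_prod (z n w) c j).2 * psi w).
    exact: integrable_mulr psi1.
  rewrite Rintegral_indicM// RintegralZl//; last exact: integrable_sub.
  rewrite (Rintegral_indicM mA iP1) -/psi -ma.
  have -> : (fun w => ((stop_prod (z n w) c j).1 * cos th +
      (stop_prod (z n w) c j).2 * sin th) * Phi1 w * \1_A w) =
      (fun w => cos th * ((stop_prod (z n w) c j).1 * psi w) +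
        sin th * ((stop_prod (z n w) c j).2 * psi w)).
    by apply/funext => w; rewrite /psi; ring.
  rewrite RintegralD//; [|exact: integrable_scale..].
  by rewrite !RintegralZl// mb mulr0 addr0.
have rest0 : {ae P, forall w, 0 <= rest w}.
  apply: aeW => w; have /andP[x0 _] := excess_bounds c (V w).
  by rewrite /rest addr_ge0// mulr_ge0// ?mulr_ge0// ltW.
have fB : {ae P, forall w n j, f n j w <= g w /\ f n j w <= B n j w + rest w}.
  apply: filterS2 sD sz => w sDw szw n j.
  have /andP[sn0 snD] := sDw n.
  have sX : 1 + s n w <= X w by rewrite lerD2l (le_trans snD)// ler_norm.
  split.
    have := stop_prod_trig_bound c_ge0 (szw n) j th; rewrite -/C.
    rewrite /f /g; set p := _ + _ * sin th => pC.
    have : `|p * Phi1 w| <= 2 * C * X w.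
      rewrite normrM; apply: (@le_trans _ _ `|p|); first by rewrite ler_piMr.
      by apply: le_trans pC _; rewrite mulrA ler_pM2l// mulr_gt0.
    by rewrite ler_norml => /andP[h _]; have := cos_le1 (W n w - th); rewrite /F; lra.
  apply: le_trans (stop_cos_le c_ge0 (szw n) (V w) (W n w) j th (Phi1 w)) _.
  rewrite -/C /B /rest /k /l -/(S n j w) -/(Q n j w).
  have : 2 * (C * (1 + s n w)) * `|Phi1 w - gauss_cut c (V w)| <= 2 * C * d1 w.
    rewrite /d1 -!mulrA ler_pM2l// ler_pM2l//.
    by rewrite ler_wpM2r.
  by lra.
have mB n j : measurable_fun [set: T] (B n j).
  apply: measurable_funD.
    apply: measurable_funD.
      by apply: measurableT_comp => //; exact: measurable_funB.
    apply: measurable_funM.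
      by apply: measurable_funD => //; apply: measurable_funM => //;
        apply: measurable_funM => //; exact: measurable_funD.
    by apply: measurableT_comp => //; exact: measurable_funB.
  apply: measurable_funD; apply: measurable_funM.
  - exact: measurable_funM.
  - by apply: measurable_funD => //; exact: measurable_funX.
  - by apply: measurable_funM => //; apply: measurable_funM => //; exact: measurable_funD.
  - exact: measurable_funX.
have cB : {ae P, forall w, exists E : nat -> R,
    (forall n, B n j w @[j --> \oo] --> E n) /\ E @ \oo --> (0 : R)}.
  apply: (limit_ingredients s0).
    move=> w sw; exists (2 + 2 * (C * (1 + 0))).
    apply: cvgD; first exact: cvg_cst.
    apply: cvgMr; apply: cvgMr; apply: cvgD => //; exact: cvg_cst.
  have cl : continuous l.
    move=> x; apply: cvgD; apply: cvgM.
    - by apply: cvgMr; exact: cvg_id.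
    - by apply: cvgD; [exact: cvg_cst|exact: exprn_continuous].
    - apply: cvgMr; apply: cvgMr; apply: cvgD; [exact: cvg_cst|exact: cvg_id].
    - exact: exprn_continuous.
  by have := cl 0; rewrite /continuous_at /l expr0n/= !(mulr0, mul0r) addr0.
have eps20 : 0 < eps / 2 by rewrite divr_gt0.
have [] := @limit_step F f B g (fun w => cos th * Phi1 w) rest N1 iF
  (fun n j _ => if_ n j) ig icP irest mB fF rest0 _ _ cB (eps / 2) eps20.
- by apply: filterS fB => w h n j _; have [] := h n j.
- by apply: filterS fB => w h n j _; have [] := h n j.
move=> N' [h [N1N' ih h0 hle key]].
pose N := maxn N' N2.
(* The excess left in [rest] is not measurable at a finite time; it is replaced by Phi2, and d2 in
   h' pays for the difference. *)
pose Phi w := cos th * Phi1 w + 2 * Phi2 w.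
pose h' w := h w + (2 * C * d1 w + 2 * d2 w).
have ih' : intg h'.
  by apply: integrable_add => //; apply: integrable_add; exact: integrable_scale.
have iPhi : intg Phi.
  by apply: integrable_add => //; exact: integrable_scale.
have id12 : intg (fun w => 2 * C * d1 w + 2 * d2 w).
  by apply: integrable_add; exact: integrable_scale.
exists N, Phi, h'; split; split.
- apply/mGP; apply: measurable_funD; apply: measurable_funM;
    try exact: measurable_cst; apply/mGP.
    apply: mG_le mPhi1; apply: leq_trans N1N' _; exact: leq_maxl.
  by apply: mG_le mPhi2; exact: leq_maxr.
- exact: iPhi.
- exact: ih'.
- apply: filterS h0 => w h0; rewrite /h' addr_ge0// addr_ge0// mulr_ge0//.
  by rewrite mulr_ge0// ltW.
- rewrite /h' RintegralD//.
  rewrite RintegralD//; [|exact: integrable_scale..].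
  rewrite !RintegralZl//.
  have : 2 * C * \int[P]_w d1 w <= 2 * C * eps1 by rewrite ler_pM2l// mulr_gt0.
  by move: eps1E; lra.
- apply: integrable_normr; apply: integrable_sub_fun => //.
  by apply: integrable_add; exact: integrable_scale.
- apply: (@le_trans _ _ (\int[P]_w (d1 w + 2 * d2 w))).
    apply: le_Rintegral => //.
    + apply: integrable_normr; apply: integrable_sub_fun => //.
      by apply: integrable_add; exact: integrable_scale.
    + by apply: integrable_add => //; exact: integrable_scale.
    move=> w _; rewrite /Phi.
    have -> : cos th * Phi1 w + 2 * Phi2 w -
        (cos th * gauss_cut c (V w) + 2 * excess c (V w)) =
        cos th * (Phi1 w - gauss_cut c (V w)) + 2 * (Phi2 w - excess c (V w)).
      by ring.
    apply: le_trans (ler_normD _ _) _; rewrite !normrM; apply: lerD.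
      by apply: le_trans (le_d1 w); rewrite ler_piMl// cos_max.
    by rewrite ger0_norm// ler_pM2l.
  rewrite RintegralD//; last exact: integrable_scale.
  rewrite RintegralZl//.
  have : 0 <= 2 * C * eps1 by exact: mulr_ge0 (mulr_ge0 _ (ltW C0)) (ltW eps10).
  by move: eps1E; lra.
move=> n A Nn GA; have mA := Gm GA.
have N'n : (N' <= n)%N by apply: leq_trans Nn; exact: leq_maxl.
apply: le_trans (key n A N'n GA) _.
rewrite -!RintegralD//; try exact: integrable_sub; last first.
  by apply: integrable_sub => //; exact: integrable_add.
apply: le_Rintegral => //.
- by apply: integrable_sub => //; apply: integrable_add => //; exact: integrable_add.
- by apply: integrable_sub => //; exact: integrable_add.
move=> w _; rewrite /rest /Phi /h'.
have := le_d2 w; have := ler_norm (- (Phi2 w - excess c (V w))).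
by rewrite normrN; lra.
Qed.

(** The subtracted term is a martingale transform with slopes bounded by 1, of mean zero over each
    event of G n. The constant part is kept exactly and only the excess is approximated. *)
Lemma cond_limsup_le_tail (A : R) : 1 <= A -> cond_limsup_le P G
  (fun n w => (A < `|W n w|)%R%:R)
  (fun w => A^-1 * (1 + c / 2) + excess c (V w)).
Proof.
move=> A1 eps eps0; have A0 : 0 < A by exact: lt_le_trans A1.
have eps20 : 0 < eps / 2 by rewrite divr_gt0.
have [N2 [Phi2 [mPhi2 Phi201 int2]]] :=
  approximation (@continuous_excess R c) (excess_bounds c) eps20.
have [s [ms sD sz s0]] := increment_majorant.
have mT2 := measurable_for_fun (@Gm _) mPhi2.
have mex : measurable_fun [set: T] (fun w => excess c (V w)).
  apply: (@measurableT_comp _ _ _ _ _ _ (excess c)) => //.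
  by apply: continuous_measurable_fun; exact: continuous_excess.
have i01 (f : T -> R) : measurable_fun [set: T] f -> (forall w, 0 <= f w <= 1) -> intg f.
  move=> mf f01; apply: (bounded_integrable P (M := 1)) => // w.
  by have /andP[? ?] := f01 w; rewrite ger0_norm.
have iP2 := i01 _ mT2 Phi201.
have iex := i01 _ mex (fun w => excess_bounds c (V w)).
pose d2 w := X w * `|Phi2 w - excess c (V w)|.
have id2 : intg d2.
  apply: (integrable_mulr (M := 1)) => //.
    by apply: measurableT_comp => //; exact: measurable_funB.
  move=> w; have /andP[? ?] := Phi201 w.
  by have /andP[? ?] := excess_bounds c (V w); rewrite normr_id ler_norml; lra.
have X0 w : 0 <= X w by exact: le_trans ler01 (X_ge1 w).
have d20 w : 0 <= d2 w by rewrite mulr_ge0.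
have le_d2 w : `|Phi2 w - excess c (V w)| <= d2 w by rewrite ler_peMl.
pose a := A^-1 * (1 + c / 2).
have a0 : 0 <= a.
  apply: mulr_ge0; first by rewrite invr_ge0 ltW.
  by rewrite addr_ge0// divr_ge0.
pose rest w := a + excess c (V w).
pose F n w : R := (A < `|W n w|)%R%:R.
pose f n j w := F n w -
  A^-1 * \sum_(k < j) stop_slope (z n w) c k * stop_inc (z n w) c k.
pose B n j w := `|W n w - S n j w| + 1 * `|Q n j w - V w| + 2 * s n w.
pose g w := (2 + c / 2) + 2 * X w.
have mF n : measurable_fun [set: T] (F n).
  rewrite (_ : F n = \1_[set w | A < `|W n w|]); last first.
    apply/funext => w; rewrite indicE /F; congr (nat_of_bool _)%:R.
    by apply/idP/idP; rewrite inE.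
  by apply: measurable_indic; apply: measurable_gt; exact: measurableT_comp.
have F1 n w : 0 <= F n w <= 1 by rewrite ler0n lern1 leq_b1.
have iF n : intg (F n) by exact: i01.
have slope_inc n k (E : set T) : G n E ->
    intg (fun w => stop_slope (z n w) c k * stop_inc (z n w) c k) /\
    \int[P]_(w in E) (stop_slope (z n w) c k * stop_inc (z n w) c k) = 0.
  have [[mq ma mb msum] _] := stop_measurable n k.
  have mslope : measurable_for (G (n + k)) (fun w => stop_slope (z n w) c k).
    apply/mGP; apply: measurable_funM; first exact/mGP.
    apply: (@measurableT_comp _ _ _ _ _ _ (fun x : R => (Num.sqrt (1 + x ^+ 2))^-1));
      last exact/mGP.
    apply: continuous_measurable_fun => x.
    apply: cvgV; first by rewrite sqrtr_eq0 -ltNge ltr_wpDr ?sqr_ge0.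
    apply: continuous_cvg; first exact: sqrt_continuous.
    by apply: cvgD; [exact: cvg_cst|exact: exprn_continuous].
  have slope1 w : `|stop_slope (z n w) c k| <= 1.
    rewrite /stop_slope normrM normfV (ger0_norm (sqrtr_ge0 _)).
    have P0 : 0 < Num.sqrt (1 + stop_sum (z n w) c k ^+ 2).
      by rewrite sqrtr_gt0 ltr_wpDr ?sqr_ge0.
    by rewrite ler_pdivrMr// mul1r -sqrtr_sqr ler_wsqrtr// lerDr.
  have H (psi : T -> R) : measurable_for (G n) psi -> (forall w, `|psi w| <= 1) ->
      intg (fun w => (stop_slope (z n w) c k * psi w) * stop_inc (z n w) c k) /\
      \int[P]_w ((stop_slope (z n w) c k * psi w) * stop_inc (z n w) c k) = 0.
    move=> mpsi psi1; apply: (Rintegral_stop_inc (M := 1)).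
      apply/mGP; apply: measurable_funM; apply/mGP => //.
      by apply: mG_le mpsi; exact: leq_addr.
    by move=> w _; rewrite normrM -[1]mulr1 ler_pM.
  move=> GE; have mE := Gm GE.
  have iinc : intg (fun w => stop_slope (z n w) c k * stop_inc (z n w) c k).
    have [| |] := H (fun=> 1); [|by move=> w; rewrite normr1|].
      by apply/mGP; exact: measurable_cst.
    by under eq_fun do rewrite mulr1.
  split=> //; rewrite Rintegral_indicM//.
  have [| |_ <-] := H \1_E.
  - by apply/mGP; apply: measurable_indic; exact/measurable_sub_sigmaP.
  - by move=> w; rewrite indicE; case: (_ \in _); rewrite ?normr1 ?normr0.
  - by apply: eq_Rintegral => w _; rewrite mulrAC.
have sum_inc n j (E : set T) : G n E ->
    intg (fun w => \sum_(k < j) stop_slope (z n w) c k * stop_inc (z n w) c k) /\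
    \int[P]_(w in E)
      (\sum_(k < j) stop_slope (z n w) c k * stop_inc (z n w) c k) = 0.
  move=> GE; have mE := Gm GE; elim: j => [|j [IH1 IH2]].
    under eq_fun do rewrite big_ord0; split; first exact: integrable_cst.
    by rewrite Rintegral_cst// mul0r.
  have [i1 i2] := slope_inc n j E GE.
  under eq_fun do rewrite big_ord_recr/=; split; first exact: integrable_add.
  by rewrite RintegralD ?IH2 ?i2 ?addr0//; exact: integrable_sub.
have GT n : G n setT by exact: sub_sigmaT.
have iS n j : intg (fun w => A^-1 *
    \sum_(k < j) stop_slope (z n w) c k * stop_inc (z n w) c k).
  by apply: integrable_scale; have [] := sum_inc n j _ (GT n).
have if_ n j : intg (f n j) by exact: integrable_sub_fun.
have ig : intg g.
  by apply: integrable_add; [exact: integrable_cst|exact: integrable_scale].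
have irest : intg rest by apply: integrable_add => //; exact: integrable_cst.
have fF n j E : (0 <= n)%N -> G n E -> \int[P]_(w in E) f n j w =
    \int[P]_(w in E) F n w - \int[P]_(w in E) 0.
  move=> _ GE; have mE := Gm GE; have [i1 i2] := sum_inc n j E GE.
  rewrite /f RintegralB//; [|exact: integrable_sub..].
  by rewrite RintegralZl ?i2 ?mulr0 ?Rintegral_cst ?mul0r//; exact: integrable_sub.
have rest0 : {ae P, forall w, 0 <= rest w}.
  apply: aeW => w; have /andP[x0 _] := excess_bounds c (V w).
  by rewrite /rest addr_ge0.
have fB : {ae P, forall w n j, f n j w <= g w /\ f n j w <= B n j w + rest w}.
  apply: filterS2 sD sz => w sDw szw n j.
  have /andP[sn0 snD] := sDw n.
  have sX : s n w <= X w.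
    by apply: le_trans snD _; rewrite /X; have := ler_norm (D w); lra.
  split; last first.
    have := stop_tail_le c_ge0 (szw n) (V w) (W n w) j A1.
    by rewrite /f /B /rest /F mul1r.
  have := stop_sqrt c_ge0 (szw n) j; rewrite /f /g; set Y := \sum_(_ < _) _.
  set psi := Num.sqrt _ => hY.
  have psi0 : 0 <= psi by exact: sqrtr_ge0.
  have A1' : A^-1 <= 1 by rewrite invf_le1.
  have A0' : 0 <= A^-1 by rewrite invr_ge0 ltW.
  have : - (1 + c / 2 + 2 * X w) <= A^-1 * Y.
    have h1 : - (1 + c / 2 + 2 * X w) <= Y by lra.
    have h2 : 0 <= 1 + c / 2 + 2 * X w by rewrite addr_ge0 ?mulr_ge0// addr_ge0// divr_ge0.
    apply: (@le_trans _ _ (A^-1 * - (1 + c / 2 + 2 * X w))); last by rewrite ler_wpM2l.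
    by rewrite mulrN lerN2 ler_piMl.
  by have /andP[_] := F1 n w; lra.
have mB n j : measurable_fun [set: T] (B n j).
  apply: measurable_funD; last exact: measurable_funM.
  apply: measurable_funD.
    by apply: measurableT_comp => //; exact: measurable_funB.
  apply: measurable_funM => //.
  by apply: measurableT_comp => //; exact: measurable_funB.
have cB : {ae P, forall w, exists E : nat -> R,
    (forall n, B n j w @[j --> \oo] --> E n) /\ E @ \oo --> (0 : R)}.
  apply: (@limit_ingredients s (fun _ _ => 1) (fun x => 2 * x) s0).
    by move=> w _; exists 1; exact: cvg_cst.
  by rewrite -[X in _ --> X](mulr0 2); apply: cvgMr; exact: cvg_id.
have [] := @limit_step F f B g (fun=> 0) rest 0 iF
  (fun n j _ => if_ n j) ig (integrable_cst P 0) irest mB fF rest0 _ _ cB (eps / 2) eps20.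
- by apply: filterS fB => w h n j _; have [] := h n j.
- by apply: filterS fB => w h n j _; have [] := h n j.
move=> N' [h [_ ih h0 hle key]].
pose Phi w := a + Phi2 w.
pose h' w := h w + d2 w.
have ih' : intg h' by exact: integrable_add.
have iPhi : intg Phi by apply: integrable_add => //; exact: integrable_cst.
have iarest : intg (fun w => a + excess c (V w)).
  by apply: integrable_add => //; exact: integrable_cst.
have PhiE w : Phi w - (a + excess c (V w)) = Phi2 w - excess c (V w).
  by rewrite /Phi; ring.
exists (maxn N' N2), Phi, h'; split; split.
- apply/mGP; apply: measurable_funD; first exact: measurable_cst.
  by apply/mGP; apply: mG_le mPhi2; exact: leq_maxr.
- exact: iPhi.
- exact: ih'.
- by apply: filterS h0 => w h0; rewrite addr_ge0.
- have int2' : \int[P]_w d2 w <= eps / 2 by exact: int2.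
  by rewrite /h' RintegralD//; apply: le_trans (lerD hle int2') _; lra.
- by apply: integrable_normr; exact: integrable_sub_fun.
- apply: (@le_trans _ _ (\int[P]_w d2 w)).
    apply: le_Rintegral => //; last by move=> w _; rewrite -/a PhiE.
    by apply: integrable_normr; exact: integrable_sub_fun.
  by apply: le_trans int2 _; lra.
move=> n E Nn GE; have mE := Gm GE.
have N'n : (N' <= n)%N by apply: leq_trans Nn; exact: leq_maxl.
apply: le_trans (key n E N'n GE) _.
rewrite Rintegral_cst// mul0r add0r.
rewrite -!RintegralD//; try exact: integrable_sub.
apply: le_Rintegral => //.
- by apply: integrable_sub => //; exact: integrable_add.
- by apply: integrable_sub => //; exact: integrable_add.
move=> w _; rewrite /rest /Phi /h'.
have := le_d2 w; have := ler_norm (- (Phi2 w - excess c (V w))).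
by rewrite normrN; lra.
Qed.

(** Tightness where V < c - 1: the excess vanishes there, and (1 + c/2)/A is made small through
    A. *)
Lemma cond_excess_bound (gt : nat -> nat -> T -> R) :
  (forall A n, (0 < n)%N -> is_condexp P (G n)
     (fun w => (A.+1%:R < `|W n w|)%R%:R) (gt A n)) ->
  {ae P, forall w, V w < c - 1 -> forall eps, 0 < eps ->
    exists A : nat, \forall n \near \oo, gt A n w <= eps}.
Proof.
move=> hg.
have h A : {ae P, forall w eps, 0 < eps -> \forall n \near \oo,
    gt A n w <= (A.+1%:R^-1 * (1 + c / 2) + excess c (V w)) + eps}.
  have A1 : 1 <= A.+1%:R :> R by rewrite ler1n.
  apply: cond_limsup_le_ae (cond_limsup_le_tail A1) _ _ => //.
  - apply: measurable_funD => //.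
    apply: (@measurableT_comp _ _ _ _ _ _ (excess c)) => //.
    by apply: continuous_measurable_fun; exact: continuous_excess.
  - by move=> n n0; have [] := hg A n n0.
  - by move=> n E n0 GE; have [_ _ H] := hg A n n0; congr fine; exact: H.
have {}h := ae_foralln h; apply: filterS h => w h Vc eps eps0.
have c20 : 0 < 1 + c / 2 by have := c_ge0; lra.
have [N N0 hN] := inv_nat_lt (divr_gt0 (divr_gt0 eps0 (ltr0Sn _ 1)) c20).
(* The truncation level is [A.+1], hence the predecessor. *)
exists N.-1; have := h N.-1 (eps / 2) (divr_gt0 eps0 (ltr0Sn _ 1)).
rewrite prednK//; apply: filterS => n /le_trans; apply.
have -> : excess c (V w) = 0.
  by rewrite /excess /clip min_l ?max_l//; lra.
by move: hN; rewrite ltr_pdivlMr//; lra.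
Qed.

Lemma cond_cos_bound (gc : nat -> T -> R) th :
  (forall n, (0 < n)%N -> is_condexp P (G n) (fun w => cos (W n w - th)) (gc n)) ->
  {ae P, forall w, 0 <= V w -> V w < c - 1 -> forall eps, 0 < eps ->
    \forall n \near \oo, gc n w <= cos th * expR (- (V w / 2)) + eps}.
Proof.
move=> hg.
have := cond_limsup_le_ae fG _ (cond_limsup_le_cos th) _ _.
move=> /(_ gc)h; have {h} : {ae P, forall w eps, 0 < eps -> \forall n \near \oo,
    gc n w <= cos th * gauss_cut c (V w) + 2 * excess c (V w) + eps}.
  apply: h.
  - apply: measurable_funD; apply: measurable_funM => //.
      apply: (@measurableT_comp _ _ _ _ _ _ (gauss_cut c)) => //.
      by apply: continuous_measurable_fun; exact: continuous_gauss_cut.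
    apply: (@measurableT_comp _ _ _ _ _ _ (excess c)) => //.
    by apply: continuous_measurable_fun; exact: continuous_excess.
  - by move=> n n0; have [] := hg n n0.
  - by move=> n E n0 GE; have [_ _ H] := hg n n0; congr fine; exact: H.
apply: filterS => w h V0 Vc eps eps0; apply: filterS (h eps eps0) => n.
have -> : excess c (V w) = 0.
  by rewrite /excess /clip min_l ?max_l//; lra.
by rewrite mulr0 addr0 /gauss_cut clip_id//; lra.
Qed.

End stopped.

Hypothesis V_ge0 : {ae P, forall w, 0 <= V w}.

(** Replacing th by th + pi changes the sign of both cosines, so the upper bound yields the lower
    one. The levels c are natural numbers: countably many null sets, and some level exceeds V + 1 at
    each point. *)
Lemma cond_cos_cvg (gc : nat -> T -> R) th :
  (forall n, (0 < n)%N -> is_condexp P (G n) (fun w => cos (W n w - th)) (gc n)) ->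
  {ae P, forall w, gc n w @[n --> \oo] --> cos th * expR (- (V w / 2))}.
Proof.
move=> hg.
have hg' n : (0 < n)%N ->
    is_condexp P (G n) (fun w => cos (W n w - (th + pi))) (fun w => - gc n w).
  move=> n0; have [mg ig intg_] := hg n n0; split.
  - by apply/mGP; apply: measurableT_comp => //; exact/mGP.
  - by apply: integrableN ig.
  - move=> A GA; have mA := Gm GA.
    have mF : measurable_fun [set: T] (fun w => cos (W n w - th)).
      apply: (@measurableT_comp _ _ _ _ _ _ (@cos R)).
        by apply: continuous_measurable_fun; exact: continuous_cos.
      exact: measurable_funB.
    have iF : intg (fun w => cos (W n w - th)).
      by apply: (bounded_integrable P (M := 1)) => // w; exact: cos_max.
    have -> : (fun w => (cos (W n w - (th + pi)))%:E) =
        (fun w => (-1%:E * (cos (W n w - th))%:E)%E).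
      apply/funext => w; rewrite -EFinM mulN1r; congr EFin.
      have -> : W n w - (th + pi) = - (th - W n w + pi) by ring.
      by rewrite cosN cosDpi -cosN opprB.
    under eq_integral do rewrite EFinN -mulN1e.
    rewrite !integralZl//; [|exact: integrable_sub..].
    by rewrite intg_.
have h1 := ae_foralln (fun k => cond_cos_bound (ler0n R k) hg).
have h2 := ae_foralln (fun k => cond_cos_bound (ler0n R k) hg').
apply: filterS2 (filterI h1 h2) V_ge0 => w [{}h1 {}h2] V0.
have [k kV] : exists k : nat, V w < k%:R - 1.
  by exists (Num.truncn (V w + 1)).+1; rewrite ltrBrDr truncnS_gt.
apply/cvgrPdist_le => eps eps0.
apply: filterS2 (h1 k V0 kV eps eps0) (h2 k V0 kV eps eps0) => n.
by rewrite cosDpi ler_norml; lra.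
Qed.

Lemma cond_tail_cvg (gt : nat -> nat -> T -> R) :
  (forall A n, (0 < n)%N -> is_condexp P (G n)
     (fun w => (A.+1%:R < `|W n w|)%R%:R) (gt A n)) ->
  {ae P, forall w eps, 0 < eps ->
    exists A : nat, \forall n \near \oo, gt A n w <= eps}.
Proof.
move=> hg; have h := ae_foralln (fun k => cond_excess_bound (ler0n R k) hg).
apply: filterS h => w h; apply: (h (Num.truncn (V w + 1)).+1).
by rewrite ltrBrDr truncnS_gt.
Qed.

End stable_limit.

(** * Levy's continuity theorem *)

Section borel_vectors.
Context {R : realType} {m : nat}.

Lemma continuous_borelV (f : 'cV[R]_m -> R) : continuous f ->
  measurable_fun [set: borelV R m] (f : borelV R m -> R).
Proof.
move=> cf; apply: (measurability _ (RGenOpens.measurableE R)).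
move=> _ [_ [a [b ->]] <-]; rewrite setTI; apply: sub_sigma_algebra.
by move/continuousP : cf; apply; exact: interval_open.
Qed.

Lemma continuous_coord (i : 'I_m) : continuous (fun u : 'cV[R]_m => u i 0).
Proof. exact: coord_continuous. Qed.

Lemma measurable_coord (i : 'I_m) :
  measurable_fun [set: borelV R m] (fun u : borelV R m => (u : 'cV[R]_m) i 0).
Proof. by apply: continuous_borelV; exact: continuous_coord. Qed.

Lemma nbhs_cV (u : 'cV[R]_m) (A : set 'cV[R]_m) :
  nbhs u A <-> exists2 e : R, 0 < e &
    forall v : 'cV[R]_m, (forall i, `|u i 0 - v i 0| < e) -> A v.
Proof.
split=> [/nbhs_ballP[e /= e0 uA]|[e e0 uA]].
  exists e => // v uv; apply: uA; split=> // i j; rewrite (ord1 j).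
  exact: uv.
apply/nbhs_ballP; exists e => // v [_ uv]; apply: uA => i; exact: uv.
Qed.

(** An open set is the union of the boxes it contains with rational centre and radius 1/(n+1). They
    are countably many, and the preimage of a box is a finite intersection of coordinate
    conditions. *)
Lemma measurable_borelV d (T : measurableType d) (U : T -> 'cV[R]_m) :
  (forall i, measurable_fun [set: T] (fun w => U w i 0)) ->
  measurable_fun [set: T] (U : T -> borelV R m).
Proof.
move=> mU; apply: (@measurability _ _ T (borelV R m) setT U (@open 'cV[R]_m) (erefl _)) => _ [D oD <-].
rewrite setTI.
pose box (p : 'cV[rat]_m * nat) : set 'cV[R]_m :=
  [set v | forall i, `|ratr (p.1 i 0) - v i 0| < p.2.+1%:R^-1].
have -> : D = \bigcup_(p in [set p | box p `<=` D]) box p.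
  apply/seteqP; split=> [u Du|u [p pD]]; last exact: pD.
  have /nbhs_cV[e e0 uD] : nbhs u D by exact: open_nbhs_nbhs.
  have [N N0 Ne] := inv_nat_lt (divr_gt0 e0 (ltr0Sn R 1)).
  have /choice[q hq] : forall i, exists q : rat, `|ratr q - u i 0| < N%:R^-1.
    move=> i; have : u i 0 - N%:R^-1 < u i 0 + N%:R^-1.
      by rewrite ltrBlDr -addrA ltrDl addr_gt0// invr_gt0 ltr0n.
    move=> /rat_in_itvoo[q]; rewrite in_itv/= => /andP[h1 h2].
    by exists q; move: h1 h2; rewrite ltr_norml; set a := N%:R^-1; lra.
  exists (\col_i q i, N.-1) => /=; last first.
    by move=> i; rewrite mxE prednK.
  move=> v hv; apply: uD => i; have := hv i; have := hq i.
  rewrite /= mxE prednK// => h1 h2.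
  have := ler_distD (ratr (q i)) (u i 0) (v i 0); rewrite (distrC (u i 0) (ratr _)).
  by move: h1 h2 Ne; set a := N%:R^-1; lra.
rewrite preimage_bigcup.
have -> : \bigcup_(p in [set p | box p `<=` D]) U @^-1` box p =
    \bigcup_p (if `[< box p `<=` D >] then U @^-1` box p else set0).
  apply/seteqP; split=> [w [p pO wp]|w [p _]].
    by exists p => //=; rewrite asboolT.
  by case: ifP => [/asboolP pD wp|//]; exists p.
apply: countable_bigcupT_measurable => [|p]; first exact: countableP.
case: ifP => [_|_]; last exact: measurable0.
rewrite (_ : U @^-1` box p =
  \bigcap_(i in [set: 'I_m]) [set w | `|ratr (p.1 i 0) - U w i 0| < p.2.+1%:R^-1]).
  apply: fin_bigcap_measurable => // i _.
  rewrite (_ : [set w | _] =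
      (fun w => `|ratr (p.1 i 0) - U w i 0|) @^-1` [set` `]-oo, p.2.+1%:R^-1[]).
    rewrite -[_ @^-1` _]setTI; apply: measurableT_comp => //.
    exact: measurable_funB.
  by apply/seteqP; split=> w /=; rewrite in_itv.
by apply/seteqP; split=> [w h i _|w h i]; [exact: h|exact: h].
Qed.

(* Uniform continuity on a box, up to points slightly outside of it. *)
Lemma uniform_on_box (f : 'cV[R]_m -> R) (A eps : R) : continuous f -> 0 < eps ->
  exists2 del, 0 < del & forall u v : 'cV[R]_m, (forall i, `|u i 0| <= A) ->
    (forall i, `|u i 0 - v i 0| < del) -> `|f u - f v| <= eps.
Proof.
move=> cf eps0.
pose K := [set r : 'rV[R]_m | forall i, `[- A, A]%classic (r 0 i)].
have cK : compact K.
  by apply: (@rV_compact R m (fun=> `[- A, A]%classic)) => i; exact: segment_compact.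
pose Q (n : nat) (r : 'rV[R]_m) := forall v : 'cV[R]_m,
  (forall i, `|r 0 i - v i 0| < n.+1%:R^-1) -> `|f r^T - f v| <= eps.
have : \forall n \near \oo, K `<=` Q n.
  move/compact_near_coveringP : cK; apply.
  move=> r _.
  have := cf r^T => /cvgrPdist_lt/(_ _ (divr_gt0 eps0 (ltr0Sn R 1))).
  move=> /nbhs_cV[e e0 he].
  have e20 : 0 < e / 2 by rewrite divr_gt0.
  have [N N0 Ne] := inv_nat_lt e20.
  exists ([set r' : 'rV[R]_m | forall i, `|r 0 i - r' 0 i| < e / 2],
          [set n : nat | (N <= n)%N]).
    split; last by exists N.
    apply/nbhs_ballP; exists (e / 2) => // r' [_ rr'] i /=; exact: rr'.
  move=> [r' n] /= [rr' Nn] v hv.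
  have h1 : `|f r^T - f r'^T| < eps / 2.
    by apply: he => i; rewrite !mxE; apply: lt_trans (rr' i) _; lra.
  have h2 : `|f r^T - f v| < eps / 2.
    apply: he => i; rewrite !mxE.
    have nN : n.+1%:R^-1 <= N%:R^-1 :> R.
      by rewrite lef_pV2 ?posrE ?ltr0n// ler_nat leqW.
    have := ler_distD (r' 0 i) (r 0 i) (v i 0); have := rr' i; have := hv i.
    by move: nN Ne; set a := N%:R^-1; set b := n.+1%:R^-1; lra.
  have := ler_distD (f r^T) (f r'^T) (f v); rewrite (distrC (f r'^T) (f r^T)).
  by lra.
case=> N _ /(_ N (leqnn N)) hN; exists N.+1%:R^-1 => // u v uA uv.
have -> : u = (u^T)^T by rewrite trmxK.
apply: hN => [i|i]; rewrite mxE; last exact: uv.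
by rewrite /= in_itv/= -ler_norml.
Qed.

End borel_vectors.

(** * Bernstein polynomials in several variables *)

Section bernstein.
Context {R : realType}.
Implicit Types (y c : R) (h : nat -> R).

(* The expectation of h(S) for S binomial with parameters N and y. *)
Fixpoint bern (N : nat) y h : R :=
  if N is N'.+1 then (1 - y) * bern N' y h + y * bern N' y (h \o succn)
  else h 0%N.

Lemma bern_cst N y c : bern N y (fun=> c) = c.
Proof. by elim: N => //= N IH; rewrite /comp IH; ring. Qed.

(** The shift c is the induction parameter, since a success turns k into k + 1. At c = -N y this is
    the binomial variance. *)
Lemma bern_var N y c :
  bern N y (fun k => (k%:R + c) ^+ 2) = N%:R * y * (1 - y) + (N%:R * y + c) ^+ 2.
Proof.
elim: N c => [|N IH] c; first by rewrite /=; ring.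
rewrite /= IH (_ : _ \o _ = fun k => (k%:R + (1 + c)) ^+ 2); last first.
  by apply/funext => k /=; rewrite -natr1 addrA.
by rewrite IH -natr1; ring.
Qed.

Lemma bern_le N y h h' : 0 <= y <= 1 -> (forall k, h k <= h' k) ->
  bern N y h <= bern N y h'.
Proof.
move=> /andP[y0 y1]; elim: N h h' => [|N IH] h h' hh /=; first exact: hh.
by apply: lerD; apply: ler_wpM2l; rewrite ?subr_ge0//; apply: IH => k //=; exact: hh.
Qed.

Lemma eq_bern N y h h' : h =1 h' -> bern N y h = bern N y h'.
Proof. by move=> /funext ->. Qed.

Lemma bern_lin N y (a b : R) h h' :
  bern N y (fun k => a * h k + b * h' k) = a * bern N y h + b * bern N y h'.
Proof.
elim: N h h' => [//|N IH] h h' /=.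
by rewrite IH (IH (h \o succn) (h' \o succn)); ring.
Qed.

Section multi.
Variable m : nat.
Implicit Types (s : seq 'I_m) (p : 'I_m -> nat) (H : ('I_m -> nat) -> R).

Definition upd p (i : 'I_m) (k : nat) : 'I_m -> nat :=
  fun j => if j == i then k else p j.

(** The expectation of H at independent binomial variables, one for each coordinate listed in s; p
    supplies the values of the other coordinates. *)
Fixpoint mbern (N : nat) (y : 'I_m -> R) s H p : R :=
  if s is i :: s' then bern N (y i) (fun k => mbern N y s' H (upd p i k))
  else H p.

Lemma mbern_cst N (y : 'I_m -> R) s c p : mbern N y s (fun=> c) p = c.
Proof.
elim: s p => //= i s IH p.
by rewrite (@eq_bern _ _ _ (fun=> c)) ?bern_cst.
Qed.

Lemma mbern_le N (y : 'I_m -> R) s H H' p : (forall i, 0 <= y i <= 1) ->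
  (forall q, H q <= H' q) -> mbern N y s H p <= mbern N y s H' p.
Proof.
move=> y01 HH; elim: s p => [|i s IH] p /=; first exact: HH.
by apply: bern_le.
Qed.

Lemma mbern_lin N (y : 'I_m -> R) s (a b : R) H H' p :
  mbern N y s (fun q => a * H q + b * H' q) p =
  a * mbern N y s H p + b * mbern N y s H' p.
Proof.
elim: s p => [//|i s IH] p /=; rewrite -bern_lin.
by apply: eq_bern => k; rewrite IH.
Qed.

Lemma mbern_sum N (y : 'I_m -> R) s I (r : seq I) (H : I -> ('I_m -> nat) -> R) p :
  mbern N y s (fun q => \sum_(i <- r) H i q) p = \sum_(i <- r) mbern N y s (H i) p.
Proof.
elim: r => [|i r IH].
  rewrite big_nil -[RHS](mbern_cst N y s 0 p); congr (mbern _ _ _ _ _).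
  by apply/funext => q; rewrite big_nil.
rewrite big_cons -IH -[X in X + _]mul1r -[X in _ + X]mul1r -mbern_lin.
by congr (mbern _ _ _ _ _); apply/funext => q; rewrite big_cons !mul1r.
Qed.

Lemma mbern_var N (y : 'I_m -> R) s i p : uniq s ->
  mbern N y s (fun q => ((q i)%:R - N%:R * y i) ^+ 2) p =
  if i \in s then N%:R * y i * (1 - y i) else ((p i)%:R - N%:R * y i) ^+ 2.
Proof.
elim: s p => [//|j s IH] p /= /andP[js us]; rewrite in_cons.
rewrite (eq_bern _ _ (fun k => IH (upd p j k) us)).
have [ij|ij] /= := eqVneq i j.
  subst j; rewrite (negbTE js) /upd eqxx.
  by rewrite bern_var subrr expr0n/= addr0.
by rewrite /upd (negbTE ij) bern_cst.
Qed.

End multi.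
End bernstein.

(** * Sines as coordinates on a box *)

Section sine_coordinates.
Context {R : realType}.
Implicit Types (x y s A : R).

(** The derivative of the sine is at least cos 1 on [-1, 1]; hence a Lipschitz inverse. *)
Lemma sin_expand x y : -1 <= x <= 1 -> -1 <= y <= 1 ->
  cos 1 * `|x - y| <= `|sin x - sin y|.
Proof.
wlog xy : x y / x <= y.
  by have [xy|/ltW yx] := leP x y => h ? ?; [|rewrite distrC (distrC (sin x))]; exact: h.
move: xy; rewrite le_eqVlt => /predU1P[->|xy]; first by rewrite !subrr normr0 mulr0.
move=> /andP[x1 _] /andP[_ y1].
have cs : {within `[x, y], continuous (@sin R)}.
  by apply: continuous_subspaceT; exact: continuous_sin.
have [u] := MVT xy (fun u _ => is_derive_sin u) cs.
rewrite in_itv/= => /andP[xu uy] E.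
rewrite (distrC (sin x)) E normrM (distrC x) ler_wpM2r// (le_trans _ (ler_norm _))//.
rewrite -(cos_norm u).
have u1 : `|u| <= 1 by rewrite ler_norml; lra.
move: u1; rewrite le_eqVlt => /predU1P[->//|u1]; apply/ltW.
rewrite ltr_cos ?in_itv/= ?normr_ge0//=.
  by apply: le_trans (ltW u1) _; have := pi_ge2 R; lra.
by rewrite ler01/=; have := pi_ge2 R; lra.
Qed.

Lemma asin_bounded s : `|s| <= sin 1 -> `|asin s| <= 1.
Proof.
have p2 := pihalf_ge1 R.
have i1 : (1 : R) \in `[- (pi / 2), pi / 2] by rewrite in_itv/=; lra.
have i1' : (-1 : R) \in `[- (pi / 2), pi / 2] by rewrite in_itv/=; lra.
have s1 : sin 1 <= 1 :> R by exact: sin_le1.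
rewrite ler_norml => /andP[h1 h2]; have h : -1 <= s <= 1 by lra.
have ia : asin s \in `[- (pi / 2), pi / 2].
  by rewrite in_itv/= asin_geNpi2 ?asin_lepi2.
have asK : sin (asin s) = s by rewrite asinK// in_itv.
rewrite ler_norml; apply/andP; split; rewrite leNgt; apply/negP => hh.
  have : sin (asin s) < sin (-1) by rewrite ltr_sin.
  by rewrite asK sinN; lra.
have : sin 1 < sin (asin s) by rewrite ltr_sin.
by rewrite asK; lra.
Qed.

(** The frequency 1/(2A) sends [-A, A] into [-1/2, 1/2], inside a region where the sine has a
    Lipschitz inverse. Polynomials in these coordinates are trigonometric, hence bounded on the
    whole space. *)
Definition sin01 A x := (1 + sin (x / (2 * A))) / 2.

Lemma sin01_bounds A x : 0 <= sin01 A x <= 1.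
Proof.
by rewrite /sin01; have := sin_le1 (x / (2 * A)); have := sin_geN1 (x / (2 * A)); lra.
Qed.

Definition sin01_inv A y := 2 * A * asin (2 * y - 1).

Lemma sin01_invP A del : 0 < A -> 0 < del -> exists2 eta, 0 < eta &
  forall x y, `|x| <= A -> `|y - sin01 A x| < eta -> `|x - sin01_inv A y| < del.
Proof.
move=> A0 del0; have k0 := cos1_gt0 R.
have ss : sin (1 / 2) < sin 1 :> R.
  by rewrite ltr_sin ?in_itv/=; have := pihalf_ge1 R; lra.
(* The constant a keeps |2y - 1| <= sin 1, where the inverse is Lipschitz; b solves 2A * 2b = del *
   cos 1. *)
pose a : R := (sin 1 - sin (1 / 2)) / 2; pose b := del * cos 1 / (4 * A).
have a0 : 0 < a by rewrite /a; lra.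
have b0 : 0 < b by rewrite divr_gt0 ?mulr_gt0.
exists (Num.min a b); first by rewrite lt_min a0.
move=> x y xA; rewrite lt_min => /andP[ya yb].
set t := x / (2 * A).
have t12 : `|t| <= 1 / 2.
  rewrite /t normrM normfV (gtr0_norm (_ : 0 < 2 * A)) ?mulr_gt0//.
  by rewrite ler_pdivrMr ?mulr_gt0//; lra.
have tI : t \in `[- (pi / 2), pi / 2].
  by move: t12; rewrite in_itv/= ler_norml; have := pihalf_ge1 R; lra.
have st : `|sin t| <= sin (1 / 2).
  have i2 : 1 / 2 \in `[- (pi / 2), pi / 2 : R].
    by rewrite in_itv/=; have := pihalf_ge1 R; lra.
  have i2' : - (1 / 2) \in `[- (pi / 2), pi / 2 : R].
    by rewrite in_itv/=; have := pihalf_ge1 R; lra.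
  rewrite ler_norml -sinN; move: t12; rewrite ler_norml => /andP[t1 t2].
  apply/andP; split; rewrite leNgt; apply/negP; rewrite ltr_sin//; lra.
have h : `|(2 * y - 1) - sin t| < 2 * Num.min a b.
  have -> : (2 * y - 1) - sin t = 2 * (y - sin01 A x).
    by rewrite /sin01 -/t; field.
  by rewrite normrM ger0_norm// ltr_pM2l// lt_min ya.
have ha : `|(2 * y - 1) - sin t| < 2 * a.
  by apply: lt_le_trans h _; rewrite ler_pM2l// ge_min lexx.
have hb : `|(2 * y - 1) - sin t| < 2 * b.
  by apply: lt_le_trans h _; rewrite ler_pM2l// ge_min lexx orbT.
have s1 : `|2 * y - 1| <= sin 1.
  have := ler_distD (sin t) (2 * y - 1) 0; rewrite !subr0 => /le_trans; apply.
  by move: ha st; rewrite /a; lra.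
have as1 := asin_bounded s1.
have sE : sin (asin (2 * y - 1)) = 2 * y - 1.
  rewrite asinK// in_itv/=; move: s1; rewrite ler_norml; have := sin_le1 (1 : R); lra.
have : cos 1 * `|asin (2 * y - 1) - t| <= `|(2 * y - 1) - sin t|.
  rewrite -{2}sE; apply: sin_expand; first by rewrite -ler_norml.
  by move: t12; rewrite ler_norml; lra.
move=> /le_lt_trans/(_ hb) hh.
have -> : x - sin01_inv A y = - (2 * A * (asin (2 * y - 1) - t)).
  by rewrite /sin01_inv /t; field; rewrite gt_eqF.
rewrite normrN normrM gtr0_norm ?mulr_gt0// -(ltr_pM2l k0) mulrCA.
apply: (@lt_le_trans _ _ (2 * A * (2 * b))); first by rewrite ltr_pM2l ?mulr_gt0.
by rewrite /b le_eqVlt; apply/orP; left; apply/eqP; field; rewrite gt_eqF.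
Qed.

End sine_coordinates.

Section grid.
Context {R : realType} {m : nat}.

(** Bernstein's argument: h p is f at the point with sine coordinates p/N, and the lattice points
    off by eta or more are charged to the variance. The bound M on h holds everywhere, so the
    approximant is controlled outside the box as well. *)
Lemma bernstein_approx (f : 'cV[R]_m -> R) (M A eps : R) : continuous f ->
  (forall x, `|f x| <= M) -> 0 < A -> 0 < eps ->
  exists N (h : ('I_m -> nat) -> R), (forall p, `|h p| <= M) /\
    forall x : 'cV[R]_m, (forall i, `|x i 0| <= A) ->
      `|f x - mbern N (fun i => sin01 A (x i 0)) (enum 'I_m) h (fun=> 0%N)| <= eps.
Proof.
move=> cf fM A0 eps0.
have eps20 : 0 < eps / 2 by rewrite divr_gt0.
have M0 : 0 <= M by exact: le_trans (fM 0).
have [del del0 hdel] := uniform_on_box A cf eps20.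
have [eta eta0 heta] := sin01_invP A0 del0.
(* Chebyshev's constant: off by eta in one coordinate means v >= (N eta)^2, so K v / N^2 >= 2M. The
   mean of v is at most N m, which leaves K m / N for N to make small. *)
pose K := 2 * M / eta ^+ 2.
have K0 : 0 <= K by apply: divr_ge0; [exact: mulr_ge0|exact: sqr_ge0].
have Km : 0 < K * m%:R + 1.
  by apply: ltr_wpDl => //; apply: mulr_ge0 => //; exact: ler0n.
have [N N0 HN] : exists2 N, (0 < N)%N & N%:R^-1 < eps / 2 / (K * m%:R + 1).
  by apply: inv_nat_lt; rewrite divr_gt0.
have N0' : 0 < N%:R :> R by rewrite ltr0n.
pose h (p : 'I_m -> nat) := f (\col_i sin01_inv A ((p i)%:R / N%:R)).
exists N, h; split=> [p|x xA]; first exact: fM.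
pose y i := sin01 A (x i 0); rewrite -/y.
have y01 i : 0 <= y i <= 1 by exact: sin01_bounds.
pose v (p : 'I_m -> nat) := \sum_i ((p i)%:R - N%:R * y i) ^+ 2.
have v0 p : 0 <= v p by apply: sumr_ge0 => i _; rewrite sqr_ge0.
have KN0 : 0 <= K / N%:R ^+ 2 by apply: divr_ge0 => //; exact: sqr_ge0.
have hv p : `|f x - h p| <= eps / 2 + K / N%:R ^+ 2 * v p.
  have [near_|/existsNP[i /negP]] :=
    pselect (forall i, `|(p i)%:R / N%:R - y i| < eta).
    apply: (@le_trans _ _ (eps / 2)); last by rewrite lerDl mulr_ge0.
    by apply: hdel => // i; rewrite mxE; apply: heta.
  rewrite -leNgt => far.
  have le2M : `|f x - h p| <= 2 * M.
    by apply: le_trans (ler_normB _ _) _; have := fM x; have := fM (\col_i sin01_inv A ((p i)%:R / N%:R)); rewrite /h; lra.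
  apply: le_trans le2M _; rewrite ler_wpDl ?(ltW eps20)//.
  have vi : (N%:R * eta) ^+ 2 <= v p.
    rewrite /v (bigD1 i)//= ler_wpDr ?sumr_ge0// => [j _|]; first by rewrite sqr_ge0.
    rewrite -[leRHS]real_normK ?num_real// lerXn2r ?nnegrE//.
      by apply: mulr_ge0; exact: ltW.
    have -> : (p i)%:R - N%:R * y i = N%:R * ((p i)%:R / N%:R - y i).
      by field; rewrite gt_eqF.
    by rewrite normrM gtr0_norm// ler_pM2l.
  apply: le_trans (ler_wpM2l KN0 vi).
  rewrite le_eqVlt; apply/orP; left; apply/eqP; rewrite /K; field.
  by rewrite !gt_eqF.
have mv : mbern N y (enum 'I_m) v (fun=> 0%N) <= N%:R * m%:R.
  rewrite /v mbern_sum; apply: (@le_trans _ _ (\sum_(i < m) N%:R)).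
    apply: ler_sum => i _; rewrite mbern_var ?enum_uniq// mem_enum /=.
    have /andP[yi0 yi1] := y01 i.
    by rewrite -mulrA ler_piMr// mulr_ile1 ?subr_ge0// lerBlDr lerDl.
  by rewrite sumr_const card_ord mulr_natr.
have KN : K / N%:R ^+ 2 * mbern N y (enum 'I_m) v (fun=> 0%N) <= eps / 2.
  apply: le_trans (ler_wpM2l KN0 mv) _.
  have -> : K / N%:R ^+ 2 * (N%:R * m%:R) = (K * m%:R) * N%:R^-1.
    by field; rewrite gt_eqF.
  move: HN; rewrite ltr_pdivlMr//; have : 0 < N%:R^-1 :> R by rewrite invr_gt0.
  by set a := N%:R^-1; nra.
pose bd q := 1 * (f x + eps / 2) + K / N%:R ^+ 2 * v q.
pose bd' q := 1 * (f x - eps / 2) + (- (K / N%:R ^+ 2)) * v q.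
have ub : mbern N y (enum 'I_m) h (fun=> 0%N) <= mbern N y (enum 'I_m) bd (fun=> 0%N).
  apply: mbern_le => // q; have := hv q; rewrite /bd ler_norml => /andP[].
  by set a := K / _ * _; lra.
have lb : mbern N y (enum 'I_m) bd' (fun=> 0%N) <= mbern N y (enum 'I_m) h (fun=> 0%N).
  apply: mbern_le => // q; have := hv q; rewrite /bd' ler_norml mulNr => /andP[].
  by set a := K / _ * _; lra.
move: ub lb; rewrite !mbern_lin !mbern_cst mulNr => ub lb.
rewrite ler_norml; move: KN ub lb; set a := K / _ * _; lra.
Qed.

End grid.

(** * Trigonometric polynomials as test functions *)

Section trigonometric_convergence.
Context {R : realType} {m : nat}.

Definition qdot (u : 'cV[rat]_m) (x : 'cV[R]_m) : R :=
  \sum_i ratr (u i 0) * x i 0.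

Lemma qdotD u v x : qdot (u + v) x = qdot u x + qdot v x.
Proof.
by rewrite /qdot -big_split/=; apply: eq_bigr => i _; rewrite mxE rmorphD mulrDl.
Qed.

Lemma qdotB u v x : qdot (u - v) x = qdot u x - qdot v x.
Proof.
rewrite /qdot -sumrB; apply: eq_bigr => i _.
by rewrite !mxE rmorphB mulrBl.
Qed.

Lemma qdot0 x : qdot 0 x = 0.
Proof. by rewrite /qdot big1// => i _; rewrite mxE rmorph0 mul0r. Qed.

Lemma qdot_coord (i : 'I_m) (q : rat) x :
  qdot (\col_j (if j == i then q else 0)) x = ratr q * x i 0.
Proof.
rewrite /qdot (bigD1 i)//= mxE eqxx big1 ?addr0// => j ji.
by rewrite mxE (negbTE ji) rmorph0 mul0r.
Qed.

Lemma continuous_qdot u : continuous (qdot u).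
Proof.
apply: (@continuous_big R 'I_m +%R 0 xpredT) => [|i _]; first exact: add_continuous.
by move=> x; exact: cvgMr (@continuous_coord R m i x).
Qed.

Lemma continuous_cos_qdot u th : continuous (fun x => cos (qdot u x - th)).
Proof.
move=> x; apply: (@cvg_comp _ _ _ (fun x => qdot u x - th) (@cos R) _ _ _ _
  (@continuous_cos R _)).
exact: cvgB (@continuous_qdot u x) (cvg_cst _).
Qed.

Variables (mu : nat -> probability (borelV R m) R) (nu : probability (borelV R m) R).

(* Closed under products, unlike the class of f with mu_n f --> nu f. *)
Definition trig_cvg (f : 'cV[R]_m -> R) : Prop :=
  [/\ continuous f, exists M, forall x, `|f x| <= M &
    forall u th, \int[mu n]_x (f x * cos (qdot u x - th)) @[n --> \oo] -->
      \int[nu]_x (f x * cos (qdot u x - th))].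

Lemma integrable_continuous (P : probability (borelV R m) R) (f : 'cV[R]_m -> R) M :
  continuous f -> (forall x, `|f x| <= M) ->
  P.-integrable [set: borelV R m] (EFin \o f).
Proof.
move=> cf fM.
exact: (@bounded_integrable _ (borelV R m) R P f M (continuous_borelV cf) fM).
Qed.

Lemma integrable_trig (P : probability (borelV R m) R) (f : 'cV[R]_m -> R) M u th :
  continuous f -> (forall x, `|f x| <= M) ->
  P.-integrable [set: borelV R m] (EFin \o (fun x => f x * cos (qdot u x - th))).
Proof.
move=> cf fM; apply: (integrable_continuous P (M := M)).
  by move=> x; exact: cvgM (cf x) (@continuous_cos_qdot _ _ x).
by move=> x; rewrite normrM (le_trans _ (fM x))// ler_piMr// cos_max.
Qed.

Lemma trig_cvg_lin a b f g : trig_cvg f -> trig_cvg g ->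
  trig_cvg (fun x => a * f x + b * g x).
Proof.
move=> [cf [M fM] hf] [cg [M' gM'] hg]; split.
- by move=> x; exact: cvgD (cvgMr (cf x)) (cvgMr (cg x)).
- exists (`|a| * M + `|b| * M') => x.
  by apply: le_trans (ler_normD _ _) _; rewrite !normrM lerD// ler_wpM2l.
move=> u th.
have E (P : probability (borelV R m) R) :
    \int[P]_x ((a * f x + b * g x) * cos (qdot u x - th)) =
    a * \int[P]_x (f x * cos (qdot u x - th)) +
    b * \int[P]_x (g x * cos (qdot u x - th)).
  have i1 := integrable_trig P u th cf fM; have i2 := integrable_trig P u th cg gM'.
  rewrite -!RintegralZl// -RintegralD//; [|exact: integrable_scale..].
  by apply: eq_Rintegral => x _; ring.
rewrite E; under eq_fun do rewrite E.
by apply: cvgD; apply: cvgMr; [exact: hf|exact: hg].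
Qed.

(** A product of two cosines is half the sum of the cosines at the sum and difference frequencies,
    which are again rational. *)
Lemma trig_cvg_cosM f v phi : trig_cvg f ->
  trig_cvg (fun x => f x * cos (qdot v x - phi)).
Proof.
move=> [cf [M fM] hf]; split.
- by move=> x; exact: cvgM (cf x) (@continuous_cos_qdot _ _ x).
- by exists M => x; rewrite normrM (le_trans _ (fM x))// ler_piMr// cos_max.
move=> u th.
have E (P : probability (borelV R m) R) :
    \int[P]_x (f x * cos (qdot v x - phi) * cos (qdot u x - th)) =
    2^-1 * \int[P]_x (f x * cos (qdot (v + u) x - (phi + th))) +
    2^-1 * \int[P]_x (f x * cos (qdot (v - u) x - (phi - th))).
  rewrite -!RintegralZl//; [|exact: integrable_trig cf fM..].
  rewrite -RintegralD//; [|apply: integrable_scale; exact: integrable_trig cf fM..].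
  apply: eq_Rintegral => x _; rewrite qdotD qdotB.
  rewrite (_ : _ + _ - (phi + th) = (qdot v x - phi) + (qdot u x - th)); last by ring.
  rewrite (_ : _ - _ - (phi - th) = (qdot v x - phi) - (qdot u x - th)); last by ring.
  set a := qdot v x - phi; set b := qdot u x - th.
  by rewrite (cosD a b) (cosB a b); field.
rewrite E; under eq_fun do rewrite E.
by apply: cvgD; apply: cvgMr; exact: hf.
Qed.

(** The sine is a cosine with phase pi/2, and its frequency 1/(2A) is rational because A is a
    natural number. *)
Lemma trig_cvg_sin01 (A : nat) i f : (0 < A)%N -> trig_cvg f ->
  trig_cvg (fun x => sin01 A%:R (x i 0) * f x).
Proof.
move=> A0 hf.
have h := trig_cvg_cosM (\col_j (if j == i then (2 * A%:R)^-1 else 0)) (pi / 2) hf.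
have := trig_cvg_lin 2^-1 2^-1 hf h; congr trig_cvg.
apply/funext => x; rewrite qdot_coord cosBpihalf /sin01 fmorphV rmorphM /=.
by rewrite !ratr_nat (mulrC _ (x i 0)); field.
Qed.

Hypothesis char_cvg : forall u th, \int[mu n]_x cos (qdot u x - th) @[n --> \oo] -->
  \int[nu]_x cos (qdot u x - th).

Lemma trig_cvg_cst c : trig_cvg (fun=> c).
Proof.
split=> [||u th]; [exact: cst_continuous|by exists `|c|; move=> x|].
have E (P : probability (borelV R m) R) : \int[P]_x (c * cos (qdot u x - th)) =
    c * \int[P]_x cos (qdot u x - th).
  rewrite RintegralZl//; apply: (integrable_continuous P (M := 1)).
    exact: continuous_cos_qdot.
  by move=> x; exact: cos_max.
by rewrite E; under eq_fun do rewrite E; apply: cvgMr.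
Qed.

Lemma trig_cvg_bern (A : nat) i N (g : nat -> 'cV[R]_m -> R) : (0 < A)%N ->
  (forall k, trig_cvg (g k)) ->
  trig_cvg (fun x => bern N (sin01 A%:R (x i 0)) (g ^~ x)).
Proof.
move=> A0; elim: N g => [|N IH] g hg /=; first exact: hg.
have h0 := IH g hg; have h1 := IH (g \o succn) (fun k => hg k.+1).
(* The recursion (1 - y) b0 + y b1 is read as b0 - y b0 + y b1, each term being in the class. *)
have := trig_cvg_lin 1 1 (trig_cvg_lin 1 (-1) h0 (trig_cvg_sin01 i A0 h0))
  (trig_cvg_sin01 i A0 h1).
by congr trig_cvg; apply/funext => x /=; rewrite /comp; ring.
Qed.

Lemma trig_cvg_mbern (A : nat) N s h p : (0 < A)%N ->
  trig_cvg (fun x => mbern N (fun i => sin01 A%:R (x i 0)) s h p).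
Proof.
move=> A0; elim: s p => [|i s IH] p /=; first exact: trig_cvg_cst.
exact: (trig_cvg_bern i N A0 (fun k => IH (upd p i k))).
Qed.

End trigonometric_convergence.

Section weak_convergence.
Context {R : realType} {m : nat}.

Definition outside (A : nat) (i : 'I_m) : set (borelV R m) :=
  [set x | A%:R < `|(x : 'cV[R]_m) i 0|].

Lemma measurable_outside A i : measurable (outside A i).
Proof.
rewrite (_ : outside A i = (fun x : borelV R m => `|(x : 'cV[R]_m) i 0|) @^-1`
    [set` `]A%:R, +oo[]).
  have h : measurable_fun [set: borelV R m]
      (fun x : borelV R m => `|(x : 'cV[R]_m) i 0|).
    by apply: measurableT_comp => //; exact: measurable_coord.
  by rewrite -[_ @^-1` _]setTI; apply: h => //; exact: measurable_itv.
by apply/seteqP; split=> x /=; rewrite in_itv/= andbT.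
Qed.

Lemma outside_cvg0 (P : probability (borelV R m) R) i del : 0 < del ->
  exists A0, forall A, (A0 <= A)%N -> fine (P (outside A i)) <= del.
Proof.
move=> del0; have mo := measurable_outside.
have E A : fine (P (outside A i)) = \int[P]_x \1_(outside A i) x.
  by rewrite /Rintegral integral_indic// setIT.
have c : \int[P]_x \1_(outside A i) x @[A --> \oo] --> (0 : R).
  rewrite -(mul0r (fine (P setT))) -(Rintegral_cst P measurableT 0).
  apply: (proj2 (@Rintegral_dominated _ _ _ P setT (fun A => \1_(outside A i))
    (fun=> 0) (fun=> 1) measurableT _ _ _ (integrable_cst P 1) _)).
  - by move=> A; exact: measurable_indic.
  - exact: measurable_cst.
  - apply: aeW => x; apply: cvg_near_cst.
    near=> A; rewrite indicE memNset//= => h.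
    have : (`|(x : 'cV[R]_m) i 0| <= A%:R) by near: A; exact: nbhs_infty_ger.
    by rewrite leNgt => /negP.
  - apply: aeW => x A; rewrite indicE.
    by case: (_ \in _); rewrite ?normr1 ?normr0.
have /cvgrPdist_le/(_ _ del0)[A0 _ h] := c; exists A0 => A /h.
by rewrite E sub0r normrN; apply: le_trans; exact: ler_norm.
Unshelve. all: by end_near. Qed.

Lemma Rintegral_box (P : probability (borelV R m) R) (f g : 'cV[R]_m -> R)
    M A eps del : continuous f -> continuous g ->
  (forall x, `|f x| <= M) -> (forall x, `|g x| <= M) -> 0 <= eps ->
  (forall x : 'cV[R]_m, (forall i, `|x i 0| <= A%:R) -> `|f x - g x| <= eps) ->
  (forall i, fine (P (outside A i)) <= del) ->
  `|\int[P]_x f x - \int[P]_x g x| <= eps + 2 * M * (m%:R * del).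
Proof.
move=> cf cg fM gM eps0 fg Pdel; have mo := measurable_outside.
have M0 : 0 <= M by exact: le_trans (fM 0).
have if_ := integrable_continuous P cf fM; have ig := integrable_continuous P cg gM.
rewrite -RintegralB//.
apply: le_trans (le_normr_Rintegral _ _) _ => //; first exact: integrable_sub_fun.
have iout i : P.-integrable setT (EFin \o \1_(outside A i)).
  apply: (bounded_integrable P (M := 1)); first exact: measurable_indic.
  by move=> x; rewrite indicE; case: (_ \in _); rewrite ?normr1 ?normr0.
have isum (r : seq 'I_m) :
    P.-integrable setT (EFin \o (fun x => \sum_(i <- r) \1_(outside A i) x)) /\
    \int[P]_x (\sum_(i <- r) \1_(outside A i) x) <= \sum_(i <- r) del.
  elim: r => [|i r [IH1 IH2]].
    under eq_fun do rewrite big_nil; split; first exact: integrable_cst.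
    by rewrite big_nil Rintegral_cst// mul0r.
  under eq_fun do rewrite big_cons; split; first exact: integrable_add.
  rewrite RintegralD// big_cons; apply: lerD => //.
  by have := Pdel i; rewrite /Rintegral integral_indic// setIT.
have [i1 i2] := isum (index_enum _).
apply: (@le_trans _ _ (\int[P]_x (eps + 2 * M *
    \sum_(i <- index_enum 'I_m) \1_(outside A i) x))).
  apply: le_Rintegral => //.
  - by apply: integrable_normr; exact: integrable_sub_fun.
  - by apply: integrable_add; [exact: integrable_cst|exact: integrable_scale].
  move=> x _.
  have s0 : 0 <= \sum_(i <- index_enum 'I_m) (\1_(outside A i) x : R).
    by apply: sumr_ge0 => i _; rewrite indicE.
  have [xA|/existsNP[i /negP]] := pselect (forall i, `|(x : 'cV[R]_m) i 0| <= A%:R).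
    by apply: le_trans (fg x xA) _; rewrite lerDl !mulr_ge0.
  rewrite -ltNge => xi; apply: (@le_trans _ _ (2 * M)).
    apply: le_trans (ler_normB _ _) _.
    by have := fM x; have := gM x; lra.
  rewrite ler_wpDl// ler_peMr ?mulr_ge0// (bigD1 i)//= indicE mem_set//.
  by rewrite lerDl; apply: sumr_ge0 => j _; rewrite indicE.
rewrite RintegralD//; [|exact: integrable_cst|exact: integrable_scale].
rewrite Rintegral_prob_cst RintegralZl//.
rewrite lerD2l ler_wpM2l ?mulr_ge0//; apply: le_trans i2 _.
by rewrite sumr_const card_ord mulr_natl.
Qed.

(* Levy's continuity theorem, with tightness assumed: rational frequencies then
   suffice. *)
Lemma continuity_theorem (mu : nat -> probability (borelV R m) R)
    (nu : probability (borelV R m) R) (f : 'cV[R]_m -> R) (M : R) :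
  (forall u th, \int[mu n]_x cos (qdot u x - th) @[n --> \oo] -->
     \int[nu]_x cos (qdot u x - th)) ->
  (forall i del, 0 < del -> exists A : nat, \forall n \near \oo,
     fine (mu n [set x | A%:R < `|(x : 'cV[R]_m) i 0|]) <= del) ->
  continuous f -> (forall x, `|f x| <= M) ->
  \int[mu n]_x f x @[n --> \oo] --> \int[nu]_x f x.
Proof.
move=> cchar tight cf fM; have mo := measurable_outside.
have M0 : 0 <= M by exact: le_trans (fM 0).
apply/cvgrPdist_le => eps eps0.
(* Each of the two comparisons of f with g costs eps/5 on the box and eps/5 outside it; the
   convergence for g costs the fifth share. The summand 1 keeps the denominator positive. *)
pose del := eps / 5 / (2 * M * m%:R + 1).
have D0 : 0 < 2 * M * m%:R + 1.
  by apply: ltr_wpDl => //; apply: mulr_ge0 => //; apply: mulr_ge0.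
have del0 : 0 < del by rewrite divr_gt0// divr_gt0.
have eps50 : 0 < eps / 5 by rewrite divr_gt0.
have Mdel : 2 * M * (m%:R * del) <= eps / 5.
  have : del * (2 * M * m%:R + 1) = eps / 5 by rewrite /del divfK// gt_eqF.
  by rewrite mulrA; move: del0; set a := 2 * M * m%:R; lra.
have /choice[A1 hA1] : forall i, exists A1, forall A, (A1 <= A)%N ->
    fine (nu (outside A i)) <= del by move=> i; exact: outside_cvg0.
have /choice[A2 hA2] : forall i, exists A2 : nat, \forall n \near \oo,
    fine (mu n (outside A2 i)) <= del by move=> i; exact: tight.
(* One positive natural half-width beyond all thresholds, of nu and of mu n, in every coordinate. *)
pose A := (\max_i (A1 i + A2 i)).+1.
have A1A i : (A1 i <= A)%N.
  by rewrite ltnW// ltnS; apply: leq_trans (leq_bigmax i); exact: leq_addr.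
have A2A i : (A2 i <= A)%N.
  by rewrite ltnW// ltnS; apply: leq_trans (leq_bigmax i); exact: leq_addl.
have A0 : 0 < A%:R :> R by rewrite ltr0n.
have [N [h [hM hf]]] := bernstein_approx cf fM A0 eps50.
pose g (x : 'cV[R]_m) := mbern N (fun i => sin01 A%:R (x i 0)) (enum 'I_m) h (fun=> 0%N).
have [cg _ hg] : trig_cvg mu nu g by exact: trig_cvg_mbern.
have gM x : `|g x| <= M.
  have y01 i : 0 <= sin01 A%:R (x i 0) <= 1 by exact: sin01_bounds.
  have h1 : mbern N (fun i => sin01 A%:R (x i 0)) (enum 'I_m) (fun=> - M) (fun=> 0%N) <= g x.
    by apply: mbern_le => // p; have := hM p; rewrite ler_norml => /andP[].
  have h2 : g x <= mbern N (fun i => sin01 A%:R (x i 0)) (enum 'I_m) (fun=> M) (fun=> 0%N).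
    by apply: mbern_le => // p; have := hM p; rewrite ler_norml => /andP[].
  by move: h1 h2; rewrite !mbern_cst ler_norml => -> ->.
have gcvg : \int[mu n]_x g x @[n --> \oo] --> \int[nu]_x g x.
  have := hg 0 0.
  have E (P : probability (borelV R m) R) :
      \int[P]_x (g x * cos (qdot 0 x - 0)) = \int[P]_x g x.
    by apply: eq_Rintegral => x _; rewrite qdot0 subrr cos0 mulr1.
  by rewrite E; under eq_fun do rewrite E.
have muA : \forall n \near \oo, forall i, fine (mu n (outside A i)) <= del.
  have /choice[K hK] : forall i, exists K : nat, forall n, (K <= n)%N ->
      fine (mu n (outside (A2 i) i)) <= del.
    by move=> i; have [K _ hK] := hA2 i; exists K => n; exact: hK.
  exists (\max_i K i) => // n /= Kn i.
  apply: le_trans (hK i n _); last by apply: leq_trans Kn; exact: leq_bigmax.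
  apply: fine_le; rewrite ?fin_num_measure//.
  apply: le_measure; rewrite ?inE//.
  by move=> x /=; apply: le_lt_trans; rewrite ler_nat.
have /cvgrPdist_le/(_ _ eps50) := gcvg.
apply: filterS2 muA => n muA gn.
have b1 := Rintegral_box cf cg fM gM (ltW eps50) hf muA.
have b2 := Rintegral_box cf cg fM gM (ltW eps50) hf (fun i => hA1 i A (A1A i)).
have -> : \int[nu]_x f x - \int[mu n]_x f x =
  (\int[nu]_x f x - \int[nu]_x g x) + (\int[nu]_x g x - \int[mu n]_x g x) -
  (\int[mu n]_x f x - \int[mu n]_x g x) by ring.
apply: le_trans (ler_normB _ _) _; apply: le_trans (lerD (ler_normD _ _) (lexx _)) _.
by move: b1 b2 gn Mdel; lra.
Qed.

Lemma weak_cvgP (mu : nat -> probability (borelV R m) R)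
    (nu : probability (borelV R m) R) :
  (forall u th, \int[mu n]_x cos (qdot u x - th) @[n --> \oo] -->
     \int[nu]_x cos (qdot u x - th)) ->
  (forall i del, 0 < del -> exists A : nat, \forall n \near \oo,
     fine (mu n [set x | A%:R < `|(x : 'cV[R]_m) i 0|]) <= del) ->
  weak_cvg mu nu.
Proof.
move=> cchar tight f cf [M fM].
have E (P : probability (borelV R m) R) :
    (\int[P]_x (f x)%:E)%E = (\int[P]_x f x)%:E.
  rewrite /Rintegral fineK//; apply: integrable_fin_num => //.
  exact: integrable_continuous cf fM.
rewrite E; under eq_fun do rewrite E.
apply: cvg_EFin; first exact: nearW.
exact: continuity_theorem cf fM.
Qed.

End weak_convergence.

(** * Gaussian vectors *)

Section image_probability.
Context {d d' : measure_display} {T : measurableType d} {T' : measurableType d'}.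
Context {R : realType}.
Variables (P : probability T R) (f : T -> T').
Hypothesis mf : measurable_fun [set: T] f.

Definition image_prob : probability T' R :=
  distribution P (HB.pack_for {mfun T >-> T'} f (isMeasurableFun.Build _ _ _ _ f mf)).

Lemma Rintegral_image_prob (g : T' -> R) : bounded_measurable g ->
  \int[image_prob]_y g y = \int[P]_x g (f x).
Proof.
move=> [mg [M gM]]; congr fine.
have ig : P.-integrable [set: T] (EFin \o (g \o f)).
  have h : measurable_fun [set: T] (g \o f) by apply: measurableT_comp.
  exact: (@bounded_integrable _ T R P (g \o f) M h (fun x => gM (f x))).
transitivity (\int[pushforward P f]_(y in setT) (g y)%:E)%E; first by [].
rewrite (@integral_pushforward _ _ T T' R f mf P setT (EFin \o g))//.
exact/measurable_EFinP.
Qed.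

End image_probability.

Section char_unique.
Context {R : realType}.
Variables P Q : probability R R.
Hypothesis char_eq : forall s th,
  \int[P]_x cos (s * x - th) = \int[Q]_x cos (s * x - th).

Let col1 (x : R) : 'cV[R]_1 := \col_i x.

Let mcol1 : measurable_fun [set: R] (col1 : R -> borelV R 1).
Proof.
apply: measurable_borelV => i; rewrite (_ : (fun w => _) = id).
  exact: measurable_id.
by apply/funext => x; rewrite mxE.
Qed.

(** The continuity theorem for the constant sequence P, seen as a law on column vectors of length 1;
    a single law is tight. *)
Let continuous_eq (h : R -> R) M : continuous h -> (forall x, `|h x| <= M) ->
  \int[P]_x h x = \int[Q]_x h x.
Proof.
move=> ch hM; pose f (x : 'cV[R]_1) := h (x 0 0).
have cf : continuous f.
  move=> x; apply: (@cvg_comp _ _ _ (fun x : 'cV[R]_1 => x 0 0) h _ _ _ _ (ch _)).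
  exact: (@continuous_coord R 1 0 x).
have E (P0 : probability R R) (g : 'cV[R]_1 -> R) : continuous g ->
    (exists M', forall x, `|g x| <= M') ->
    \int[image_prob P0 mcol1]_y g y = \int[P0]_x g (col1 x).
  move=> cg gM; apply: Rintegral_image_prob; split=> //.
  exact: continuous_borelV.
have bf : exists M', forall x, `|f x| <= M' by exists M => x; exact: hM.
have Eh (P0 : probability R R) : \int[P0]_x h x = \int[image_prob P0 mcol1]_y f y.
  by rewrite E//; apply: eq_Rintegral => x _; rewrite /f mxE.
rewrite !Eh.
have qE (u : 'cV[rat]_1) x : qdot u (col1 x) = ratr (u 0 0) * x.
  by rewrite /qdot big_ord1 mxE.
have Ec (P0 : probability R R) u th :
    \int[image_prob P0 mcol1]_y cos (qdot u y - th) =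
    \int[P0]_x cos (ratr (u 0 0) * x - th).
  rewrite E; [|exact: continuous_cos_qdot|by exists 1 => x; exact: cos_max].
  by apply: eq_Rintegral => x _; rewrite qE.
have c : \int[image_prob P mcol1]_y f y @[_ --> \oo] -->
    \int[image_prob Q mcol1]_y f y.
  apply: (@continuity_theorem R 1 (fun=> image_prob P mcol1) _ f M) => //.
  - by move=> u th; rewrite !Ec char_eq; exact: cvg_cst.
  - move=> i del del0; have [A hA] := outside_cvg0 (image_prob P mcol1) i del0.
    by exists A; apply: nearW => _; exact: hA.
  - by move=> x; exact: hM.
exact: (cvg_unique _ (cvg_cst _) c).
Qed.

(** The indicator of the open ray is the bounded pointwise limit of the ramps clip 1 (n (x - a)). *)
Let ray_eq a : P `]a, +oo[%classic = Q `]a, +oo[%classic.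
Proof.
pose h (n : nat) (x : R) := clip 1 (n%:R * (x - a)).
have ch n : continuous (h n).
  move=> x; apply: (@cvg_comp _ _ _ (fun x => n%:R * (x - a)) (clip 1) _ _ _ _
    (@continuous_clip _ 1 _)).
  by apply: cvgMr; apply: cvgB; [exact: cvg_id|exact: cvg_cst].
have h1 n x : `|h n x| <= 1.
  by rewrite ger0_norm ?clip_ge0// clip_le.
have hE (P0 : probability R R) :
    \int[P0]_x h n x @[n --> \oo] --> fine (P0 `]a, +oo[%classic).
  have -> : fine (P0 `]a, +oo[%classic) = \int[P0]_x \1_(`]a, +oo[%classic) x.
    by rewrite /Rintegral integral_indic// setIT.
  apply: (proj2 (@Rintegral_dominated _ _ _ P0 setT h (\1_(`]a, +oo[%classic))
    (fun=> 1) measurableT _ _ _ (integrable_cst P0 1) _)).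
  - by move=> n; apply: continuous_measurable_fun; exact: ch.
  - exact: measurable_indic.
  - apply: aeW => x; have [ax|xa] := ltP a x.
      rewrite indicE mem_set/= ?in_itv/= ?ax//.
      apply: cvg_near_cst; near=> n; rewrite /h clip_max//.
      rewrite -ler_pdivrMr ?subr_gt0//; near: n; exact: nbhs_infty_ger.
    rewrite indicE memNset/= ?in_itv/= ?andbT; last first.
      by move=> /(le_lt_trans xa); rewrite ltxx.
    apply: cvg_near_cst; apply: nearW => n; rewrite /h /clip min_l ?max_l//.
      by rewrite mulr_ge0_le0// subr_le0.
    by apply: (@le_trans _ _ 0) => //; rewrite mulr_ge0_le0// subr_le0.
  - by apply: aeW => x n.
have E n : \int[P]_x h n x = \int[Q]_x h n x by exact: continuous_eq (ch n) (h1 n).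
have hP := hE P; have hQ := hE Q.
have {}hP : \int[Q]_x h n x @[n --> \oo] --> fine (P `]a, +oo[%classic).
  by apply: cvg_trans hP; apply: near_eq_cvg; apply: nearW => n; rewrite E.
rewrite -[LHS]fineK ?fin_num_measure// -[RHS]fineK ?fin_num_measure//.
by congr EFin; exact: (cvg_unique _ hP hQ).
Unshelve. all: by end_near. Qed.

Lemma char_unique A : measurable A -> P A = Q A.
Proof.
apply: (@measure_unique _ _ _ (@RGenOInfty.G R) (fun n => `](- n%:R), +oo[%classic)).
- exact: RGenOInfty.measurableE.
- move=> _ _ [x ->] [y ->]; exists (Num.max x y).
  apply/seteqP; split=> z /=; rewrite !in_itv/= !andbT gt_max.
    by move=> [-> ->].
  by move=> /andP[].
- by move=> n; exists (- n%:R).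
- apply/seteqP; split=> // x _; exists (Num.truncn `|x|).+1 => //=.
  rewrite in_itv/= andbT ltrNl; apply: le_lt_trans (truncnS_gt _).
  by rewrite -normrN ler_norm.
- by move=> _ [x ->]; exact: ray_eq.
- by move=> n; rewrite ltey_eq fin_num_measure.
Qed.

End char_unique.

(** * The characteristic function of the normal law, by a differential equation *)

Section normal_char.
Context {R : realType}.
Notation mu := (@lebesgue_measure R).
Variable sg : R.
Hypothesis sg0 : sg != 0.

Let p := normal_pdf (0 : R) sg.

Let ip : mu.-integrable [set: R] (EFin \o p).
Proof. exact: integrable_normal_pdf. Qed.

Let mp : measurable_fun [set: R] p.
Proof. exact: measurable_normal_pdf. Qed.

Let p0 x : 0 <= p x. Proof. exact: normal_pdf_ge0. Qed.

Let Ip : \int[mu]_x p x = 1.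
Proof. by rewrite /Rintegral integral_normal_pdf. Qed.

Let integrable_pM (f : R -> R) M : measurable_fun [set: R] f ->
  (forall x, `|f x| <= M) -> mu.-integrable [set: R] (EFin \o (fun x => f x * p x)).
Proof.
move=> mf fM; apply: (@le_integrable _ _ _ mu setT measurableT _
    (EFin \o (fun x => M * p x))).
- by apply/measurable_EFinP; exact: measurable_funM.
- move=> x _ /=; rewrite lee_fin !normrM ler_wpM2r//.
  exact: le_trans (fM x) (ler_norm _).
- exact: (integrableZl measurableT M ip).
Qed.

Lemma Rintegral_normal_prob (f : R -> R) : bounded_measurable f ->
  \int[normal_prob (0 : R) sg]_x f x = \int[mu]_x (f x * p x).
Proof.
pose P := (normal_prob (0 : R) sg : probability (measurableTypeR R) R).
apply: (@bounded_measurable_ind _ _ _ (fun f =>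
  \int[P]_x f x = \int[mu]_x (f x * p x))) => {f}.
- move=> E mE; rewrite /Rintegral integral_indic// setIT; congr fine.
  rewrite /P/= /normal_prob integral_mkcond; apply: eq_integral => x _.
  by rewrite /patch indicE; case: ifP => _; rewrite ?mul1r ?mul0r.
- move=> a b f g [mf [M fM]] [mg [M' gM']] hf hg.
  rewrite RintegralD//; last 2 first.
  + by apply: integrable_scale; exact: bounded_integrable fM.
  + by apply: integrable_scale; exact: bounded_integrable gM'.
  rewrite !RintegralZl//; [|exact: bounded_integrable gM'|exact: bounded_integrable fM].
  rewrite hf hg -!RintegralZl//; [|exact: integrable_pM gM'|exact: integrable_pM fM].
  rewrite -RintegralD//; last 2 first.
  + exact: (integrableZl measurableT a (integrable_pM mf fM)).
  + exact: (integrableZl measurableT b (integrable_pM mg gM')).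
  by apply: eq_Rintegral => x _; ring.
- move=> f [mf [M fM]] hf; apply/eqP; rewrite -subr_eq0 -normr_le0.
  apply: (@le_epsilon_scale _ _ _ 2) => // eps eps0; rewrite add0r.
  have [g [[mg [M' gM']] hg fg]] := hf eps eps0.
  have iPf : P.-integrable setT (EFin \o f) by exact: bounded_integrable fM.
  have iPg : P.-integrable setT (EFin \o g) by exact: bounded_integrable gM'.
  have b1 : `|\int[P]_x f x - \int[P]_x g x| <= eps.
    rewrite -RintegralB//; apply: le_trans (le_normr_Rintegral _ _) _ => //.
      exact: integrable_sub_fun.
    rewrite -[leRHS](Rintegral_prob_cst P); apply: le_Rintegral => //.
    + by apply: integrable_normr; exact: integrable_sub_fun.
    + exact: integrable_cst.
  have b2 : `|\int[mu]_x (f x * p x) - \int[mu]_x (g x * p x)| <= eps.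
    have id : mu.-integrable setT (EFin \o (fun x => (f x - g x) * p x)).
      apply: (@integrable_pM _ eps) => //; exact: measurable_funB.
    rewrite -RintegralB//; [|exact: integrable_pM fM|exact: integrable_pM gM'].
    under eq_Rintegral do rewrite -mulrBl.
    apply: le_trans (le_normr_Rintegral _ _) _ => //.
    rewrite -[leRHS]mulr1 -Ip -RintegralZl//; apply: le_Rintegral => //.
    + exact: integrable_norm.
    + exact: (integrableZl measurableT eps ip).
    + by move=> x _; rewrite normrM (ger0_norm (p0 x)) ler_wpM2r.
  rewrite (_ : \int[P]_x f x - _ = (\int[P]_x f x - \int[P]_x g x) -
    (\int[mu]_x (f x * p x) - \int[mu]_x (g x * p x))); last by rewrite hg; ring.
  by apply: le_trans (ler_normB _ _) _; lra.
Qed.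

Let sg2 : 0 < sg ^+ 2. Proof. by rewrite exprn_even_gt0. Qed.

Let pE x : p x = normal_peak sg * expR (- (x ^+ 2 / (sg ^+ 2 *+ 2))).
Proof. by rewrite /p normal_pdfE// /normal_fun subr0 mulNr. Qed.

Let q x := expR (- (x ^+ 2 / (sg ^+ 2 *+ 4))).

Let C : R := normal_peak sg * (1 + sg ^+ 2 *+ 4).

Let C0 : 0 <= C.
Proof.
apply: mulr_ge0; first exact: normal_peak_ge0.
by rewrite addr_ge0// mulrn_wge0// ltW.
Qed.

(** Half of the exponent absorbs |x|: with t = x^2/(4 sg^2), |x| <= 1 + x^2 <= (1 + 4 sg^2) e^t.
    What remains, q, is a multiple of a normal density of variance 2 sg^2, so the bound is
    integrable and free of s. *)
Let xp_le x : `|x| * p x <= C * q x.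
Proof.
rewrite pE /C /q; set t := x ^+ 2 / (sg ^+ 2 *+ 4).
have t0 : 0 <= t by rewrite divr_ge0 ?sqr_ge0// mulrn_wge0// ltW.
have -> : - (x ^+ 2 / (sg ^+ 2 *+ 2)) = - t + - t by rewrite /t; field.
rewrite expRD.
have h : `|x| * expR (- t) <= 1 + sg ^+ 2 *+ 4.
  rewrite expRN -ler_pdivlMr ?invr_gt0 ?expR_gt0// invrK.
  have x2 : x ^+ 2 = sg ^+ 2 *+ 4 * t by rewrite /t; field.
  have nx : `|x| <= 1 + x ^+ 2.
    rewrite -[x ^+ 2]real_normK ?num_real//.
    by have := sqr_ge0 (`|x| - 1); have := normr_ge0 x; nra.
  have s4 : 0 <= sg ^+ 2 *+ 4 by rewrite mulrn_wge0// ltW.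
  apply: le_trans nx _; rewrite x2.
  apply: (@le_trans _ _ ((1 + sg ^+ 2 *+ 4) * (1 + t))).
    by set a := sg ^+ 2 *+ 4 in s4 *; nra.
  by apply: ler_wpM2l; [exact: addr_ge0|exact: expR_ge1Dx].
have e0 := expR_ge0 (- t); have k0 := normal_peak_ge0 sg.
have -> : `|x| * (normal_peak sg * (expR (- t) * expR (- t))) =
  normal_peak sg * (`|x| * expR (- t)) * expR (- t) by ring.
by rewrite ler_wpM2r// ler_wpM2l.
Qed.

Let iq : mu.-integrable [set: R] (EFin \o q).
Proof.
pose s' := sg * Num.sqrt 2.
have s'0 : s' != 0 by rewrite mulf_neq0// sqrtr_eq0 -ltNge.
have -> : EFin \o q = (fun x => ((normal_peak s')^-1%:E * (normal_pdf 0 s' x)%:E)%E).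
  apply/funext => x /=; rewrite -EFinM normal_pdfE// mulKf ?gt_eqF ?normal_peak_gt0//.
  rewrite /normal_fun subr0 mulNr; congr (expR (- (_ / _)))%:E.
  by rewrite /s' exprMn sqr_sqrtr//; ring.
by apply: integrableZl => //; exact: integrable_normal_pdf.
Qed.

Let pder (x : R) : is_derive x 1 p (- (x / sg ^+ 2) * p x).
Proof.
have -> : p = fun x => normal_peak sg * expR (- (x ^+ 2 / (sg ^+ 2 *+ 2))).
  by apply/funext => y; exact: pE.
apply: is_derive_eq; rewrite /GRing.scale/=; field.
exact: sg0.
Qed.

Section frequency.
Variable th : R.

Let sinp (s x : R) := sin (s * x - th) * p x.
Let dsinp (s x : R) := (s * cos (s * x - th)) * p x - (x / sg ^+ 2 * sin (s * x - th)) * p x.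

Let sinp_der (s x : R) : is_derive x 1 (sinp s) (dsinp s x).
Proof.
have h1 : is_derive x 1 (fun x => sin (s * x - th)) (s * cos (s * x - th)).
  by apply: is_derive_eq; rewrite /GRing.scale/=; ring.
have h2 := pder x.
have := is_deriveM h1 h2; rewrite /sinp => h; apply: (is_derive_eq h).
by rewrite /dsinp /GRing.scale/=; ring.
Qed.

Let mtrig (h : R -> R) s : continuous h -> measurable_fun [set: R] (fun x => h (s * x - th)).
Proof.
move=> ch; apply: continuous_measurable_fun => x.
apply: (@cvg_comp _ _ _ (fun x => s * x - th) h _ _ _ _ (ch _)).
by apply: cvgB; [exact: cvgMr cvg_id|exact: cvg_cst].
Qed.

Let xsin (s x : R) := (x * sin (s * x - th)) * p x.

Let mxsin s : measurable_fun [set: R] (xsin s).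
Proof.
apply: measurable_funM => //; apply: measurable_funM => //.
by apply: mtrig; exact: continuous_sin.
Qed.

Let xsin_le s x : `|xsin s x| <= C * q x.
Proof.
apply: le_trans (xp_le x); rewrite /xsin !normrM (ger0_norm (p0 x)).
by rewrite ler_wpM2r// ler_piMr// sin_max.
Qed.

Let icq : mu.-integrable [set: R] (EFin \o (fun x => C * q x)).
Proof. exact: (integrableZl measurableT C iq). Qed.

Let ixsin s : mu.-integrable [set: R] (EFin \o xsin s).
Proof.
apply: (@le_integrable _ _ _ mu setT measurableT _ (EFin \o (fun x => C * q x))) => //.
  by apply/measurable_EFinP; exact: mxsin.
by move=> x _ /=; rewrite lee_fin (le_trans (xsin_le s x))// ler_norm.
Qed.

Let icos s : mu.-integrable [set: R] (EFin \o (fun x => cos (s * x - th) * p x)).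
Proof.
by apply: (@integrable_pM _ 1) => [|x]; [apply: mtrig; exact: continuous_cos|exact: cos_max].
Qed.

Let dsinpE s : dsinp s =
  (fun x => s * (cos (s * x - th) * p x) - (sg ^+ 2)^-1 * xsin s x).
Proof. by apply/funext => x; rewrite /dsinp /xsin; ring. Qed.

Let idsinp s : mu.-integrable [set: R] (EFin \o dsinp s).
Proof.
rewrite dsinpE; exact: (integrableB measurableT
  (integrableZl measurableT s (icos s))
  (integrableZl measurableT (sg ^+ 2)^-1 (ixsin s))).
Qed.

Let cp : continuous p. Proof. exact: continuous_normal_pdf. Qed.

Let continuous_dsinp s : continuous (dsinp s).
Proof.
have cl (h : R -> R) : continuous h -> continuous (fun x => h (s * x - th)).
  move=> ch x; apply: (@cvg_comp _ _ _ (fun x => s * x - th) h _ _ _ _ (ch _)).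
  by apply: cvgB; [exact: cvgMr cvg_id|exact: cvg_cst].
move=> x; apply: cvgB.
  by apply: cvgM; [apply: cvgMr; exact: (cl _ (@continuous_cos R))|exact: cp].
apply: cvgM; last exact: cp.
apply: cvgM; last exact: (cl _ (@continuous_sin R)).
exact: cvgMl cvg_id.
Qed.

Let sinp_le s x n : n.+1%:R <= `|x| -> `|sinp s x| <= C * n.+1%:R^-1.
Proof.
move=> nx; rewrite ler_pdivlMr// mulrC.
have q1 : q x <= 1.
  by rewrite /q expR_le1 oppr_le0 divr_ge0 ?sqr_ge0// mulrn_wge0// ltW.
apply: le_trans (_ : C * q x <= _); last by rewrite ler_piMr.
apply: le_trans (xp_le x); rewrite /sinp normrM (ger0_norm (p0 x)).
rewrite ler_pM// ?mulr_ge0//; by rewrite ler_piMl// sin_max.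
Qed.

(** The fundamental theorem of calculus on [-n-1, n+1], with boundary terms of order 1/n. This is
    the integration by parts behind the differential equation. *)
Let Rintegral_dsinp s : \int[mu]_x dsinp s x = 0.
Proof.
pose I n : set R := `[(- n.+1%:R : R), n.+1%:R]%classic.
have mI n : measurable (I n) by exact: measurable_itv.
have md : measurable_fun [set: R] (dsinp s).
  by apply: continuous_measurable_fun; exact: continuous_dsinp.
have [_ c] : mu.-integrable [set: R] (EFin \o dsinp s) /\
    \int[mu]_x (dsinp s x * \1_(I n) x) @[n --> \oo] --> \int[mu]_x dsinp s x.
  apply: (@Rintegral_dominated _ _ _ mu setT _ _ (fun x => `|dsinp s x|) measurableT) => //.
  - by move=> n; apply: measurable_funM; [exact: md|apply: measurable_indic; exact: mI].
  - apply: aeW => x; apply: cvg_near_cst.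
    near=> n; rewrite indicE mem_set ?mulr1//.
    rewrite /I/= in_itv/= -ler_norml.
    apply: (@le_trans _ _ n%:R); last by rewrite ler_nat.
    by near: n; exact: nbhs_infty_ger.
  - exact: (integrable_norm (idsinp s)).
  - apply: aeW => x n; rewrite normrM indicE ler_piMr//.
    by case: (_ \in _); rewrite ?normr1 ?normr0.
apply: (cvg_unique (@Rhausdorff R) c).
have e n : \int[mu]_x (dsinp s x * \1_(I n) x) = sinp s n.+1%:R - sinp s (- n.+1%:R).
  have nn : - n.+1%:R < n.+1%:R :> R by rewrite gtrN.
  have ds (x : R) : derivable (sinp s) x 1 by case: (sinp_der s x).
  have dE (x : R) : derive1 (sinp s) x = dsinp s x by rewrite derive1E; case: (sinp_der s x).
  have cs : continuous (sinp s).
    by move=> x; apply: differentiable_continuous; exact/derivable1_diffP.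
  have h := @continuous_FTC2 R (dsinp s) (sinp s) _ _ nn
    (continuous_subspaceT (@continuous_dsinp s)).
  rewrite /Rintegral; transitivity (fine (\int[mu]_(x in I n) (dsinp s x)%:E)%E).
    congr fine; rewrite [RHS]integral_mkcond; apply: eq_integral => x _.
    by rewrite /patch indicE; case: (_ \in _); rewrite ?mulr1 ?mulr0.
  rewrite h//.
  split; [by move=> x _; exact: ds| |].
  - by apply: cvg_at_right_filter; exact: cs.
  - by apply: cvg_at_left_filter; exact: cs.
suff : (fun n => sinp s n.+1%:R - sinp s (- n.+1%:R)) @ \oo --> 0.
  by rewrite -(funext e).
clear e c.
rewrite -[X in _ --> X](subrr 0).
have z : (fun n => C * n.+1%:R^-1) @ \oo --> 0.
  rewrite -[X in _ --> X](mulr0 C); apply: cvgM; first exact: cvg_cst.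
  exact: cvg_harmonic.
by apply: cvgB; apply: norm_cvg0; apply: (squeeze_cvgr _ (cvg_cst 0) z);
  apply: nearW => n; rewrite normr_ge0/= sinp_le// ?normrN normr_nat.
Unshelve. all: by end_near. Qed.

Let Rintegral_xsin s :
  \int[mu]_x xsin s x = sg ^+ 2 * s * \int[mu]_x (cos (s * x - th) * p x).
Proof.
have := Rintegral_dsinp s; rewrite dsinpE RintegralB//; last 2 first.
- exact: (integrableZl measurableT s (icos s)).
- exact: (integrableZl measurableT (sg ^+ 2)^-1 (ixsin s)).
rewrite !RintegralZl//.
move=> /subr0_eq h; rewrite -mulrA h mulrA divff ?mul1r// gt_eqF//.
Qed.

Let I s := \int[mu]_x (cos (s * x - th) * p x).

(** Differentiation under the integral gives minus the integral of [xsin], and integration by parts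
    returns I, whence I' = - sg^2 s I. *)
Let derI (s : R) : is_derive s 1 I (- (sg ^+ 2 * s) * I s).
Proof.
pose f (s x : R) := cos (s * x - th) * p x.
have df (r x : R) : is_derive r 1 (fun r => f r x) (- xsin r x).
  have -> : (fun r => f r x) = (fun r => p x * cos (r * x - th)).
    by apply/funext => r'; rewrite /f mulrC.
  by apply: is_derive_eq; rewrite /xsin /GRing.scale/=; ring.
have dE (r x : R) : partial1of2 f r x = - xsin r x.
  by rewrite partial1of2E; case: (df r x).
have Is : (`]s - 1, s + 1[%classic : set R) s by rewrite /= in_itv/=; apply/andP; split; lra.
have i1 r : mu.-integrable [set: R] (EFin \o f r) by exact: icos.
have d1 (r x : R) : derivable (f ^~ x) r 1 by case: (df r x).
have g0 x : 0 <= C * q x by rewrite mulr_ge0// expR_ge0.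
have gu (r x : R) : `|partial1of2 f r x| <= C * q x.
  by rewrite dE normrN xsin_le.
have h1 := @derivable_under_integral R _ _ mu f setT measurableT s (s - 1) (s + 1) Is
  (fun r _ => i1 r) (fun r x _ _ => d1 r x) _ g0 icq (fun r x _ _ => gu r x).
have h2 := @differentiation_under_integral R _ _ mu f setT measurableT s (s - 1) (s + 1) Is
  (fun r _ => i1 r) (fun r x _ _ => d1 r x) _ g0 icq (fun r x _ _ => gu r x).
apply: DeriveDef => //; rewrite -derive1E [LHS]h2.
under eq_Rintegral do rewrite dE -mulN1r.
by rewrite RintegralZl// Rintegral_xsin mulN1r mulNr.
Qed.

Lemma Rintegral_cos_pdf s : I s = cos th * expR (- (sg ^+ 2 * s ^+ 2 / 2)).
Proof.
pose J (s : R) := I s * expR (sg ^+ 2 * s ^+ 2 / 2).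
have dJ (r : R) : is_derive r 1 J 0.
  have h1 : is_derive r 1 (fun r : R => expR (sg ^+ 2 * r ^+ 2 / 2))
      (sg ^+ 2 * r * expR (sg ^+ 2 * r ^+ 2 / 2)).
    by apply: is_derive_eq; rewrite /GRing.scale/=; field.
  have := is_deriveM (derI r) h1; rewrite /J => h; apply: (is_derive_eq h).
  by rewrite /GRing.scale/=; ring.
have := is_derive_0_is_cst s 0 dJ; rewrite /J => h.
have i0 : I 0 = cos th.
  rewrite /I; under eq_Rintegral do rewrite mul0r sub0r cosN.
  by rewrite RintegralZl// Ip mulr1.
move: h; rewrite i0 expr0n/= mulr0 mul0r expR0 mulr1 => h.
by rewrite expRN -h mulfK// gt_eqF// expR_gt0.
Qed.

End frequency.

Lemma char_normal s th : \int[normal_prob (0 : R) sg]_x cos (s * x - th) =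
  cos th * expR (- (sg ^+ 2 * s ^+ 2 / 2)).
Proof.
rewrite Rintegral_normal_prob ?Rintegral_cos_pdf//; split; last first.
  by exists 1 => x; exact: cos_max.
apply: continuous_measurable_fun => x; apply: (@cvg_comp _ _ _ (fun x => s * x - th) cos).
  by apply: cvgB; [exact: cvgMr cvg_id|exact: cvg_cst].
exact: continuous_cos.
Qed.

End normal_char.

Section gaussian_vectors.
Context {R : realType}.

Definition dot {m : nat} (a x : 'cV[R]_m) : R := (a^T *m x) 0 0.

Lemma dotE m (a x : 'cV[R]_m) : dot a x = \sum_i a i 0 * x i 0.
Proof. by rewrite /dot mxE; apply: eq_bigr => i _; rewrite mxE. Qed.

Lemma dotD m (a x y : 'cV[R]_m) : dot a (x + y) = dot a x + dot a y.
Proof. by rewrite /dot mulmxDr mxE. Qed.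

Lemma dotZ m (a x : 'cV[R]_m) c : dot a (c *: x) = c * dot a x.
Proof. by rewrite /dot -scalemxAr mxE. Qed.

Lemma dotC m (a x : 'cV[R]_m) : dot a x = dot x a.
Proof. by rewrite !dotE; apply: eq_bigr => i _; rewrite mulrC. Qed.

Lemma continuous_dot m (a : 'cV[R]_m) : continuous (dot a).
Proof.
have -> : dot a = (fun x => \sum_i a i 0 * x i 0) by apply/funext => x; exact: dotE.
apply: (@continuous_big R 'I_m +%R 0 xpredT) => [|i _]; first exact: add_continuous.
by move=> x; exact: cvgMr (@continuous_coord R m i x).
Qed.

Lemma bounded_measurable_cos_dot m (a : 'cV[R]_m) c :
  bounded_measurable ((fun x => cos (dot a x - c)) : borelV R m -> R).
Proof.
split; last by exists 1 => x; exact: cos_max.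
apply: continuous_borelV => x.
apply: (@cvg_comp _ _ _ (fun x => dot a x - c) (@cos R) _ _ _ _ (@continuous_cos R _)).
exact: cvgB (@continuous_dot m a x) (cvg_cst _).
Qed.

(** N is the law of a sum of vectors of s with independent standard normal coefficients. Each step
    adds one vector by a product measure, and Fubini's theorem factors the cosine integral. *)
Lemma normal_combination m (s : seq 'cV[R]_m) :
  exists N : probability (borelV R m) R, forall (a : 'cV[R]_m) th,
    \int[N]_x cos (dot a x - th) = cos th * expR (- ((\sum_(v <- s) dot a v ^+ 2) / 2)).
Proof.
elim: s => [|v s [N hN]].
  exists (@dirac _ (borelV R m) (0 : 'cV[R]_m) R) => a th.
  rewrite big_nil mul0r oppr0 expR0 mulr1 /Rintegral integral_dirac//.
    by rewrite diracT mul1e/= /dot mulmx0 mxE sub0r cosN.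
  by apply/measurable_EFinP; case: (bounded_measurable_cos_dot a th).
pose g := (normal_prob (0 : R) 1 : probability (measurableTypeR R) R).
pose f (z : borelV R m * measurableTypeR R) : 'cV[R]_m :=
  (z.1 : 'cV[R]_m) + (z.2 : R) *: v.
have mf : measurable_fun [set: _] (f : _ -> borelV R m).
  apply: measurable_borelV => i; rewrite /f.
  under eq_fun do rewrite !mxE.
  apply: measurable_funD.
    exact: (measurableT_comp (@measurable_coord R m i) measurable_fst).
  by apply: measurable_funM => //; exact: measurable_snd.
pose Q := (N \x g)%E : probability _ R.
exists (image_prob Q mf) => a th.
rewrite Rintegral_image_prob; last exact: bounded_measurable_cos_dot.
have [mc [M cM]] := bounded_measurable_cos_dot a th.
have iQ : Q.-integrable [set: _] (EFin \o (fun z => cos (dot a (f z) - th))).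
  apply: (@bounded_integrable _ _ _ Q _ 1) => [|z]; last exact: cos_max.
  exact: (measurableT_comp mc mf).
have -> : \int[Q]_z cos (dot a (f z) - th) =
    \int[N]_x \int[g]_z cos (dot a (f (x, z)) - th).
  rewrite /Rintegral -(@integral12_prod_meas1 _ _ _ _ _ N g _ iQ).
  congr fine; apply: eq_integral => x _; rewrite /fubini_F fineK//.
  apply: integrable_fin_num => //.
  apply: (@bounded_integrable _ _ _ g (fun z => cos (dot a (f (x, z)) - th)) 1) => [|z].
    exact: (measurableT_comp (measurableT_comp mc mf) (pair1_measurable x)).
  exact: cos_max.
transitivity (\int[N]_x (expR (- (dot a v ^+ 2 / 2)) * cos (dot a x - th))).
  apply: eq_Rintegral => x _.
  have := @char_normal R 1 (oner_neq0 _) (dot a v) (th - dot a x).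
  rewrite -[X in X = _ -> _]/(\int[g]_z _) expr1n mul1r mulrC -cosN opprB => <-.
  by apply: eq_Rintegral => z _; rewrite /f/= dotD dotZ; congr cos; ring.
rewrite RintegralZl//; last first.
  by apply: (@bounded_integrable _ _ _ N _ 1) => [//|x]; exact: cos_max.
rewrite hN big_cons mulrDl opprD expRD; ring.
Qed.

Let dot_sym m (V : 'M[R]_m) a b : V^T = V -> dot a (V *m b) = dot b (V *m a).
Proof. by move=> VT; rewrite dotC /dot trmx_mul VT mulmxA. Qed.

Let dot_delta m (i : 'I_m) (x : 'cV[R]_m) : dot (delta_mx i 0) x = x i 0.
Proof. by rewrite /dot trmx_delta -rowE mxE. Qed.

Let dot_delta_mx m (V : 'M[R]_m) i j : dot (delta_mx i 0) (V *m delta_mx j 0) = V i j.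
Proof. by rewrite dot_delta -colE mxE. Qed.

Let psd m (V : 'M[R]_m) := V^T = V /\ forall a, 0 <= dot a (V *m a).

(** If c = a.Vb were nonzero, the form at a + lambda b would be A + 2 lambda c with A = a.Va; the
    chosen lambda makes it -1. *)
Let psd_null m (V : 'M[R]_m) a b : psd V -> dot b (V *m b) = 0 -> dot a (V *m b) = 0.
Proof.
move=> [VT V0] b0; apply/eqP/negP => /negP nz.
set c := dot a (V *m b) in nz.
have := V0 (a + (- ((dot a (V *m a) + 1) / (2 * c))) *: b).
rewrite mulmxDr -scalemxAr dotD dotZ !(dotC (_ + _)) !dotD !dotZ.
rewrite (dotC _ a) (dotC _ b) (dotC _ a) (dotC _ b) (dot_sym b) // b0 -/c.
set A := dot a (V *m a); have -> : A + - ((A + 1) / (2 * c)) * c +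
    - ((A + 1) / (2 * c)) * (c + - ((A + 1) / (2 * c)) * 0) = -1 by field.
by rewrite lerNr oppr0 ler10.
Qed.

(** Symmetric elimination: subtracting v v^T with v = V e_i / sqrt(V_ii) keeps the matrix positive
    semidefinite and clears a diagonal entry. When the diagonal is zero, [psd_null] makes the matrix
    zero. *)
Let psd_sum_squares m (n : nat) (V : 'M[R]_m) :
  psd V -> (#|[set i | V i i != 0%R]%SET| <= n)%N ->
  exists s : seq 'cV[R]_m, forall a, dot a (V *m a) = \sum_(v <- s) dot a v ^+ 2.
Proof.
elim: n V => [|n IH] V psdV; case: (pickP (fun i => V i i != 0)) => [i Vi|V0 _].
- by rewrite leqn0 cards_eq0 => /eqP/setP/(_ i); rewrite !inE Vi.
- exists [::] => a; rewrite big_nil (_ : V = 0) ?mul0mx /dot ?mulmx0 ?mxE//.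
  apply/matrixP => i j; rewrite mxE -dot_delta_mx; apply: psd_null => //.
  by rewrite dot_delta_mx; apply/eqP/negbFE; exact: V0.
- move=> cV; have [VT Vge0] := psdV.
  have Vi0 : 0 < V i i by rewrite lt_def Vi -dot_delta_mx Vge0.
  pose e : 'cV[R]_m := delta_mx i 0.
  pose v := (Num.sqrt (V i i))^-1 *: (V *m e).
  pose V' := V - v *m v^T.
  have dv a : dot a v ^+ 2 = dot a (V *m e) ^+ 2 / V i i.
    by rewrite dotZ exprMn exprVn sqr_sqrtr ?ltW// mulrC.
  have V'E a : dot a (V' *m a) = dot a (V *m a) - dot a v ^+ 2.
    rewrite /V' mulmxBl {1}/dot mulmxBr [LHS]mxE [in X in _ + X]mxE; congr (_ - _).
    rewrite -mulmxA (mulmxA a^T) mxE big_ord1 -/(dot a v) -/(dot v a) (dotC v).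
    by rewrite -expr2.
  have psdV' : psd V'.
    split; first by rewrite /V' linearB/= VT trmx_mul trmxK.
    (* The form of V' at a is that of V at a minus its component along e, the minimum of the form of
       V on the line a + R e. *)
    move=> a; have := Vge0 (a - (dot a (V *m e) / V i i) *: e).
    set c := dot a (V *m e).
    rewrite V'E dv -/c -scaleNr mulmxDr -scalemxAr dotD dotZ !(dotC (_ + _)) !dotD !dotZ.
    rewrite (dotC _ a) (dotC _ e) (dotC _ a) (dotC _ e) (dot_sym e a) // dot_delta_mx -/c.
    by congr (_ <= _); field.
  have [|s hs] := IH V' psdV'.
    (* Zero diagonal entries stay zero, since V_jj = 0 forces V e_j = 0, and the entry at i becomes
       zero. *)
    rewrite -ltnS; apply: leq_trans cV; apply: proper_card; apply/properP; split.
      apply/fintype.subsetP => j; rewrite !inE; apply: contra => /eqP Vj.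
      rewrite -dot_delta_mx V'E dv dot_delta_mx Vj dot_sym//.
      by rewrite (@psd_null _ V) ?expr0n ?mul0r ?subr0// dot_delta_mx.
    exists i; rewrite !inE// negbK -dot_delta_mx V'E dv !dot_delta_mx.
    by apply/eqP; field.
  by exists (v :: s) => a; rewrite big_cons -hs V'E; ring.
- exists [::] => a; rewrite big_nil (_ : V = 0) ?mul0mx /dot ?mulmx0 ?mxE//.
  apply/matrixP => i j; rewrite mxE -dot_delta_mx; apply: psd_null => //.
  by rewrite dot_delta_mx; apply/eqP/negbFE; exact: V0.
Qed.

Lemma posdef_ge0 m (V : 'M[R]_m) (a : 'cV[R]_m) : posdef V -> 0 <= (a^T *m V *m a) 0 0.
Proof.
move=> [_ Vp]; have [->|/Vp/ltW//] := eqVneq a 0.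
by rewrite mulmx0 mxE.
Qed.

Lemma gaussian_exists m (V : 'M[R]_m) : posdef V ->
  exists2 N : probability (borelV R m) R, is_centred_gaussian V N &
    forall (a : 'cV[R]_m) th,
    \int[N]_x cos (dot a x - th) = cos th * expR (- ((a^T *m V *m a) 0 0 / 2)).
Proof.
move=> pV; have psdV : psd V.
  by split; [case: pV|move=> a; rewrite /dot mulmxA posdef_ge0].
have [s hs] := psd_sum_squares psdV (leqnn _).
have [N hN] := normal_combination s.
have cN a th : \int[N]_x cos (dot a x - th) = cos th * expR (- ((a^T *m V *m a) 0 0 / 2)).
  by rewrite hN -hs /dot mulmxA.
exists N => // a B mB.
have ma : measurable_fun [set: borelV R m] (dot a : borelV R m -> R).
  by apply: continuous_borelV; exact: continuous_dot.
have V0 := posdef_ge0 a pV.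
have mcos (s0 th : R) : measurable_fun [set: R] (fun x : R => cos (s0 * x - th)).
  apply: continuous_measurable_fun => x.
  apply: (@cvg_comp _ _ _ (fun x => s0 * x - th) (@cos R) _ _ _ _ (@continuous_cos R _)).
  by apply: cvgB; [exact: cvgMr cvg_id|exact: cvg_cst].
pose v := (a^T *m V *m a) 0 0.
have cE (s0 th : R) : \int[image_prob N ma]_x cos (s0 * x - th) =
    cos th * expR (- (s0 ^+ 2 * v / 2)).
  rewrite Rintegral_image_prob; last first.
    by split; [exact: mcos|exists 1 => x; exact: cos_max].
  transitivity (\int[N]_x cos (dot (s0 *: a) x - th)).
    by apply: eq_Rintegral => x _; rewrite (dotC (_ *: _)) dotZ dotC.
  have quadE b : (b^T *m V *m b) 0 0 = dot b (V *m b) by rewrite /dot mulmxA.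
  rewrite cN quadE -scalemxAr dotZ (dotC (s0 *: a)) dotZ (dotC (V *m a)) -quadE -/v.
  by rewrite mulrA -expr2.
rewrite /centred_normal -/v; case: eqP => [v0|/eqP v0].
  transitivity (image_prob N ma B); first by [].
  rewrite (@char_unique R (image_prob N ma) (@dirac _ R (0 : R) R))// => s0 th.
  rewrite cE v0 mulr0 mul0r oppr0 expR0 mulr1 /Rintegral integral_dirac//.
    by rewrite diracT mul1e/= mulr0 sub0r cosN.
  by apply/measurable_EFinP; exact: mcos.
transitivity (image_prob N ma B); first by [].
have sv : Num.sqrt v != 0 by rewrite sqrtr_eq0 -ltNge lt_def v0.
pose g := (normal_prob (0 : R) (Num.sqrt v) : probability (measurableTypeR R) R).
(* [measurableTypeR R] and [R] have the same measurable sets but different displays. *)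
have mid : measurable_fun [set: measurableTypeR R] (id : measurableTypeR R -> R).
  by move=> _ A mA; rewrite setTI; exact: mA.
transitivity (image_prob g mid B); last by [].
apply: char_unique => // s0 th.
rewrite cE [RHS]Rintegral_image_prob; last first.
  by split; [exact: mcos|exists 1 => x; exact: cos_max].
by rewrite char_normal// sqr_sqrtr// (mulrC v).
Qed.

End gaussian_vectors.

(** * The predictive distribution functions *)

Lemma uniform_harmonic_cvg {R : realType} (u : nat -> R) (l : R) :
  (forall n, `|l - u n| <= n.+1%:R^-1) -> u @ \oo --> l.
Proof.
move=> h; apply/cvgrPdist_le => eps eps0; near=> n; apply: le_trans (h n) _.
rewrite invf_ple ?posrE//; apply: (@le_trans _ _ n%:R); last by rewrite ler_nat.
by near: n; exact: nbhs_infty_ger.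
Unshelve. all: by end_near. Qed.

Lemma Rintegral_prob_le {d : measure_display} {T : measurableType d} {R : realType}
    (P : probability T R) (f : T -> R) M :
  measurable_fun [set: T] f -> (forall w, `|f w| <= M) -> `|\int[P]_w f w| <= M.
Proof.
move=> mf fM; have intf := bounded_integrable P mf fM.
apply: le_trans (le_normr_Rintegral _ _) _ => //.
rewrite -[leRHS](Rintegral_prob_cst P); apply: le_Rintegral => //.
- exact: integrable_normr.
- exact: integrable_cst.
Qed.

Section conditional_law.
Context {d : measure_display} {T : measurableType d} {R : realType}.
Variables (P : probability T R) (S : set (set T)).
Hypotheses (sS : sigma_algebra [set: T] S) (Sm : S `<=` d.-measurable).

Local Notation intg f := (P.-integrable [set: T] (EFin \o f)).

Lemma condexp_lin a b f f' g g' : intg f -> intg f' ->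
  is_condexp P S f g -> is_condexp P S f' g' ->
  is_condexp P S (fun w => a * f w + b * f' w) (fun w => a * g w + b * g' w).
Proof.
move=> intf intf' [mg ig E] [mg' ig' E']; split.
- apply/(measurable_forP _ sS); apply: measurable_funD;
    by apply: measurable_funM => //; exact/(measurable_forP _ sS).
- by apply: integrable_add; exact: integrable_scale.
- move=> A SA; have mA := Sm SA.
  have h (u v : T -> R) : intg u -> intg v ->
      (\int[P]_(w in A) (a * u w + b * v w)%:E =
       a%:E * (\int[P]_(w in A) (u w)%:E) + b%:E * (\int[P]_(w in A) (v w)%:E))%E.
    move=> iu iv; under eq_integral do rewrite EFinD.
    rewrite integralD//; [|exact: integrable_sub (integrable_scale a iu)|
      exact: integrable_sub (integrable_scale b iv)].
    under eq_integral do rewrite EFinM.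
    rewrite integralZl//; last exact: integrable_sub iu.
    congr (_ + _)%E; under eq_integral do rewrite EFinM.
    by rewrite integralZl//; exact: integrable_sub iv.
  by rewrite !h// E// E'.
Qed.

Lemma cond_law_integral m (U : T -> 'cV[R]_m) (L : T -> probability (borelV R m) R)
    (f : borelV R m -> R) :
  measurable_fun [set: T] (U : T -> borelV R m) -> is_cond_law P S U L ->
  bounded_measurable f ->
  is_condexp P S (fun w => f (U w)) (fun w => \int[L w]_x f x).
Proof.
move=> mU hL; apply: (@bounded_measurable_ind _ (borelV R m) R (fun f =>
  is_condexp P S (fun w => f (U w)) (fun w => \int[L w]_x f x))) => {f}.
- move=> E mE; have := hL E mE.
  rewrite (_ : (fun w => fine (L w E)) = (fun w => \int[L w]_x \1_E x))//.
  by apply/funext => w; rewrite /Rintegral integral_indic// setIT.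
- move=> a b f g [mf [M fM]] [mg [M' gM']] cf cg.
  rewrite (_ : (fun w => \int[L w]_x (a * f x + b * g x)) =
      (fun w => a * \int[L w]_x f x + b * \int[L w]_x g x)); last first.
    apply/funext => w.
    have i1 := bounded_integrable (L w) mf fM.
    have i2 := bounded_integrable (L w) mg gM'.
    rewrite RintegralD//; [|exact: integrable_scale|exact: integrable_scale].
    by rewrite !RintegralZl.
  have i1 : intg (fun w => f (U w)).
    by apply: (bounded_integrable P (M := M)) => //; exact: (measurableT_comp mf mU).
  have i2 : intg (fun w => g (U w)).
    by apply: (bounded_integrable P (M := M')) => //; exact: (measurableT_comp mg mU).
  exact: condexp_lin.
- move=> f [mf [M fM]] hf.
  have /choice[g hg] : forall n : nat, exists g : borelV R m -> R,
      [/\ bounded_measurable g,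
      is_condexp P S (fun w => g (U w)) (fun w => \int[L w]_x g x) &
      forall x, `|f x - g x| <= n.+1%:R^-1] by move=> n; exact: hf.
  pose F n w := \int[L w]_x g n x.
  have mg n : measurable_fun [set: borelV R m] (g n) by case: (hg n) => [[]].
  have n1 n : n.+1%:R^-1 <= 1 :> R by rewrite invf_le1// ler1n.
  have gM n x : `|g n x| <= M + 1.
    have [_ _ /(_ x) h] := hg n; have h1 := fM x; have h2 := n1 n.
    rewrite (_ : g n x = f x - (f x - g n x)); last by rewrite opprB addrC subrK.
    by apply: le_trans (ler_normB _ _) _; apply: lerD => //; exact: le_trans h h2.
  have FM n w : `|F n w| <= M + 1 by exact: Rintegral_prob_le.
  have Fc w : F n w @[n --> \oo] --> \int[L w]_x f x.
    apply: uniform_harmonic_cvg => n.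
    rewrite /F -RintegralB//; [|exact: bounded_integrable fM|exact: bounded_integrable (gM n)].
    by apply: Rintegral_prob_le => [|x]; [exact: measurable_funB|case: (hg n)].
  have mF : measurable_for S (fun w => \int[L w]_x f x).
    apply/(measurable_forP _ sS); apply: (@measurable_fun_cvg _ (g_sigma_algebraType S) R setT (F : nat -> g_sigma_algebraType S -> R)) => [n|w _ //].
    by apply/(measurable_forP _ sS); case: (hg n) => _ [].
  have mF' := measurable_for_fun Sm mF.
  have mFn n : measurable_fun [set: T] (F n).
    by case: (hg n) => _ [h _ _] _; exact: (measurable_for_fun Sm h).
  have ifU : intg (fun w => f (U w)).
    by apply: (bounded_integrable P (M := M)) => //; exact: (measurableT_comp mf mU).
  have c1 A : measurable A -> intg (fun w => \int[L w]_x f x) /\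
      \int[P]_(w in A) F n w @[n --> \oo] --> \int[P]_(w in A) \int[L w]_x f x.
    move=> mA; apply: (Rintegral_dominated mA mFn mF' _ (integrable_cst P (M + 1))).
      by apply: aeW => w; exact: Fc.
    by apply: aeW => w n; exact: FM.
  have [iF _] := c1 _ measurableT.
  split=> // A SA; have mA := Sm SA.
  have EF (h : T -> R) : intg h ->
      (\int[P]_(w in A) (h w)%:E)%E = (\int[P]_(w in A) h w)%:E.
    by move=> ih; rewrite fineK//; apply: integrable_fin_num => //; exact: integrable_sub.
  rewrite !EF//; congr EFin; have [_ c] := c1 _ mA.
  apply: (cvg_unique (@Rhausdorff R) c).
  have [_ c2] : intg (fun w => f (U w)) /\ \int[P]_(w in A) g n (U w) @[n --> \oo] -->
      \int[P]_(w in A) f (U w).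
    apply: (Rintegral_dominated (g := fun=> M + 1) mA).
    - by move=> n; exact: (measurableT_comp (mg n) mU).
    - exact: (measurableT_comp mf mU).
    - apply: aeW => w; apply: uniform_harmonic_cvg => n; by case: (hg n).
    - exact: integrable_cst.
    - by apply: aeW => w n; exact: gM.
  apply: cvg_trans c2; apply: near_eq_cvg; apply: nearW => n.
  by case: (hg n) => _ [_ _ /(_ A SA) h] _; rewrite /Rintegral h.
Qed.

End conditional_law.

Section past_filtration.
Context {d0 : measure_display} {T : measurableType d0} {R : realType} {d : nat}.
Variables (X : nat -> T -> borelV R d) (Y : nat -> T -> R).
Hypothesis mX : forall i, (1 <= i)%N -> measurable_fun [set: T] (X i).
Hypothesis mY : forall i, (1 <= i)%N -> measurable_fun [set: T] (Y i).

Let measurable_past n : measurable_fun [set: T] (past X Y n).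
Proof.
apply/measurable_fun_tnthP => i.
rewrite (_ : _ \o _ = (fun w => (X i.+1 w, Y i.+1 w))).
  by apply: measurable_fun_pair; [exact: mX|exact: mY].
by apply/funext => w /=; rewrite tnth_mktuple.
Qed.

Lemma filtration_sigma_past : filtration (sigma_past X Y).
Proof.
split=> n.
- apply: sigma_algebra_preimage; split=> [|A mA|F mF].
  + exact: measurable0.
  + exact: measurableD.
  + exact: bigcupT_measurable.
- by move=> _ [C mC <-]; exact: measurable_past.
- move=> _ [C mC <-].
  (* The past up to n is a measurable function of the past up to n + 1: the last entry is
     dropped. *)
  pose h (z : n.+1.-tuple (borelV R d * R)%type) : n.-tuple (borelV R d * R)%type :=
    [tuple tnth z (widen_ord (leqnSn n) i) | i < n].
  have mh : measurable_fun [set: _] h.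
    apply/measurable_fun_tnthP => i.
    rewrite (_ : _ \o _ = (@tnth _ _)^~ (widen_ord (leqnSn n) i)).
      exact: measurable_tnth.
    by apply/funext => z /=; rewrite tnth_mktuple.
  exists (h @^-1` C); first by rewrite -[_ @^-1` _]setTI; exact: mh.
  rewrite !setTI; apply/seteqP; split=> w /=; congr C;
    by apply: eq_from_tnth => i; rewrite !tnth_mktuple.
Qed.

Variable K : forall n : nat, R.-pker (borelV R d * n.-tuple (borelV R d * R))%type ~> R.

Lemma measurable_for_pred_cdf n x t :
  measurable_for (sigma_past X Y n) (pred_cdf X Y K n x t).
Proof.
move=> B mB; pose k (z : n.-tuple (borelV R d * R)%type) :=
  fine (K n ((x : borelV R d), z) [set` `]-oo, t]]).
exists (k @^-1` B); last by rewrite setTI.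
rewrite -[_ @^-1` _]setTI.
have mk : measurable_fun [set: _] k.
  apply: measurableT_comp => //.
  exact: (measurableT_comp (measurable_kernel (K n) [set` `]-oo, t]] (measurable_itv _))
    (pair1_measurable (x : borelV R d))).
exact: mk.
Qed.

Lemma pred_cdf_ge0 n x t w : 0 <= pred_cdf X Y K n x t w.
Proof. by rewrite /pred_cdf fine_ge0. Qed.

Lemma pred_cdf_le1 n x t w : pred_cdf X Y K n x t w <= 1.
Proof.
have K1 : (K n ((x : borelV R d), past X Y n w) [set` `]-oo, t]] <= 1)%E.
  by rewrite -(prob_kernel (s := K n) ((x : borelV R d), past X Y n w)) le_measure// inE.
rewrite -lee_fin /pred_cdf fineK// ge0_fin_numE//.
exact: le_lt_trans K1 (ltry 1).
Qed.

End past_filtration.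

Section random_cdf.
Context {d : measure_display} {T : measurableType d} {R : realType}.
Variable P : probability T R.

Lemma is_cdf_bounded (G : R -> R) s : is_cdf G -> 0 <= G s <= 1.
Proof.
move=> [nd _ G0 G1]; apply/andP; split; apply/ler_addgt0Pr => e e0.
  near -oo_R => y; apply: (@le_trans _ _ (G y + e)).
    suff : - e <= G y by lra.
    near: y; apply: (cvgr_ge 0 G0); by lra.
  by rewrite lerD2r; apply: nd; near: y; apply: nbhs_ninfty_le; exact: num_real.
near +oo_R => y; apply: (@le_trans _ _ (G y)).
  by apply: nd; near: y; apply: nbhs_pinfty_ge; exact: num_real.
near: y; apply: (cvgr_le 1 G1); by lra.
Unshelve. all: by end_near. Qed.

Variables (F : R -> T -> R) (t : R).
Hypothesis mF : forall s, measurable_fun [set: T] (F s).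
Hypothesis cdfF : {ae P, forall w, is_cdf (F ^~ w)}.
Hypothesis t_cont : {for t, continuous (fun s => fine 'E_P[F s])}.

(* The jump at t is nonnegative and has mean zero. *)
Lemma ae_continuous_cdf : {ae P, forall w, {for t, continuous (F ^~ w)}}.
Proof.
pose f n := F (t - n.+1%:R^-1).
have [g mg hg] := ae_cvg_measurable (fun n => mF (t - n.+1%:R^-1)).
have tlt n : t - n.+1%:R^-1 <= t by rewrite gerBl.
have fc : {ae P, forall w, f ^~ w @ \oo --> g w}.
  apply: filterS cdfF => w cw; have [nd _ _ _] := cw.
  have cf : cvgn (f ^~ w).
    apply: nondecreasing_is_cvgn => [n k nk|].
      by apply: nd; rewrite lerD2l lerN2 lef_pV2 ?posrE// ler_nat.
    by exists (F t w) => _ [n _ <-]; apply: nd.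
  by rewrite (hg w _ cf).
have f1 : {ae P, forall w n, `|f n w| <= 1}.
  apply: filterS cdfF => w cw n.
  by have /andP[h0 h1] := is_cdf_bounded (t - n.+1%:R^-1) cw; rewrite ger0_norm.
have [ig cg] := Rintegral_dominated measurableT (fun n => mF (t - n.+1%:R^-1)) mg fc
  (integrable_cst P 1) f1.
have iF : P.-integrable [set: T] (EFin \o F t).
  apply: (ae_le_integrable (mF t) (integrable_cst P 1)); apply: filterS cdfF => w cw.
  by have /andP[h0 h1] := is_cdf_bounded t cw; rewrite ger0_norm.
have EF s : fine 'E_P[F s] = \int[P]_w F s w by rewrite unlock.
have Eg : \int[P]_w g w = \int[P]_w F t w.
  apply: (cvg_unique (@Rhausdorff R) cg); rewrite -EF.
  have tc : (fun n => t - n.+1%:R^-1) @ \oo --> t.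
    rewrite -[X in _ --> X]subr0; apply: cvgB; [exact: cvg_cst|exact: cvg_harmonic].
  have := cvg_comp _ _ tc t_cont; apply: cvg_trans; apply: near_eq_cvg; apply: nearW => n.
  by rewrite /= EF.
have gF : {ae P, forall w, g w <= F t w}.
  apply: filterS2 cdfF fc => w [nd _ _ _] c.
  rewrite -(cvg_lim (@Rhausdorff R) c); apply: limr_le; first exact: cvgP c.
  by apply: nearW => n; apply: nd.
have gE : {ae P, forall w, g w = F t w}.
  have := @ae_eq_integral_abs _ _ _ P setT measurableT (EFin \o (fun w => F t w - g w)).
  case.
    by apply/measurable_EFinP; exact: measurable_funB.
  move=> h _; have : ae_eq P setT (EFin \o (fun w => F t w - g w)) (cst 0%E).
    apply: h; transitivity (\int[P]_w (F t w - g w)%:E)%E.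
      apply: ae_eq_integral => //.
      - by apply: measurableT_comp => //; apply/measurable_EFinP; exact: measurable_funB.
      - by apply/measurable_EFinP; exact: measurable_funB.
      - by apply: filterS gF => w gw _ /=; rewrite ger0_norm// subr_ge0.
    rewrite -[LHS]fineK; last first.
      by apply: integrable_fin_num => //; exact: integrable_sub_fun.
    by rewrite -/(Rintegral _ _ _) RintegralB// Eg subrr.
  by apply: filterS => w /(_ I) /= [] /eqP; rewrite subr_eq0 => /eqP.
apply: filterS3 cdfF fc gE => w [nd rc _ _] c gw.
apply/left_right_continuousP; split; last exact: rc.
apply/cvgrPdist_le => e e0.
have [n hn] : exists n, F t w - f n w <= e.
  near \oo => n; exists n; rewrite -gw; apply: le_trans (ler_norm _) _.
  by near: n; move/cvgrPdist_le : c; exact.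
near=> s.
have st : s <= t by near: s; exact: nbhs_left_le.
have ns : t - n.+1%:R^-1 <= s.
  by apply/ltW; near: s; apply: nbhs_left_gt; rewrite gtrBl.
rewrite ger0_norm ?subr_ge0; last exact: nd.
by apply: le_trans hn; rewrite lerD2l lerN2; exact: nd.
Unshelve. all: by end_near. Qed.

End random_cdf.

(** * Tails of series and the polynomial rate *)

Section tails.
Context {R : realType}.

(** s n is the sum of a k over k > n. The partial sums run over j as in the stopped walks, and
    convergence is part of the statement. *)
Definition tails {V : normedModType R} (a s : nat -> V) :=
  forall n, \sum_(k < j) a (n + k).+1 @[j --> \oo] --> s n.

Lemma tails_tail (V : normedModType R) (a : nat -> V) :
  cvgn (series a) -> tails a (fun n => tail a n.+1).
Proof.
move=> ca n.
have : cvgn (fun N => \sum_(n.+1 <= k < N) a k) by rewrite is_cvg_series_restrict.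
rewrite -/(tail a n.+1) -(cvg_shiftn n.+1); apply: cvg_trans.
apply: near_eq_cvg; apply: nearW => j /=.
rewrite -{1}[n.+1]add0n big_addn addnK big_mkord.
by apply: eq_bigr => k _; rewrite addnS addnC.
Qed.

Lemma tails_image (V V' : normedModType R) (phi : V -> V') (a s : nat -> V) :
  continuous phi -> phi 0 = 0 -> {morph phi : x y / x + y} ->
  tails a s -> tails (fun k => phi (a k)) (fun n => phi (s n)).
Proof.
move=> cphi phi0 phiD ts n; have := cvg_comp _ _ (ts n) (cphi (s n)).
apply: cvg_trans; apply: near_eq_cvg; apply: nearW => j /=.
by rewrite (big_morph phi phiD phi0).
Qed.

Implicit Types (a b c s al : nat -> R).

Lemma tails_lin x y a b s s' : tails a s -> tails b s' ->
  tails (fun k => x * a k + y * b k) (fun n => x * s n + y * s' n).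
Proof.
move=> ha hb n; under eq_fun do rewrite big_split/= -!mulr_sumr.
by apply: cvgD; apply: cvgMr; [exact: ha|exact: hb].
Qed.

Arguments tails_lin x y {a b s s'}.

Lemma tails_sum (I : finType) (x : I -> R) (a s : I -> nat -> R) :
  (forall i, tails (a i) (s i)) ->
  tails (fun k => \sum_i x i * a i k) (fun n => \sum_i x i * s i n).
Proof.
move=> ha n; rewrite (_ : (fun j => _) =
    (fun j => \sum_i x i * \sum_(k < j) a i (n + k).+1)); last first.
  by apply/funext => j; rewrite exchange_big; apply: eq_bigr => i _; rewrite mulr_sumr.
apply: (@cvg_big R I +%R 0 xpredT _ _ _ _ (fun i j => x i * \sum_(k < j) a i (n + k).+1)).
  exact: add_continuous.
by move=> i _; apply: cvgMr; exact: ha.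
Qed.

Lemma tails_le a b s s' : tails a s -> tails b s' -> (forall k, a k <= b k) ->
  forall n, s n <= s' n.
Proof.
move=> ha hb ab n; apply: (ler_cvg_to (ha n) (hb n)); apply: nearW => j.
by apply: ler_sum => k _.
Qed.

Lemma tails_mul a b s s' : tails (fun k => a k ^+ 2) s -> tails (fun k => b k ^+ 2) s' ->
  exists q, tails (fun k => a k * b k) q.
Proof.
move=> ha hb; suff /choice[q hq] : forall n, exists l : R,
    \sum_(k < j) a (n + k).+1 * b (n + k).+1 @[j --> \oo] --> l by exists q.
move=> n; have c : cvgn (series (fun k => a (n + k).+1 * b (n + k).+1)).
  apply: normed_cvg; apply: (@series_le_cvg _ _
      (fun k => a (n + k).+1 ^+ 2 + b (n + k).+1 ^+ 2)) => [k|k|k|] /=.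
  - exact: normr_ge0.
  - by rewrite addr_ge0// sqr_ge0.
  - rewrite ler_norml; set x := a _; set y := b _.
    by have := sqr_ge0 (x - y); have := sqr_ge0 (x + y);
      have := sqr_ge0 x; have := sqr_ge0 y; nra.
  - apply/cvg_ex; exists (s n + s' n); rewrite seriesEord.
    by under eq_fun do rewrite big_split; exact: cvgD (ha n) (hb n).
by move/cvg_ex: c => [l hl]; exists l; rewrite seriesEord in hl.
Qed.

(** In the expanded square the cross terms are bounded by eps b^2 + a^2/eps. The tails of b^2 are
    bounded after scaling and those of a^2 vanish, so the cross terms vanish too. *)
Lemma tails_sq_perturb al a b s s' (V : R) :
  tails (fun k => a k ^+ 2) s -> tails (fun k => b k ^+ 2) s' ->
  al n ^+ 2 * s n @[n --> \oo] --> (0 : R) -> al n ^+ 2 * s' n @[n --> \oo] --> V ->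
  exists2 q, tails (fun k => (a k - b k) ^+ 2) q & al n ^+ 2 * q n @[n --> \oo] --> V.
Proof.
move=> ha hb ca cb; have [x hx] := tails_mul ha hb.
exists (fun n => 1 * (1 * s n + (- 2) * x n) + 1 * s' n).
  have := tails_lin 1 1 (tails_lin 1 (- 2) ha hx) hb.
  by congr tails; apply/funext => k; ring.
have bnd eps : 0 < eps -> forall n, `|x n| <= eps * s' n + eps^-1 * s n.
  move=> e0 n; have hs := tails_lin eps eps^-1 hb ha.
  have pt (y z : R) : - (eps * z ^+ 2 + eps^-1 * y ^+ 2) <= y * z <=
      eps * z ^+ 2 + eps^-1 * y ^+ 2.
    have e1 : 0 <= eps^-1 by rewrite invr_ge0 ltW.
    have h1 := mulr_ge0 e1 (sqr_ge0 (y - eps * z)).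
    have h2 := mulr_ge0 e1 (sqr_ge0 (y + eps * z)).
    have h3 := mulr_ge0 (ltW e0) (sqr_ge0 z).
    have h4 := mulr_ge0 e1 (sqr_ge0 y).
    move: h1 h2; rewrite (_ : eps^-1 * (y - eps * z) ^+ 2 =
      eps * z ^+ 2 + eps^-1 * y ^+ 2 - 2 * (y * z)); last by field; rewrite gt_eqF.
    rewrite (_ : eps^-1 * (y + eps * z) ^+ 2 =
      eps * z ^+ 2 + eps^-1 * y ^+ 2 + 2 * (y * z)); last by field; rewrite gt_eqF.
    by move: h3 h4; set u := eps * _; set v := eps^-1 * _; move=> *; apply/andP; split; lra.
  rewrite ler_norml; apply/andP; split.
    have hs' := tails_lin (- eps) (- eps^-1) hb ha.
    have := tails_le hs' hx; rewrite (_ : - (_ + _) =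
      - eps * s' n + - eps^-1 * s n); last by ring.
    apply=> k; have /andP[+ _] := pt (a k) (b k).
    by rewrite opprD -!mulNr.
  by apply: (tails_le hx hs) => k; have /andP[] := pt (a k) (b k).
have cx : al n ^+ 2 * x n @[n --> \oo] --> (0 : R).
  apply/cvgrPdist_le => e e0; pose B : R := `|V| + 1.
  have B0 : 0 < B by rewrite ltr_pwDr.
  (* B eventually bounds the scaled tails of b^2, so that eps B = e/2; the other half of e comes
     from the tails of a^2. *)
  pose eps := e / (2 * B).
  have eps0 : 0 < eps by rewrite divr_gt0// mulr_gt0.
  near=> n; rewrite sub0r normrN normrM ger0_norm ?sqr_ge0//.
  have h1 : al n ^+ 2 * s' n <= B.
    near: n; apply: (cvgr_le V cb); rewrite (le_lt_trans (ler_norm V))//.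
    by rewrite ltrDl.
  have h2 : al n ^+ 2 * s n <= eps * e / 2.
    by near: n; apply: (cvgr_le 0 ca); rewrite divr_gt0// mulr_gt0.
  apply: le_trans (ler_wpM2l (sqr_ge0 _) (bnd eps eps0 n)) _.
  rewrite mulrDr mulrCA (mulrCA _ eps^-1).
  have h3 := ler_wpM2l (ltW eps0) h1.
  have h4 : eps^-1 * (al n ^+ 2 * s n) <= e / 2.
    rewrite -ler_pdivlMl ?invr_gt0// invrK; apply: le_trans h2 _; rewrite mulrA//.
  have e5 : eps * B = e / 2 by rewrite /eps; field; rewrite gt_eqF.
  by rewrite e5 in h3; lra.
rewrite (_ : (fun n => _) = (fun n => al n ^+ 2 * s n + (- 2) * (al n ^+ 2 * x n) +
  al n ^+ 2 * s' n)); last by apply/funext => n; ring.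
rewrite -[V]add0r; apply: cvgD cb; rewrite -[X in _ --> X](addr0 0); apply: cvgD => //.
by rewrite -[X in _ --> X](mulr0 (- 2)); exact: cvgMr.
Unshelve. all: by end_near. Qed.

Definition negligible_sq al a :=
  exists2 s, tails (fun k => a k ^+ 2) s & al n ^+ 2 * s n @[n --> \oo] --> (0 : R).

Lemma negligible_sq_scale al a x : negligible_sq al a ->
  negligible_sq al (fun k => x * a k).
Proof.
move=> [s hs cs]; exists (fun n => x ^+ 2 * s n + 0 * s n).
  have := tails_lin (x ^+ 2) 0 hs hs.
  by congr tails; apply/funext => k; ring.
rewrite (_ : (fun n => _) = (fun n => x ^+ 2 * (al n ^+ 2 * s n))); last first.
  by apply/funext => n; ring.
by rewrite -[X in _ --> X](mulr0 (x ^+ 2)); exact: cvgMr.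
Qed.

(** Induction by [tails_sq_perturb] with limit zero; as that lemma treats differences, the new term
    enters with a minus sign. *)
Lemma negligible_sq_sum al (I : Type) (r : seq I) (a : I -> nat -> R) :
  (forall i, negligible_sq al (a i)) -> negligible_sq al (fun k => \sum_(i <- r) a i k).
Proof.
move=> ha; elim: r => [|i r [s hs cs]].
  exists (fun=> 0) => [n|].
    under eq_fun do under eq_bigr do rewrite big_nil expr0n/=.
    by under eq_fun do rewrite big1//; exact: cvg_cst.
  by under eq_fun do rewrite mulr0; exact: cvg_cst.
have [s' hs' cs'] := negligible_sq_scale (- 1) (ha i).
have [q hq cq] := tails_sq_perturb hs hs' cs cs'.
exists q => //; move: hq; congr tails; apply/funext => k.
by rewrite big_cons mulN1r opprK addrC.
Qed.

End tails.

Arguments tails_lin {R} x y {a b s s'}.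

Section power_rate.
Context {R : realType}.
Variable gam : R.
Hypotheses (gam_gt0 : 0 < gam) (gam_le1 : gam <= 1).

Definition rate (n : nat) : R := n%:R `^ (gam / 2).

Lemma rate_ge0 n : 0 <= rate n. Proof. exact: powR_ge0. Qed.

Lemma rate_gt0 n : 0 < rate n.+1. Proof. exact: powR_gt0. Qed.

Lemma rate_sqr n : rate n ^+ 2 = n%:R `^ gam.
Proof.
rewrite /rate -powR_mulrn ?powR_ge0// -powRrM; congr (_ `^ _).
by field.
Qed.

Lemma rate_nd n k : (n <= k)%N -> rate n <= rate k.
Proof.
move=> nk; apply: ge0_ler_powR; rewrite ?nnegrE ?ler0n ?ler_nat//.
by rewrite divr_ge0// ltW.
Qed.

(** The ratio is (1 + 1/n)^(gam/2), between 1 and 1 + 1/n because gam/2 <= 1. *)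
Lemma rate_ratio : rate n.+1 / rate n @[n --> \oo] --> (1 : R).
Proof.
rewrite -(cvg_shiftn 1)/=.
have c : (fun n : nat => 1 + n.+1%:R^-1 : R) @ \oo --> (1 : R).
  by rewrite -[X in _ --> X]addr0; apply: cvgD; [exact: cvg_cst|exact: cvg_harmonic].
apply: (@squeeze_cvgr _ _ _ _ (fun=> 1) _ _ _ _ _ c); last exact: cvg_cst.
apply: nearW => n; rewrite addn1.
have n0 : 0 < n.+1%:R :> R by [].
have e : rate n.+2 / rate n.+1 = (1 + n.+1%:R^-1) `^ (gam / 2).
  rewrite /rate (_ : n.+2%:R = n.+1%:R * (1 + n.+1%:R^-1)); last first.
    by rewrite mulrDr mulr1 divff ?natr1// gt_eqF.
  rewrite powRM ?addr_ge0// mulrC mulrA mulVf ?mul1r// gt_eqF//.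
have h1 : 1 <= 1 + n.+1%:R^-1 :> R by rewrite lerDl.
have g0 : 0 <= gam / 2 by rewrite divr_ge0// ltW.
have g1 : gam / 2 <= 1 by rewrite ler_pdivrMr// mul1r (le_trans gam_le1)// ler1n.
have := ler_powR h1 g0; have := ler_powR h1 g1.
by rewrite powRr0 powRr1 ?addr_ge0// e => -> ->.
Qed.

End power_rate.

Lemma ae_forall_countable {d} {T : measurableType d} {R : realType}
    (P : probability T R) (I : countType) (Q : I -> T -> Prop) :
  (forall i, {ae P, forall w, Q i w}) -> {ae P, forall w, forall i, Q i w}.
Proof.
move=> h.
have : {ae P, forall w, forall n, if unpickle n is Some i then Q i w else True}.
  by apply/ae_foralln => n; case: (unpickle n) => [i|]; [exact: h|exact: aeW].
by apply: filterS => w hw i; have := hw (pickle i); rewrite pickleK.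
Qed.

(** * From rational directions to random vectors *)

Section vector_limit.
Context {d : measure_display} {T : measurableType d} {R : realType} {m : nat}.
Variables (P : probability T R) (G : nat -> set (set T)).
Variables (F C : nat -> T -> 'cV[R]_m) (Finf : T -> 'cV[R]_m) (V : T -> 'M[R]_m).
Variable gam : R.
Local Notation al := (rate gam).
Local Notation intg f := (P.-integrable [set: T] (EFin \o f)).
Let Del k w := F k w - F k.-1 w.

Hypotheses (gam_gt0 : 0 < gam) (gam_le1 : gam <= 1).
Hypothesis fG : filtration G.
Hypothesis mF : forall n i, measurable_for (G n) (fun w => F n w i 0).
Hypothesis F01 : forall n i w, 0 <= F n w i 0 <= 1.
Hypothesis hC : forall k i, is_condexp P (G k)
  (fun w => Del k.+1 w i 0) (fun w => C k.+1 w i 0).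
Hypothesis mFinf : forall i, measurable_fun [set: T] (fun w => Finf w i 0).
Hypothesis cF : forall i, {ae P, forall w, F n w i 0 @[n --> \oo] --> Finf w i 0}.
Hypothesis Del_dominated : forall i, exists2 D, intg D &
  {ae P, forall w k, al k.+1 * `|Del k.+1 w i 0| <= D w}.
Hypothesis C_dominated : forall i, exists2 D, intg D &
  {ae P, forall w k, al k.+1 * `|C k.+1 w i 0| <= D w}.
Hypothesis C_tail : forall i, {ae P, forall w,
  cvgn (series (fun k => C k w i 0)) /\
  al n * tail (fun k => C k w i 0) n.+1 @[n --> \oo] --> (0 : R)}.
Hypothesis C_sqr : forall i, {ae P, forall w, negligible_sq al (fun k => C k w i 0)}.
Hypothesis mV : forall i j, measurable_fun [set: T] (fun w => V w i j).
Hypothesis V_posdef : {ae P, forall w, posdef (V w)}.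
Hypothesis Del_sqr : {ae P, forall w,
  cvgn (series (fun k => Del k w *m (Del k w)^T)) /\
  n%:R `^ gam *: tail (fun k => Del k w *m (Del k w)^T) n.+1 @[n --> \oo] --> V w}.

Variable L : nat -> T -> probability (borelV R m) R.
Hypothesis hL : forall n, (1 <= n)%N ->
  is_cond_law P (G n) (fun w => al n *: (F n w - Finf w)) (L n).

Let Gm n : G n `<=` d.-measurable. Proof. by case: fG. Qed.
Let Gs n : sigma_algebra [set: T] (G n). Proof. by case: fG. Qed.

Let U n w := al n *: (F n w - Finf w).

Let mFT n i : measurable_fun [set: T] (fun w => F n w i 0).
Proof. exact: (measurable_for_fun (@Gm n) (mF n i)). Qed.

Let mUi n i : measurable_fun [set: T] (fun w => U n w i 0).
Proof.
under eq_fun do rewrite /U !mxE.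
by apply: measurable_funM => //; exact: measurable_funB.
Qed.

Let mU n : measurable_fun [set: T] (U n : T -> borelV R m).
Proof. by apply: measurable_borelV => i; exact: mUi. Qed.

Let iF n i : intg (fun w => F n w i 0).
Proof.
apply: (bounded_integrable P (M := 1)) => // w.
by have /andP[h0 h1] := F01 n i w; rewrite ger0_norm.
Qed.

Let DelE k w i : Del k w i 0 = F k w i 0 - F k.-1 w i 0.
Proof. by rewrite /Del !mxE. Qed.

Section direction.
Variable u : 'cV[rat]_m.

Let e k w := qdot u (C k w) - qdot u (Del k w).
Let a : 'cV[R]_m := map_mx ratr u.
Let Vu w := (a^T *m V w *m a) 0 0.
Let W n w := qdot u (U n w).

Let qdot_dot x : qdot u x = dot a x.
Proof. by rewrite /qdot dotE; apply: eq_bigr => i _; rewrite mxE. Qed.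

Let VuE w : Vu w = \sum_i a i 0 * \sum_j V w i j * a j 0.
Proof.
rewrite /Vu -mulmxA -/(dot _ _) dotE; apply: eq_bigr => i _.
by congr (_ * _); rewrite [LHS]mxE.
Qed.

Let mVu : measurable_fun [set: T] Vu.
Proof.
rewrite (_ : Vu = fun w => \sum_i a i 0 * \sum_j V w i j * a j 0); last exact/funext.
apply: measurable_sum => i; apply: measurable_funM => //.
by apply: measurable_sum => j; exact: measurable_funM.
Qed.

Let mW n : measurable_fun [set: T] (W n).
Proof. by apply: measurable_sum => i; exact: measurable_funM. Qed.

Let me k : measurable_for (G k.+1) (e k.+1).
Proof.
have GS : G k `<=` G k.+1 by case: fG.
apply/(measurable_forP _ (Gs k.+1)).
have mi i : measurable_for (G k.+1) (fun w => C k.+1 w i 0).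
  by have [h _ _] := hC k i; exact: (measurable_for_sub GS h).
have mj i : measurable_for (G k.+1) (fun w => F k w i 0).
  exact: (measurable_for_sub GS (mF k i)).
apply: measurable_funB; apply: measurable_sum => i; apply: measurable_funM => //.
  exact/(measurable_forP _ (Gs k.+1)).
under eq_fun do rewrite DelE.
by apply: measurable_funB; exact/(measurable_forP _ (Gs k.+1)).
Qed.

Let eE k w : e k w = \sum_i ratr (u i 0) * (C k w i 0 - Del k w i 0).
Proof. by rewrite /e /qdot -sumrB; apply: eq_bigr => i _; rewrite mulrBr. Qed.

Let iDel k i : intg (fun w => Del k w i 0).
Proof.
rewrite (_ : (fun w => _) = (fun w => F k w i 0 - F k.-1 w i 0)).
  exact: integrable_sub_fun.
by apply/funext => w; exact: DelE.
Qed.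

Let iCD k i : intg (fun w => C k.+1 w i 0 - Del k.+1 w i 0).
Proof. by have [_ h _] := hC k i; exact: integrable_sub_fun. Qed.

Lemma integrable_sum_fun (I : Type) (r : seq I) (f : I -> T -> R) :
  (forall i, intg (f i)) -> intg (fun w => \sum_(i <- r) f i w).
Proof.
move=> intf; elim: r => [|i r IH].
  by under eq_fun do rewrite big_nil; exact: integrable_cst.
by under eq_fun do rewrite big_cons; exact: integrable_add.
Qed.

Lemma Rintegral_sum_fun (I : Type) (r : seq I) (f : I -> T -> R) A :
  measurable A -> (forall i, intg (f i)) ->
  \int[P]_(w in A) (\sum_(i <- r) f i w) = \sum_(i <- r) \int[P]_(w in A) f i w.
Proof.
move=> mA intf; elim: r => [|i r IH].
  by under eq_Rintegral do rewrite big_nil; rewrite big_nil Rintegral_cst// mul0r.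
under eq_Rintegral do rewrite big_cons.
rewrite RintegralD//; [|exact: integrable_sub|exact: integrable_sub (integrable_sum_fun r intf)].
by rewrite big_cons IH.
Qed.

Let ie k : intg (e k.+1).
Proof.
rewrite (_ : e k.+1 = fun w => \sum_i ratr (u i 0) * (C k.+1 w i 0 - Del k.+1 w i 0)).
  by apply: integrable_sum_fun => i; exact: integrable_scale.
by apply/funext => w; exact: eE.
Qed.

Let e_martingale k A : G k A -> \int[P]_(w in A) e k.+1 w = 0.
Proof.
move=> GA; have mA := Gm GA.
under eq_Rintegral do rewrite eE.
rewrite Rintegral_sum_fun//; last by move=> i; exact: integrable_scale.
apply: big1 => i _; have [_ iC /(_ A GA) h] := hC k i.
rewrite RintegralZl//; last exact: integrable_sub.
rewrite RintegralB//; [|exact: integrable_sub|exact: integrable_sub].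
by rewrite /Rintegral h subrr mulr0.
Qed.

Let e_dominated : exists2 D, intg D & {ae P, forall w k, al k.+1 * `|e k.+1 w| <= D w}.
Proof.
have /choice[D1 hD1] : forall i, exists D, intg D /\
  {ae P, forall w k, al k.+1 * `|Del k.+1 w i 0| <= D w}.
  by move=> i; have [D ? ?] := Del_dominated i; exists D.
have /choice[D2 hD2] : forall i, exists D, intg D /\
  {ae P, forall w k, al k.+1 * `|C k.+1 w i 0| <= D w}.
  by move=> i; have [D ? ?] := C_dominated i; exists D.
exists (fun w => \sum_i `|ratr (u i 0) : R| * (D2 i w + D1 i w)).
  apply: integrable_sum_fun => i; apply: integrable_scale; apply: integrable_add.
    by case: (hD2 i).
  by case: (hD1 i).
have h1 : {ae P, forall w i, forall k, al k.+1 * `|Del k.+1 w i 0| <= D1 i w}.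
  by apply: ae_forall_countable => i; case: (hD1 i).
have h2 : {ae P, forall w i, forall k, al k.+1 * `|C k.+1 w i 0| <= D2 i w}.
  by apply: ae_forall_countable => i; case: (hD2 i).
apply: filterS2 h1 h2 => w {}h1 {}h2 k; rewrite eE.
apply: le_trans (ler_wpM2l (rate_ge0 _ _) (ler_norm_sum _ _ _)) _.
rewrite mulr_sumr; apply: ler_sum => i _.
rewrite normrM mulrCA ler_wpM2l//.
apply: le_trans (ler_wpM2l (rate_ge0 _ _) (ler_normB _ _)) _.
by rewrite mulrDr; apply: lerD.
Qed.

(** The quadratic form at a fixed vector is linear and continuous in the matrix, and at x x^T it is
    (u.x)^2. The matrix limit thus gives the scalar one for Del, and subtracting C does not change
    it by [tails_sq_perturb]. *)
Let sum_sqr : {ae P, forall w, exists q : nat -> R,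
  (forall n, \sum_(k < j) (al n * e (n + k).+1 w) ^+ 2 @[j --> \oo] --> q n) /\
  q n @[n --> \oo] --> Vu w}.
Proof.
have hC2 := ae_forall_countable C_sqr.
apply: filterS2 hC2 Del_sqr => w {}hC2 [cD hD].
have [s hs cs] : negligible_sq al (fun k => qdot u (C k w)).
  by apply: negligible_sq_sum => i; exact: negligible_sq_scale.
pose phi (M : 'M[R]_m) : R := (a^T *m M *m a) 0 0.
have phiE M : phi M = \sum_i a i 0 * \sum_j M i j * a j 0.
  rewrite /phi -mulmxA -/(dot _ _) dotE; apply: eq_bigr => i _.
  by congr (_ * _); rewrite [LHS]mxE.
have cphi : continuous phi.
  rewrite (_ : phi = fun M => \sum_i a i 0 * \sum_j M i j * a j 0); last exact/funext.
  have ci i : continuous (fun M : 'M[R]_m => \sum_j M i j * a j 0).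
    apply: (@continuous_big R 'I_m +%R 0 xpredT) => [|j _]; first exact: add_continuous.
    by move=> M; exact: cvgMl (@coord_continuous _ _ _ i j M).
  apply: (@continuous_big R 'I_m +%R 0 xpredT) => [|i _]; first exact: add_continuous.
  by move=> M; exact: cvgMr (ci i M).
have phi0 : phi 0 = 0 by rewrite /phi mulmx0 mul0mx mxE.
have phiD : {morph phi : x y / x + y}.
  by move=> x y; rewrite /phi mulmxDr mulmxDl mxE.
have phiZ c x : phi (c *: x) = c * phi x.
  by rewrite /phi -scalemxAr -scalemxAl mxE.
have phi_sq x : phi (x *m x^T) = qdot u x ^+ 2.
  rewrite /phi qdot_dot mulmxA -mulmxA mxE big_ord1 -/(dot a x) -/(dot x a).
  by rewrite (dotC x) expr2.
have hb := tails_image cphi phi0 phiD (tails_tail cD).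
have {}hb : tails (fun k => qdot u (Del k w) ^+ 2)
    (fun n => phi (tail (fun k => Del k w *m (Del k w)^T) n.+1)).
  by move: hb; congr tails; apply/funext => k; exact: phi_sq.
have cb : al n ^+ 2 * phi (tail (fun k => Del k w *m (Del k w)^T) n.+1)
    @[n --> \oo] --> Vu w.
  have := cvg_comp _ _ hD (cphi (V w)); apply: cvg_trans.
  by apply: near_eq_cvg; apply: nearW => n /=; rewrite phiZ rate_sqr.
have [q hq cq] := tails_sq_perturb hs hb cs cb.
exists (fun n => al n ^+ 2 * q n); split=> // n.
under eq_fun do under eq_bigr do rewrite exprMn.
by under eq_fun do rewrite -mulr_sumr; apply: cvgMr; exact: hq.
Qed.

(** The increments Del telescope, so the sum of e_k over k > n is the tail of C plus u.(F_n - Finf).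
    The remainder r is the scaled tail of C. *)
Let sum_inc : {ae P, forall w, exists r : nat -> R,
  (forall n, \sum_(k < j) al n * e (n + k).+1 w @[j --> \oo] --> W n w + r n) /\
  r n @[n --> \oo] --> (0 : R)}.
Proof.
have h1 := ae_forall_countable C_tail; have h2 := ae_forall_countable cF.
apply: filterS2 h1 h2 => w {}h1 {}h2.
pose s i n := tail (fun k => C k w i 0) n.+1.
have ts i : tails (fun k => C k w i 0) (s i) by apply: tails_tail; case: (h1 i).
have tC : tails (fun k => qdot u (C k w)) (fun n => \sum_i ratr (u i 0) * s i n).
  exact: tails_sum.
have tD : tails (fun k => qdot u (Del k w)) (fun n => qdot u (Finf w) - qdot u (F n w)).
  move=> n; have E j : \sum_(k < j) qdot u (Del (n + k).+1 w) =
      qdot u (F (n + j)%N w) - qdot u (F n w).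
    elim: j => [|j IH]; first by rewrite big_ord0 addn0 subrr.
    by rewrite big_ord_recr/= IH addnS /Del/= qdot_dot !qdot_dot /dot mulmxBr !mxE; ring.
  under eq_fun do rewrite E.
  apply: cvgB; last exact: cvg_cst.
  have : qdot u (F j w) @[j --> \oo] --> qdot u (Finf w).
    apply: (@cvg_big R 'I_m +%R 0 xpredT _ _ _ _ (fun i j => ratr (u i 0) * F j w i 0)).
      exact: add_continuous.
    by move=> i _; apply: cvgMr; exact: h2.
  rewrite -(cvg_shiftn n); apply: cvg_trans.
  by apply: near_eq_cvg; apply: nearW => j /=; rewrite addnC.
exists (fun n => \sum_i ratr (u i 0) * (al n * s i n)); split=> [n|].
  under eq_fun do rewrite -mulr_sumr.
  have -> : W n w + \sum_i ratr (u i 0) * (al n * s i n) =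
      al n * (1 * (\sum_i ratr (u i 0) * s i n) +
        (- 1) * (qdot u (Finf w) - qdot u (F n w))).
    have -> : W n w = al n * (qdot u (F n w) - qdot u (Finf w)).
      rewrite /W /U -[- Finf w]scaleN1r !qdot_dot dotZ dotD dotZ; ring.
    have -> : \sum_i ratr (u i 0) * (al n * s i n) = al n * \sum_i ratr (u i 0) * s i n.
      by rewrite mulr_sumr; apply: eq_bigr => i _; rewrite mulrCA.
    by ring.
  apply: cvgMr; have := tails_lin 1 (- 1) tC tD n; apply: cvg_trans.
  by apply: near_eq_cvg; apply: nearW => j; apply: eq_bigr => k _; rewrite /e; ring.
have z : \sum_(i < m) ratr (u i 0) * 0 = 0 :> R by rewrite big1// => i _; rewrite mulr0.
rewrite -[X in _ --> X]z.
apply: (@cvg_big R 'I_m +%R 0 xpredT _ _ _ _ (fun i n => ratr (u i 0) * (al n * s i n))).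
  exact: add_continuous.
by move=> i _; apply: cvgMr; case: (h1 i).
Qed.

Let Vu_ge0 : {ae P, forall w, 0 <= Vu w}.
Proof. by apply: filterS V_posdef => w; exact: posdef_ge0. Qed.

Lemma cond_cos_direction th : {ae P, forall w,
  \int[L n w]_x cos (qdot u x - th) @[n --> \oo] --> cos th * expR (- (Vu w / 2))}.
Proof.
have [D iD eD] := e_dominated.
apply: (cond_cos_cvg fG me ie e_martingale (rate_ge0 gam) (rate_gt0 gam)
  (rate_nd gam_gt0) (rate_ratio gam_gt0 gam_le1) iD eD mVu mW sum_sqr sum_inc Vu_ge0)
  => n n0.
apply: (@cond_law_integral _ _ _ P (G n) (@Gs n) (@Gm n) m (U n) (L n)
  (fun x => cos (qdot u x - th)) (mU n) (hL n0)).
split; last by exists 1 => x; exact: cos_max.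
by apply: continuous_borelV; exact: continuous_cos_qdot.
Qed.

Lemma cond_tail_direction i : u = \col_j (if j == i then 1 else 0) -> {ae P, forall w,
  forall eps, 0 < eps -> exists A : nat, \forall n \near \oo,
  fine (L n w [set x | A.+1%:R < `|(x : 'cV[R]_m) i 0|]) <= eps}.
Proof.
move=> uE; have [D iD eD] := e_dominated.
apply: (cond_tail_cvg fG me ie e_martingale (rate_ge0 gam) (rate_gt0 gam)
  (rate_nd gam_gt0) (rate_ratio gam_gt0 gam_le1) iD eD mVu mW sum_sqr sum_inc
  (gt := fun A n w => fine (L n w [set x | A.+1%:R < `|(x : 'cV[R]_m) i 0|]))) => A n n0.
rewrite (_ : (fun w => _) = \1_(U n @^-1` [set x | A.+1%:R < `|x i 0|])).
  by apply: hL => //; exact: measurable_outside.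
apply/funext => w; rewrite indicE; congr (nat_of_bool _)%:R.
rewrite /W uE qdot_coord rmorph1 mul1r.
by apply/idP/idP; rewrite inE.
Qed.

End direction.

Lemma vector_limit : {ae P, forall w, exists N : probability (borelV R m) R,
  is_centred_gaussian (V w) N /\ weak_cvg (fun n => L n w) N}.
Proof.
(* Phases form an uncountable set. Only 0 and pi/2 are given null sets; any other phase is a
   combination of these two by the addition formula. *)
have h0 := ae_forall_countable (fun u => cond_cos_direction u 0).
have h1 := ae_forall_countable (fun u => cond_cos_direction u (pi / 2)).
have h2 := ae_forall_countable (fun i => cond_tail_direction (erefl (\col_j (if j == i then 1 else 0)))).
apply: filterS2 V_posdef (filterI h0 (filterI h1 h2)) => w pV [{}h0 [{}h1 {}h2]].
have [N gN cN] := gaussian_exists pV.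
exists N; split=> //; apply: weak_cvgP => [u th|i del del0]; last first.
  by have [A hA] := h2 i del del0; exists A.+1.
pose a : 'cV[R]_m := map_mx ratr u.
have -> : \int[N]_x cos (qdot u x - th) = cos th * expR (- ((a^T *m V w *m a) 0 0 / 2)).
  rewrite -cN; apply: eq_Rintegral => x _; congr (cos (_ - _)).
  by rewrite /qdot dotE; apply: eq_bigr => i _; rewrite mxE.
have E n : \int[L n w]_x cos (qdot u x - th) =
    cos th * \int[L n w]_x cos (qdot u x - 0) + sin th * \int[L n w]_x cos (qdot u x - pi / 2).
  have ic c : (L n w).-integrable [set: borelV R m] (EFin \o (fun x => cos (qdot u x - c))).
    apply: (@integrable_continuous _ _ _ _ 1) => [|x]; last exact: cos_max.
    exact: continuous_cos_qdot.
  rewrite -!RintegralZl// -RintegralD//; [|exact: integrable_scale|exact: integrable_scale].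
  apply: eq_Rintegral => x _; rewrite subr0 cosBpihalf cosB; ring.
under eq_fun do rewrite E.
set q := expR _; have -> : cos th * q = cos th * (cos 0 * q) + sin th * (cos (pi / 2) * q).
  by rewrite cos0 cos_pihalf; ring.
by apply: cvgD; apply: cvgMr; [exact: h0|exact: h1].
Qed.

End vector_limit.

(** * From the predictive hypotheses to the vector limit *)

Lemma sup_dominated {d} {T : measurableType d} {R : realType}
    (P : probability T R) (f : nat -> T -> R) :
  (forall k, measurable_fun [set: T] (f k)) -> (forall k w, 0 <= f k w) ->
  (\int[P]_w ereal_sup [set (f k w)%:E | k in [set k | (1 <= k)%N]] < +oo)%E ->
  exists2 D, P.-integrable [set: T] (EFin \o D) &
    {ae P, forall w k, f k.+1 w <= D w}.
Proof.
move=> mf f0; set S := fun w => ereal_sup _ => Soo.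
have S0 w : (0 <= S w)%E.
  by apply: (@le_trans _ _ (f 1%N w)%:E); [rewrite lee_fin|apply: ereal_sup_ubound; exists 1%N].
have mS : measurable_fun [set: T] S.
  apply: (@measurable_fun_esups _ _ _ setT (fun k w => (f k w)%:E)) => k.
  exact/measurable_EFinP.
have iS : P.-integrable [set: T] S.
  apply/integrableP; split=> //; apply: le_lt_trans Soo.
  by under eq_integral do rewrite gee0_abs//.
exists (fine \o S).
  apply: (@le_integrable _ _ _ P setT measurableT _ S) => //.
    by apply/measurable_EFinP; exact: measurableT_comp.
  by move=> w _ /=; case: (S w) => [r| |]//=; rewrite ?normr0 ?leey.
have := integrable_ae measurableT iS; apply: filterS => w /(_ I) fS k.
rewrite -lee_fin fineK//; apply: ereal_sup_ubound.
by exists k.+1.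
Qed.

Theorem theorem5p3
  (R : realType) (d0 : measure_display) (T : measurableType d0)
  (P : probability T R) (d : nat)
  (XX : set 'cV[R]_d) (YY : set R)
  (mXX : measurable (XX : set (borelV R d))) (mYY : measurable YY)
  (X : nat -> T -> borelV R d) (Y : nat -> T -> R)
  (mX : forall i, (1 <= i)%N -> measurable_fun [set: T] (X i))
  (mY : forall i, (1 <= i)%N -> measurable_fun [set: T] (Y i))
  (X_in : forall i w, (1 <= i)%N -> XX (X i w))
  (Y_in : forall i w, (1 <= i)%N -> YY (Y i w))
  (K : forall n : nat,
     R.-pker (borelV R d * n.-tuple (borelV R d * R))%type ~> R)
  (hK : is_predictive X Y K P)
  (* [CE k x t] is E(Delta_k(x, t) | Z_{1:k-1}) *)
  (CE : nat -> 'cV[R]_d -> R -> T -> R)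
  (hCE : forall k x t, (1 <= k)%N -> XX x ->
     is_condexp P (sigma_past X Y k.-1) (pred_incr X Y K k x t) (CE k x t))
  (m : nat) (m_gt0 : (1 <= m)%N)
  (x : 'I_m -> 'cV[R]_d) (t : 'I_m -> R) (x_in : forall i, XX (x i))
  (A1 : compact YY)
  (A2 : forall s, YY s ->
     {ae P, forall w,
       equicontinuous [set: nat]
         (fun n (z : subspace XX) => pred_cdf X Y K n z s w)})
  (A3 : forall z s, XX z ->
     {ae P, forall w,
       cvgn (series (fun k => CE k z s w)) /\
       tail (fun k => CE k z s w) n @[n --> \oo] --> (0 : R)})
  (Ft : 'cV[R]_d -> R -> T -> R)
  (mFt : forall z s, XX z -> measurable_fun [set: T] (Ft z s))
  (hFt : {ae P, forall w, forall z, XX z ->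
     is_cdf (fun s => Ft z s w) /\
     weak_cvg_cdf (fun n s => pred_cdf X Y K n z s w) (fun s => Ft z s w)})
  (t_cont : forall i,
     {for t i, continuous (fun s : R => fine 'E_P[Ft (x i) s])})
  (gam : R) (gam_gt0 : 0 < gam) (gam_le1 : gam <= 1)
  (ia_sum : forall i,
     let u (n : nat) (w : T) : R :=
       n%:R `^ (gam / 2) * tail (fun k => CE k (x i) (t i) w) n.+1 in
     {ae P, forall w,
       cvgn (series (fun k => CE k (x i) (t i) w)) /\
       u n w @[n --> \oo] --> (0 : R)} /\
     dominated_L1 P (fun n w => (u n w)%:E))
  (ia_sup : forall i,
     let u (n : nat) (w : T) : \bar R :=
       ((n%:R `^ (gam / 2))%:E *
        ereal_sup [set `|CE k (x i) (t i) w|%:E | k in [set k | (n <= k)%N]])%E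
     in
     {ae P, forall w, u n w @[n --> \oo] --> (0 : \bar R)} /\
     dominated_L1 P u)
  (ib : forall i,
     {ae P, forall w,
       cvgn (series (fun k => CE k (x i) (t i) w ^+ 2)) /\
       n%:R `^ gam * tail (fun k => CE k (x i) (t i) w ^+ 2) n
         @[n --> \oo] --> (0 : R)})
  (ii : forall i,
     (\int[P]_w ereal_sup [set (k%:R `^ (gam / 2) *
                                `|pred_incr X Y K k (x i) (t i) w|)%:E
                          | k in [set k | (1 <= k)%N]] < +oo)%E)
  (V : T -> 'M[R]_m)
  (mV : forall i j, measurable_fun [set: T] (fun w => V w i j))
  (V_posdef : {ae P, forall w, posdef (V w)})
  (iii :
     let Del (k : nat) (w : T) : 'cV[R]_m :=
       vec_at (pred_incr X Y K k) x t w in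
     {ae P, forall w,
       cvgn (series (fun k => Del k w *m (Del k w)^T)) /\
       n%:R `^ gam *: tail (fun k => Del k w *m (Del k w)^T) n.+1
         @[n --> \oo] --> V w})
  (* [L n] is L(n^(gam/2) (F_n(x, t) - Ft(x, t)) | Z_{1:n}) *)
  (L : nat -> T -> probability (borelV R m) R)
  (hL : forall n, (1 <= n)%N ->
     is_cond_law P (sigma_past X Y n)
       (fun w => n%:R `^ (gam / 2) *:
          (vec_at (pred_cdf X Y K n) x t w - vec_at Ft x t w))
       (L n)) :
  {ae P, forall w,
    exists N : probability (borelV R m) R,
      is_centred_gaussian (V w) N /\ weak_cvg (fun n => L n w) N}.
Proof.
pose F n := vec_at (pred_cdf X Y K n) x t.
pose C k := vec_at (CE k) x t.
have FE n i : (fun w => F n w i 0) = pred_cdf X Y K n (x i) (t i).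
  by apply/funext => w; rewrite /F mxE.
have CEE k i : (fun w => C k w i 0) = CE k (x i) (t i).
  by apply/funext => w; rewrite /C mxE.
have DE k i : (fun w => (F k w - F k.-1 w) i 0) = pred_incr X Y K k (x i) (t i).
  by apply/funext => w; rewrite /F !mxE.
have fG := filtration_sigma_past mX mY.
have [_ Gm _] := fG.
have mF n i : measurable_fun [set: T] (pred_cdf X Y K n (x i) (t i)).
  exact: (measurable_for_fun (@Gm n) (@measurable_for_pred_cdf _ _ _ _ X Y K n (x i) (t i))).
have mD k i : measurable_fun [set: T] (pred_incr X Y K k (x i) (t i)).
  exact: measurable_funB.
apply: (@vector_limit _ _ _ _ P (sigma_past X Y) F C (vec_at Ft x t) V gam) => //.
- by move=> n i; rewrite FE; exact: measurable_for_pred_cdf.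
- by move=> n i w; rewrite /F mxE pred_cdf_ge0 pred_cdf_le1.
- by move=> k i; rewrite DE CEE; exact: (hCE k.+1 (x i) (t i) isT (x_in i)).
- move=> i; rewrite (_ : (fun w => _) = Ft (x i) (t i)); first exact: mFt.
  by apply/funext => w; rewrite mxE.
- move=> i.
  have cdfF : {ae P, forall w, is_cdf (fun s => Ft (x i) s w)}.
    by apply: filterS hFt => w /(_ _ (x_in i))[].
  (* Weak convergence gives pointwise convergence only at continuity points; almost surely t i is
     one, by the assumption on the mean. *)
  have c := ae_continuous_cdf (fun s => mFt (x i) s (x_in i)) cdfF (t_cont i).
  apply: filterS2 hFt c => w /(_ _ (x_in i))[_ wc] c.
  rewrite mxE; have := wc (t i) c; apply: cvg_trans.
  by apply: near_eq_cvg; apply: nearW => n; rewrite /F mxE.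
- move=> i; have mr k : measurable_fun [set: T]
      (fun w => k%:R `^ (gam / 2) * `|pred_incr X Y K k (x i) (t i) w|).
    by apply: measurable_funM => //; exact: measurableT_comp.
  have [|D iD hD] := sup_dominated mr _ (ii i).
    by move=> k w; rewrite mulr_ge0// powR_ge0.
  exists D => //; apply: filterS hD => w hD k.
  by have := hD k; rewrite -DE.
(* The domination at index k + 1 covers the single term k + 1 of the supremum. *)
- move=> i; have [_ [D iD hD]] := ia_sup i; exists D => //.
  apply: filterS hD => w hD k; have := hD k.+1.
  set S := ereal_sup _ => hS; rewrite -lee_fin; apply: le_trans hS.
  have h : (`|CE k.+1 (x i) (t i) w|%:E <= S)%E.
    by apply: ereal_sup_ubound; exists k.+1 => /=.
  rewrite /C mxE EFinM abseM gee0_abs ?lee_fin ?powR_ge0//.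
  by rewrite lee_wpmul2l ?lee_fin ?powR_ge0//; apply: le_trans h _; exact: lee_abs.
- move=> i; have [h _] := ia_sum i; apply: filterS h => w [h1 h2].
  rewrite (_ : (fun k => C k w i 0) = (fun k => CE k (x i) (t i) w))//.
  by apply/funext => k; rewrite /C mxE.
- move=> i; apply: filterS (ib i) => w [h1 h2].
  rewrite (_ : (fun k => C k w i 0) = (fun k => CE k (x i) (t i) w)); last first.
    by apply/funext => k; rewrite /C mxE.
  have ts := tails_tail h1.
  have z : tails (fun=> 0 : R) (fun=> 0).
    by move=> n; under eq_fun do rewrite big1//; exact: cvg_cst.
  have s0 := tails_le z ts (fun k => sqr_ge0 _).
  exists (fun n => tail (fun k => CE k (x i) (t i) w ^+ 2) n.+1) => //.
  (* The tails assumed in (ib) start at n, those of [negligible_sq] at n + 1. The hypothesis is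
     shifted by one, and n^gam <= (n+1)^gam allows the comparison. *)
  have c : n.+1%:R `^ gam * tail (fun k => CE k (x i) (t i) w ^+ 2) n.+1
      @[n --> \oo] --> (0 : R).
    move: h2; rewrite -(cvg_shiftn 1); apply: cvg_trans; apply: near_eq_cvg.
    by apply: nearW => n /=; rewrite addn1.
  apply: (@squeeze_cvgr _ _ _ _ (fun=> 0) _ _ _ _ _ c); last exact: cvg_cst.
  apply: nearW => n; rewrite rate_sqr// mulr_ge0 ?powR_ge0//= ler_wpM2r//.
  by apply: ge0_ler_powR; rewrite ?nnegrE ?ler0n ?ler_nat// ltW.
- apply: filterS iii => w.
  rewrite (_ : (fun k => vec_at (pred_incr X Y K k) x t w *m _) =
    (fun k => (F k w - F k.-1 w) *m (F k w - F k.-1 w)^T))//.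
  apply/funext => k; rewrite (_ : vec_at (pred_incr X Y K k) x t w = F k w - F k.-1 w)//.
  by apply/matrixP => i j; rewrite !mxE.
Qed.
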